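(* Let $\mathscr{B}\subseteq\mathscr{A}$ be an inclusion of unital $*$-algebras such that the C*-enveloping algebra $B$ of $\mathscr{B}$ exists. Assume that there is a character $\varepsilon:\mathscr{A}\to\mathbb{C}$ and a bounded unital $*$-representation $\pi:\mathscr{A}\to\mathcal{B}(\mathcal{H})$ on a Hilbert space $\mathcal{H}$ such that $$\pi(b)-\varepsilon(b)\in\mathcal{L}^1(\mathcal{H})\quad\text{for all } b\in\mathscr{B}.$$ Then: (i) There is a homomorphism of unital semirings $$\mathrm{ch}:\big(\mathrm{Vect}_{\mathscr{A}}(\mathscr{B}),\oplus,\otimes_{\mathscr{B}}\big)\to\mathbb{Z}[t]/(t^2),\qquad \mathrm{ch}(\mathscr{E})=\mathrm{ch}_0(\mathscr{E})+\mathrm{ch}_1(\mathscr{E})\,t,$$ given, for any $\mathscr{E}\cong p\,\mathscr{B}^N$ (isomorphism of right $\mathscr{B}$-modules, $p\in M_N(\mathscr{B})$ idempotent), by $$\mathrm{ch}_0(\mathscr{E})=\varepsilon(\mathrm{Tr}\,p),\qquad \mathrm{ch}_1(\mathscr{E})=\mathrm{Tr}_{\mathcal{H}}\big(\pi(\mathrm{Tr}\,p)-\varepsilon(\mathrm{Tr}\,p)\big).$$ (ii) The underlying morphism of abelian semigroups is the composition of the map $\mathrm{Vect}_{\mathscr{A}}(\mathscr{B})\to K_0(B)$, $\mathscr{E}\mapsto[\mathscr{E}]$, with a homomorphism of abelian groups $[\mathrm{ch}]:K_0(B)\to\mathbb{Z}[t]/(t^2)$. (iii) If $(u,v)$ is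 a trivializing pair for $\mathscr{E}\in\mathrm{Vect}_{\mathscr{A}}(\mathscr{B})$, then the number of columns of $u$ is $r=\mathrm{ch}_0(\mathscr{E})$, and thus depends only on the K-theory class of $\mathscr{E}$.
   Context: A character is a unital $*$-homomorphism to $\mathbb{C}$; $\varepsilon(b)$ also denotes the corresponding scalar multiple of the identity on $\mathcal{H}$. $\mathcal{L}^1(\mathcal{H})$ denotes the trace class operators and $\mathrm{Tr}_{\mathcal{H}}$ the operator trace. For a square matrix $p$, $\mathrm{Tr}\,p=\sum_k p_k^k$ is the sum of the diagonal entries; $a_i^j$ is the entry of a matrix $a$ in row $i$ and column $j$. $\mathrm{Vect}_{\mathscr{A}}(\mathscr{B})$ is the collection of isomorphism classes of $\mathscr{B}$-bimodules $\mathscr{E}$ that are finitely generated and projective as right $\mathscr{B}$-modules and that trivialize over $\mathscr{A}$, meaning that there is an isomorphism $\mathscr{E}\otimes_{\mathscr{B}}\mathscr{A}\cong\mathscr{A}^r$ of right $\mathscr{A}$-modules with a free right $\mathscr{A}$-module, for some positive integer $r$. Identifying $e\in\mathscr{E}$ with $e\otimes_{\mathscr{B}}1$, one identifies $\mathscr{E}$ with a vector subspace of $\mathscr{A}^r$ (column vectors). The semiring operations are direct sum and tensor product over $\mathscr{B}$, with unit $\mathscr{B}$. A trivializing pair for $\mathscr{E}$ is a pair $(u,v)$ of an $N\times r$ matrix $u$ and an $r\times N$ matrix $v$ with entries in $\mathscr{A}$ such that $vu=1_r$, $p:=uv\in M_N(\mathscr{B})$, left multiplication by $u$ maps $\mathscr{E}\subseteq\mathscr{A}^r$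 into $\mathscr{B}^N$, left multiplication by $v$ maps $\mathscr{B}^N$ into $\mathscr{E}$, and these restrict to mutually inverse isomorphisms $\mathscr{E}\cong p\,\mathscr{B}^N$ of right $\mathscr{B}$-modules. For $\mathscr{E}\cong p\,\mathscr{B}^N$ as right $\mathscr{B}$-module, $[\mathscr{E}]\in K_0(B)$ is the class of the image of the idempotent $p$ in $M_N(B)$ under the canonical $*$-homomorphism $\mathscr{B}\to B$.
   Formalization: Closure under ⊗_B and ch(E⊗F)=ch(E)ch(F) are claimed only when F (for closure of the semiring, both factors) has a trivialization F⊗_B A≅A^r that also respects the left B-action, acting componentwise on A^r; for arbitrary left actions the product rule is false (flip-twisted B). *)

(* Defs.v *)
From HB Require Import structures.
From mathcomp Require Import all_boot all_order all_algebra finmap.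
From mathcomp Require Import boolp classical_sets reals topology normedtype.
From mathcomp Require Import summability complex qpoly.

Set Implicit Arguments.
Unset Strict Implicit.
Unset Printing Implicit Defensive.

Import Order.TTheory GRing.Theory Num.Theory.
Import numFieldNormedType.Exports.

Local Open Scope ring_scope.
Local Open Scope quotient_scope.
Local Open Scope classical_set_scope.

(* A formal sum is a list of pairs (k, x), standing for the sum of the k.x.
   Two formal sums are identified when every map from the generators to an
   abelian group that kills the relators gives them the same value.  As the
   projection onto the group <X | Rel> is such a map, this is the congruence
   generated by Rel. *)
Section Presented.
Variables (X : choiceType) (Rel : seq (int * X) -> Prop).

Definition feval (G : zmodType) (h : X -> G) (s : seq (int * X)) : G :=
  \sum_(a <- s) h a.2 *~ a.1.

Definition kills (G : zmodType) (h : X -> G) : Prop :=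
  forall r, Rel r -> feval h r = 0.

Definition pres_eq (s t : seq (int * X)) : bool :=
  `[< forall (G : zmodType) (h : X -> G), kills h -> feval h s = feval h t >].

Lemma pres_eq_equiv : equiv_class_of pres_eq.
Proof.
split=> [s|s t|t s u].
- by apply/asboolP.
- by apply/asboolP/asboolP => st G h hK; rewrite (st G h hK).
- by move=> /asboolP st /asboolP tu; apply/asboolP => G h hK; rewrite st ?tu.
Qed.

Canonical pres_equiv := EquivRelPack pres_eq_equiv.

Definition presented : Type := {eq_quot pres_equiv}.
HB.instance Definition _ := Choice.on presented.
HB.instance Definition _ := EqQuotient.on presented.

Definition fopp (s : seq (int * X)) := [seq (- a.1, a.2) | a <- s].

Lemma feval_cat (G : zmodType) (h : X -> G) s t :
  feval h (s ++ t) = feval h s + feval h t.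
Proof. by rewrite /feval big_cat. Qed.

Lemma feval_nil (G : zmodType) (h : X -> G) : feval h [::] = 0.
Proof. by rewrite /feval big_nil. Qed.

Lemma feval_cons (G : zmodType) (h : X -> G) a s :
  feval h (a :: s) = h a.2 *~ a.1 + feval h s.
Proof. by rewrite /feval big_cons. Qed.

Lemma feval_opp (G : zmodType) (h : X -> G) s : feval h (fopp s) = - feval h s.
Proof.
rewrite /feval big_map -sumrN; apply: eq_bigr => a _ /=.
by rewrite mulrNz.
Qed.

Lemma presP (s t : seq (int * X)) :
  reflect (forall (G : zmodType) (h : X -> G), kills h -> feval h s = feval h t)
          (\pi_presented s == \pi_presented t).
Proof. by rewrite eqmodE; apply: asboolP. Qed.

Lemma feval_repr (G : zmodType) (h : X -> G) s :
  kills h -> feval h (repr (\pi_presented s)) = feval h s.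
Proof. by move: h; move: G; apply/presP; rewrite reprK. Qed.

Definition pres_zero : presented := \pi_presented [::].
Definition pres_add (a b : presented) : presented := \pi_presented (repr a ++ repr b).
Definition pres_opp (a : presented) : presented := \pi_presented (fopp (repr a)).

Lemma pres_addA : associative pres_add.
Proof.
move=> a b c; apply/eqP/presP => G h hK.
by rewrite !feval_cat !feval_repr // !feval_cat addrA.
Qed.

Lemma pres_addC : commutative pres_add.
Proof.
by move=> a b; apply/eqP/presP => G h hK; rewrite !feval_cat addrC.
Qed.

Lemma pres_add0 : left_id pres_zero pres_add.
Proof.
move=> a; rewrite -[RHS]reprK; apply/eqP/presP => G h hK.
by rewrite feval_cat feval_repr // /feval big_nil add0r.
Qed.

Lemma pres_addN : left_inverse pres_zero pres_opp pres_add.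
Proof.
move=> a; apply/eqP/presP => G h hK.
by rewrite feval_cat feval_repr // feval_opp addNr /feval big_nil.
Qed.

HB.instance Definition _ :=
  GRing.isZmodule.Build presented pres_addA pres_addC pres_add0 pres_addN.

Definition pres_gen (x : X) : presented := \pi_presented [:: (1, x)].

Definition pres_lift (G : zmodType) (h : X -> G) (q : presented) : G :=
  feval h (repr q).

Lemma pres_lift_gen (G : zmodType) (h : X -> G) x :
  kills h -> pres_lift h (pres_gen x) = h x.
Proof.
by move=> hK; rewrite /pres_lift feval_repr // /feval big_seq1 mulr1z.
Qed.

Lemma pres_liftD (G : zmodType) (h : X -> G) :
  kills h -> {morph pres_lift h : a b / a + b}.
Proof. by move=> hK a b; rewrite /pres_lift feval_repr // feval_cat. Qed.

Lemma morphD_int (G G' : zmodType) (f : G -> G') :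
  {morph f : a b / a + b} -> forall k a, f (a *~ k) = f a *~ k.
Proof.
move=> fD.
have f0 : f 0 = 0 by apply: (addIr (f 0)); rewrite -fD !add0r.
have fN a : f (- a) = - f a.
  by apply: (addIr (f a)); rewrite -fD !addNr.
have fn n a : f (a *+ n) = f a *+ n.
  by elim: n => [|n IH]; rewrite ?mulr0n // !mulrS fD IH.
by case=> n a; rewrite -?pmulrn ?NegzE ?mulrNz -?pmulrn ?fN fn.
Qed.

Lemma pi_feval (s : seq (int * X)) : \pi_presented s = feval pres_gen s.
Proof.
have piD s1 t : \pi_presented (s1 ++ t) = \pi_presented s1 + \pi_presented t.
  by apply/eqP/presP => G h hK; rewrite !feval_cat !feval_repr.
have genZ (k : int) x : \pi_presented [:: (k, x)] = pres_gen x *~ k.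
  have piN s1 : \pi_presented (fopp s1) = - \pi_presented s1.
    by apply/eqP/presP => G h hK; rewrite !feval_opp feval_repr.
  have gn (n : nat) : \pi_presented [:: (n%:Z, x)] = pres_gen x *+ n.
    elim: n => [|n IH].
      by apply/eqP/presP => G h hK; rewrite /feval big_seq1 mulr0z big_nil.
    rewrite mulrS -IH -piD; apply/eqP/presP => G h hK.
    by rewrite /= !feval_cons feval_nil !addr0 /= intS mulrzDr.
  case: k => n; first by rewrite gn pmulrn.
  by rewrite NegzE mulrNz -pmulrn -gn -piN.
elim: s => [|[k x] s IH]; first by rewrite /feval big_nil.
by rewrite -cat1s piD IH genZ /feval big_cons.
Qed.

Lemma pres_ext (G : zmodType) (f g : presented -> G) :
  {morph f : a b / a + b} -> {morph g : a b / a + b} ->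
  (forall x, f (pres_gen x) = g (pres_gen x)) -> f =1 g.
Proof.
move=> fD gD fg q; rewrite -[q]reprK pi_feval /feval.
elim: (repr q) => [|a s IH].
  rewrite !big_nil.
  have z (u : presented -> G) : {morph u : a b / a + b} -> u 0 = 0.
    by move=> uD; apply: (addIr (u 0)); rewrite -uD !add0r.
  by rewrite !z.
by rewrite !big_cons fD gD IH !morphD_int // fg.
Qed.

Lemma pres_gen_rel (r : seq (int * X)) : Rel r -> feval pres_gen r = 0.
Proof.
move=> Rr; rewrite -pi_feval; apply/eqP/presP => G h hK.
by rewrite hK // /feval big_nil.
Qed.

End Presented.

(* A right T-module is an [lmodType] over the converse ring [T^c], so that
   e.t is written [(t : T^c) *: e]; the free right module of column vectors
   is ['cV[T^c]_n]. *)
Record bimodule (S T : nzRingType) := Bimodule {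
  bimod_car :> lmodType T^c;
  lact : S -> bimod_car -> bimod_car;
  lact_linear : forall s, linear (lact s);
  lactDl : forall s t x, lact (s + t) x = lact s x + lact t x;
  lactA : forall s t x, lact (s * t) x = lact s (lact t x);
  lact1 : forall x, lact 1 x = x }.

Section BimoduleTheory.
Variables (S T : nzRingType) (E : bimodule S T).

Lemma lactD (s : S) (x y : E) : lact s (x + y) = lact s x + lact s y.
Proof. by have := lact_linear s 1 x y; rewrite !scale1r. Qed.

Lemma lactZ (s : S) (t : T^c) (x : E) : lact s (t *: x) = t *: lact s x.
Proof.
have l0 : lact s (0 : E) = 0.
  by apply: (addIr (lact s 0)); rewrite -lactD !add0r.
by have := lact_linear s t x 0; rewrite l0 !addr0.
Qed.
End BimoduleTheory.

Definition bimod_iso (S T : nzRingType) (E F : bimodule S T) : Prop :=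
  exists f : {linear E -> F},
    bijective f /\ (forall s x, f (lact s x) = lact s (f x)).

Section RegularBimodule.
Variables (S T : nzRingType) (f : {rmorphism S -> T}).

Definition ext_lact (s : S) (x : (T^c)^o) : (T^c)^o := (f s * (x : T) : T).

Fact ext_lact_linear s : linear (ext_lact s).
Proof.
move=> t x y; rewrite /ext_lact mulrDr; congr (_ + _).
exact: (mulrA (f s) (x : T) (t : T)).
Qed.
Fact ext_lactD s t x : ext_lact (s + t) x = ext_lact s x + ext_lact t x.
Proof. by rewrite /ext_lact rmorphD mulrDl. Qed.
Fact ext_lactA s t x : ext_lact (s * t) x = ext_lact s (ext_lact t x).
Proof. by rewrite /ext_lact rmorphM -mulrA. Qed.
Fact ext_lact1 x : ext_lact 1 x = x.
Proof. by rewrite /ext_lact rmorph1 mul1r. Qed.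

(* T as an (S, T)-bimodule, S acting through f. *)
Definition ext_bimod : bimodule S T :=
  Bimodule ext_lact_linear ext_lactD ext_lactA ext_lact1.
End RegularBimodule.

Definition unit_bimod (S : nzRingType) : bimodule S S :=
  ext_bimod (idfun : {rmorphism S -> S}).

Section DirectSum.
Variables (S T : nzRingType) (E F : bimodule S T).

Definition sum_lact (s : S) (x : E * F) : E * F := (lact s x.1, lact s x.2).

Fact sum_lact_linear s : linear (sum_lact s).
Proof. by move=> t [x x'] [y y']; rewrite /sum_lact /= !lactD !lactZ. Qed.
Fact sum_lactD s t x : sum_lact (s + t) x = sum_lact s x + sum_lact t x.
Proof. by rewrite /sum_lact !lactDl. Qed.
Fact sum_lactA s t x : sum_lact (s * t) x = sum_lact s (sum_lact t x).
Proof. by rewrite /sum_lact /= !lactA. Qed.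
Fact sum_lact1 x : sum_lact 1 x = x.
Proof. by case: x => x y; rewrite /sum_lact /= !lact1. Qed.

Definition sum_bimod : bimodule S T :=
  Bimodule sum_lact_linear sum_lactD sum_lactA sum_lact1.
End DirectSum.

Section Tensor.
Variables (S T U : nzRingType) (E : bimodule S T) (F : bimodule T U).

Inductive tensor_rel : seq (int * (E * F)) -> Prop :=
| TensorDl (e e' : E) (f : F) :
    tensor_rel [:: (1, (e + e', f)); (-1, (e, f)); (-1, (e', f))]
| TensorDr (e : E) (f f' : F) :
    tensor_rel [:: (1, (e, f + f')); (-1, (e, f)); (-1, (e, f'))]
| TensorMid (e : E) (t : T) (f : F) :
    tensor_rel [:: (1, ((t : T^c) *: e, f)); (-1, (e, lact t f))].

Definition tensor_car : Type := presented tensor_rel.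
HB.instance Definition _ := GRing.Zmodule.on tensor_car.

Definition tens (e : E) (f : F) : tensor_car := pres_gen tensor_rel (e, f).

Lemma tensDl e e' f : tens (e + e') f = tens e f + tens e' f.
Proof.
have := pres_gen_rel (TensorDl e e' f).
rewrite !feval_cons feval_nil /= addr0 !mulrNz !mulr1z => /eqP.
by rewrite -opprD subr_eq0 => /eqP.
Qed.

Lemma tensDr e f f' : tens e (f + f') = tens e f + tens e f'.
Proof.
have := pres_gen_rel (TensorDr e f f').
rewrite !feval_cons feval_nil /= addr0 !mulrNz !mulr1z => /eqP.
by rewrite -opprD subr_eq0 => /eqP.
Qed.

Lemma tens_mid e (t : T) f : tens ((t : T^c) *: e) f = tens e (lact t f).
Proof.
have := pres_gen_rel (TensorMid e t f).
by rewrite !feval_cons feval_nil /= addr0 mulrNz !mulr1z => /eqP; rewrite subr_eq0 => /eqP.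
Qed.

Lemma kills_balanced (G : zmodType) (h : E * F -> G) :
  (forall e e' f, h (e + e', f) = h (e, f) + h (e', f)) ->
  (forall e f f', h (e, f + f') = h (e, f) + h (e, f')) ->
  (forall e (t : T) f, h ((t : T^c) *: e, f) = h (e, lact t f)) ->
  kills tensor_rel h.
Proof.
move=> hl hr hm _ [e e' f|e f f'|e t f];
  rewrite !feval_cons feval_nil /= addr0 !mulrNz !mulr1z.
- by rewrite hl -opprD subrr.
- by rewrite hr -opprD subrr.
- by rewrite hm subrr.
Qed.

Definition tensor_scale (u : U^c) : tensor_car -> tensor_car :=
  pres_lift (fun x : E * F => tens x.1 (u *: x.2)).

Definition tensor_lact (s : S) : tensor_car -> tensor_car :=
  pres_lift (fun x : E * F => tens (lact s x.1) x.2).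

Let scale_kills (u : U^c) :
  kills tensor_rel (fun x : E * F => tens x.1 (u *: x.2)).
Proof.
apply: kills_balanced => [e e' f|e f f'|e t f] /=.
- exact: tensDl.
- by rewrite scalerDr tensDr.
- by rewrite tens_mid lactZ.
Qed.

Let lact_kills (s : S) :
  kills tensor_rel (fun x : E * F => tens (lact s x.1) x.2).
Proof.
apply: kills_balanced => [e e' f|e f f'|e t f] /=.
- by rewrite lactD tensDl.
- exact: tensDr.
- by rewrite lactZ tens_mid.
Qed.

Lemma tensor_scale_tens u e f : tensor_scale u (tens e f) = tens e (u *: f).
Proof. exact: (pres_lift_gen _ (scale_kills u)). Qed.

Lemma tensor_lact_tens s e f : tensor_lact s (tens e f) = tens (lact s e) f.
Proof. exact: (pres_lift_gen _ (lact_kills s)). Qed.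

Fact tensor_scaleDr : right_distributive tensor_scale +%R.
Proof. by move=> u; exact: (pres_liftD (scale_kills u)). Qed.

Fact tensor_lactDr s : {morph tensor_lact s : x y / x + y}.
Proof. exact: (pres_liftD (lact_kills s)). Qed.

Lemma tensor_ext (G : zmodType) (f g : tensor_car -> G) :
  {morph f : a b / a + b} -> {morph g : a b / a + b} ->
  (forall e e', f (tens e e') = g (tens e e')) -> f =1 g.
Proof. by move=> fD gD fg; apply: pres_ext => // -[e e']; exact: fg. Qed.

Fact tensor_scaleA (u v : U^c) x :
  tensor_scale u (tensor_scale v x) = tensor_scale (u * v) x.
Proof.
move: x; apply: tensor_ext => [x y|x y|e f].
- by rewrite !tensor_scaleDr.
- by rewrite !tensor_scaleDr.
- by rewrite !tensor_scale_tens scalerA.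
Qed.

Fact tensor_scale1 : left_id 1 tensor_scale.
Proof.
apply: tensor_ext => [x y|x y|e f] //; first by rewrite tensor_scaleDr.
by rewrite tensor_scale_tens scale1r.
Qed.

Fact tensor_scaleDl x : {morph tensor_scale^~ x : u v / u + v}.
Proof.
move=> u v; move: x; apply: tensor_ext => [x y|x y|e f].
- by rewrite tensor_scaleDr.
- by rewrite !tensor_scaleDr addrACA.
- by rewrite !tensor_scale_tens scalerDl tensDr.
Qed.

HB.instance Definition _ := GRing.Zmodule_isLmodule.Build U^c tensor_car
  tensor_scaleA tensor_scale1 tensor_scaleDr tensor_scaleDl.

Fact tensor_lact_linear s : linear (tensor_lact s).
Proof.
move=> u x y; rewrite tensor_lactDr; congr (_ + _); move: x.
apply: tensor_ext => [x z|x z|e f].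
- by rewrite scalerDr tensor_lactDr.
- by rewrite tensor_lactDr scalerDr.
- have -> : u *: tens e f = tens e (u *: f) by exact: tensor_scale_tens.
  rewrite !tensor_lact_tens; symmetry; exact: tensor_scale_tens.
Qed.

Fact tensor_lactDl s t x : tensor_lact (s + t) x = tensor_lact s x + tensor_lact t x.
Proof.
move: x; apply: tensor_ext => [x y|x y|e f].
- by rewrite tensor_lactDr.
- by rewrite !tensor_lactDr addrACA.
- by rewrite !tensor_lact_tens lactDl tensDl.
Qed.

Fact tensor_lactA s t x : tensor_lact (s * t) x = tensor_lact s (tensor_lact t x).
Proof.
move: x; apply: tensor_ext => [x y|x y|e f].
- by rewrite tensor_lactDr.
- by rewrite !tensor_lactDr.
- by rewrite !tensor_lact_tens lactA.
Qed.

Fact tensor_lact1 x : tensor_lact 1 x = x.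
Proof.
move: x; apply: tensor_ext => [x y|x y|e f] //; first by rewrite tensor_lactDr.
by rewrite tensor_lact_tens lact1.
Qed.

Definition tensor_bimod : bimodule S U :=
  Bimodule tensor_lact_linear tensor_lactDl tensor_lactA tensor_lact1.
End Tensor.

Definition finitely_generated (R : nzRingType) (M : lmodType R) : Prop :=
  exists (n : nat) (f : {linear 'cV[R]_n -> M}), forall x, exists y, f y = x.

Definition projective (R : nzRingType) (P : lmodType R) : Prop :=
  forall (M N : lmodType R) (g : {linear M -> N}) (f : {linear P -> N}),
    (forall y, exists x, g x = y) ->
    exists h : {linear P -> M}, forall x, g (h x) = f x.

(* E is isomorphic, as a right T-module, to p T^N. *)
Definition iso_idem (S T : nzRingType) (E : bimodule S T) (N : nat)
    (p : 'M[T]_N) : Prop :=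
  exists f : {linear E -> 'cV[T^c]_N}, injective f /\
    (forall x : 'cV[T]_N,
       (exists e, (f e : 'cV[T]_N) = x) <-> (exists y : 'cV[T]_N, x = p *m y)).

Section Vect.
Variables (B A : nzRingType) (iota : {rmorphism B -> A}).

Definition trivialization (E : bimodule B B) (r : nat)
    (Phi : {linear tensor_bimod E (ext_bimod iota) -> 'cV[A^c]_r}) : Prop :=
  bijective Phi.

(* The left action of B on A^r is componentwise left multiplication. *)
Definition left_compatible (E : bimodule B B) (r : nat)
    (Phi : {linear tensor_bimod E (ext_bimod iota) -> 'cV[A^c]_r}) : Prop :=
  forall b x, (Phi (lact b x) : 'cV[A]_r) = iota b *: (Phi x : 'cV[A]_r).

Definition in_Vect (E : bimodule B B) : Prop :=
  [/\ finitely_generated E, projective E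
    & exists (r : nat) Phi, (0 < r)%N /\ @trivialization E r Phi].

(* Same, with a trivialization that also respects the left actions of B, so
   that E is a sub-B-bimodule of A^r.  Left actions on an arbitrary element of
   [in_Vect] may be twisted (for instance by an automorphism of B that does
   not extend to A); the tensor product over B then need not stay in [in_Vect],
   whereas [in_Vect_bi] is closed under it. *)
Definition in_Vect_bi (E : bimodule B B) : Prop :=
  [/\ finitely_generated E, projective E
    & exists (r : nat) Phi,
        [/\ (0 < r)%N, @trivialization E r Phi & left_compatible Phi]].

(* e |-> e (x) 1, seen in A^r. *)
Definition embed (E : bimodule B B) (r : nat)
    (Phi : {linear tensor_bimod E (ext_bimod iota) -> 'cV[A^c]_r}) (e : E) :
    'cV[A]_r :=
  Phi (tens (F := ext_bimod iota) e (1 : A)).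

Definition trivializing_pair (E : bimodule B B) (r : nat)
    (Phi : {linear tensor_bimod E (ext_bimod iota) -> 'cV[A^c]_r}) (N : nat)
    (u : 'M[A]_(N, r)) (v : 'M[A]_(r, N)) : Prop :=
  v *m u = 1%:M /\
  exists (p : 'M[B]_N) (f : {linear E -> 'cV[B^c]_N})
         (g : {linear 'cV[B^c]_N -> E}),
    [/\ map_mx iota p = u *m v,
        forall e, map_mx iota (f e : 'cV[B]_N) = u *m embed Phi e,
        forall y : 'cV[B]_N, embed Phi (g y) = v *m map_mx iota y,
        forall e, (exists y : 'cV[B]_N, (f e : 'cV[B]_N) = p *m y) /\ g (f e) = e
      & forall y : 'cV[B]_N, f (g (p *m y)) = p *m y].
End Vect.

Section K0.
Variable R : nzRingType.

Definition is_idem (x : {n : nat & 'M[R]_n}) : bool :=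
  tagged x *m tagged x == tagged x.
Definition idem_mx := {x : {n : nat & 'M[R]_n} | is_idem x}.

Definition mk_idem (n : nat) (p : 'M[R]_n) (pp : p *m p = p) : idem_mx :=
  exist (fun x => is_idem x) (Tagged (fun n => 'M[R]_n) p) (introT eqP pp).

Inductive K0_rel : seq (int * idem_mx) -> Prop :=
| K0Equiv m n (p : 'M[R]_m) (q : 'M[R]_n) pp qq
    (x : 'M[R]_(m, n)) (y : 'M[R]_(n, m)) :
    p = x *m y -> q = y *m x ->
    K0_rel [:: (1, @mk_idem m p pp); (-1, @mk_idem n q qq)]
| K0Sum m n (p : 'M[R]_m) (q : 'M[R]_n) pp qq pq :
    K0_rel [:: (1, @mk_idem (m + n) (block_mx p 0 0 q) pq);
               (-1, @mk_idem m p pp); (-1, @mk_idem n q qq)].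

(* The Grothendieck group of the semigroup of idempotent matrices up to
   algebraic (Murray-von Neumann) equivalence. *)
Definition K0 : Type := presented K0_rel.
HB.instance Definition _ := GRing.Zmodule.on K0.

Definition K0_class (n : nat) (p : 'M[R]_n) (pp : p *m p = p) : K0 :=
  pres_gen K0_rel (mk_idem pp).
End K0.

(* kappa is the image [E] of E in K_0(T'), along f : T -> T'. *)
Definition K0_image (S T T' : nzRingType) (f : {rmorphism T -> T'})
    (E : bimodule S T) (kappa : K0 T') : Prop :=
  exists (N : nat) (p : 'M[T]_N) (pp : map_mx f p *m map_mx f p = map_mx f p),
    [/\ p *m p = p, iso_idem E p & kappa = K0_class pp].

#[key="A"]
HB.mixin Record isStar (R : realType) A of GRing.Algebra R[i] A := {
  star : A -> A;
  starD : forall x y, star (x + y) = star x + star y;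
  starZ : forall (k : R[i]) x, star (k *: x) = k^* *: star x;
  starM : forall x y, star (x * y) = star y * star x;
  starK : forall x, star (star x) = x }.

#[short(type="starAlgType")]
HB.structure Definition StarAlgebra (R : realType) :=
  {A of isStar R A & GRing.Algebra R[i] A}.

Definition star_preserving (R : realType) (A B : starAlgType R) (f : A -> B) :=
  forall x, f (star x) = star (f x).

Record hilbertType (R : realType) := Hilbert {
  hilbert_car :> completeNormedModType R[i];
  inner : hilbert_car -> hilbert_car -> R[i];
  inner_linear : forall k x y z,
    inner (k *: x + y) z = k * inner x z + inner y z;
  inner_conj : forall x y, inner y x = (inner x y)^*;
  inner_norm : forall x, inner x x = `|x| ^+ 2 }.

Section Operators.
Variables (R : realType) (H : hilbertType R).
Implicit Types T P : H -> H.

Definition bounded_op T : Prop :=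
  linear T /\ exists M : R, forall x, `|T x| <= M%:C%C * `|x|.

Definition orthonormal_basis (I : choiceType) (e : I -> H) : Prop :=
  (forall i j, inner (e i) (e j) = (i == j)%:R) /\
  (forall x, (forall i, inner x (e i) = 0) -> x = 0).

(* The sum of <T e_i, e_i> is unconditionally convergent, with value tau,
   for every orthonormal basis. *)
Definition has_trace T (tau : R[i]) : Prop :=
  forall (I : choiceType) (e : I -> H), orthonormal_basis e ->
    partial_sum (fun i => inner (T (e i)) (e i) : R[i]^o) @ totally
      --> (tau : R[i]^o).

(* P = |T| = (T^* T)^(1/2). *)
Definition is_abs T P : Prop :=
  [/\ bounded_op P, forall x, 0 <= inner (P x) x
    & forall x y, inner (P (P x)) y = inner (T x) (T y)].

Definition trace_class T : Prop :=
  bounded_op T /\ exists P, is_abs T P /\ exists tau, has_trace P tau.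
End Operators.

Record is_rep (R : realType) (A : starAlgType R) (H : hilbertType R)
    (pi : A -> H -> H) : Prop := IsRep {
  rep_bounded : forall a, bounded_op (pi a);
  rep_linear : forall k a b x, pi (k *: a + b) x = k *: pi a x + pi b x;
  rep1 : forall x, pi 1 x = x;
  repM : forall a b x, pi (a * b) x = pi a (pi b x);
  rep_star : forall a x y, inner (pi a x) y = inner x (pi (star a) y) }.

Record is_cstar_norm (R : realType) (B : starAlgType R) (nrm : B -> R) : Prop :=
  IsCstarNorm {
  cnorm0 : forall x, nrm x = 0 -> x = 0;
  cnormD : forall x y, nrm (x + y) <= nrm x + nrm y;
  cnormZ : forall (k : R[i]) x, (nrm (k *: x))%:C%C = `|k| * (nrm x)%:C%C;
  cnormM : forall x y, nrm (x * y) <= nrm x * nrm y;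
  cnorm_star : forall x, nrm (star x * x) = nrm x ^+ 2;
  cnorm_complete : forall u : nat -> B,
    (forall eps, 0 < eps -> exists n0, forall m n, (n0 <= m)%N -> (n0 <= n)%N ->
       nrm (u m - u n) < eps) ->
    exists l, forall eps, 0 < eps -> exists n0, forall n, (n0 <= n)%N ->
       nrm (u n - l) < eps }.

(* (B, nrm) with j : B0 -> B is the completion of B0 for the largest
   C*-seminorm, i.e. the supremum of |rho(b)| over the bounded unital
   *-representations rho of B0, which is thereby finite. *)
Record is_cstar_envelope (R : realType) (B0 B : starAlgType R) (nrm : B -> R)
    (j : B0 -> B) : Prop := IsCstarEnvelope {
  envelope_norm : is_cstar_norm nrm;
  envelope_star : star_preserving j;
  envelope_dense : forall x eps, 0 < eps -> exists b, nrm (x - j b) < eps;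
  envelope_ub : forall (H : hilbertType R) (rho : B0 -> H -> H), is_rep rho ->
    forall b x, `|rho b x| <= (nrm (j b))%:C%C * `|x|;
  envelope_lub : forall b (M : R), 0 <= M ->
    (forall (H : hilbertType R) (rho : B0 -> H -> H), is_rep rho ->
      forall x, `|rho b x| <= M%:C%C * `|x|) ->
    nrm (j b) <= M }.

Definition Zdual : comNzRingType := {poly %/ ('X^2 : {poly int})}.
Definition zdual (a b : int) : Zdual := in_qpoly 'X^2 (a%:P + b *: 'X).

(* Main.v *)
(* The pair b |-> (pi b, eps b) extends to the C*-envelope, with values in the
   operators that are scalar, with scalar eps b, modulo the compact operators.
   An idempotent matrix P over such operators is equivalent, through one Neumann
   inverse, to an idempotent e that is scalar modulo finite rank operators.  The
   trace of e minus its scalar part is an integer, being a difference of traces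
   of idempotent complex matrices, and depends only on the class of P because an
   equivalence can be approximated by one that is scalar modulo finite rank: it
   is the index of P, defined on K_0 of the envelope.  Over B every matrix
   involved is scalar modulo trace class operators, so the index of P is also
   the trace of P minus its scalar part, that is Tr(pi(Tr p) - eps(Tr p)).

   If F is trivialized by (u, v), with v u = 1, then b in B acts on F through
   u b v, and the idempotent of E (x) F has trace Tr(u b v) with b = Tr(p_E).
   Writing pi(b) = eps(b) + d with d of trace class, Tr(u d v) = Tr(d v u) =
   r Tr(d), which is the product rule. *)
Require Import Defs.
From HB Require Import structures.
From mathcomp Require Import all_boot all_order all_algebra finmap.
From mathcomp Require Import boolp classical_sets reals topology normedtype.
From mathcomp Require Import summability complex qpoly ring lra.

Set Implicit Arguments.
Unset Strict Implicit.
Unset Printing Implicit Defensive.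

Import Order.TTheory GRing.Theory Num.Theory.
Import numFieldNormedType.Exports.

Local Open Scope ring_scope.

(** * Complete norms and the Neumann series *)

(** The obstacle is that [nrm] controls only operator norms, for which the trace is not continuous:
    the map sending b to Tr(pi(b) - eps(b)) need not extend to the envelope, where that difference
    is merely compact. The integer survives because idempotents are rigid, and passing to finite
    rank idempotents lets algebra alone express this rigidity. Idempotents are not made self-adjoint
    and no functional calculus occurs: a complete submultiplicative norm, the Neumann series and
    three nested ideals (finite rank, trace class, norm closure of finite rank) suffice, so the
    index is developed over an abstract ring with such data and specialised afterwards. A Neumann
    inverse satisfies g = 1 + w g, hence it is scalar modulo any ideal containing w, closed or not;
    thus one construction serves both the compact and the trace class situation. On the module side
    everything is expressed in dual bases, so that ch is read off from the sum of the phi_i(g_i) and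
    the semiring laws become identities between finite sums. *)

Record complete_norm (R : realType) (S : pzRingType) (nu : S -> R) : Prop :=
  CompleteNorm {
  nu0 : nu 0 = 0;
  nu0_eq0 : forall x, nu x = 0 -> x = 0;
  nuN : forall x, nu (- x) = nu x;
  nuD : forall x y, nu (x + y) <= nu x + nu y;
  nuM : forall x y, nu (x * y) <= nu x * nu y;
  nu_complete : forall u : nat -> S,
    (forall e, 0 < e -> exists n0, forall m n, (n0 <= m)%N -> (n0 <= n)%N ->
       nu (u m - u n) < e) ->
    exists l, forall e, 0 < e -> exists n0, forall n, (n0 <= n)%N ->
       nu (u n - l) < e }.

Lemma small_half_power (R : realType) (a e : R) :
  0 < e -> exists n0, forall n, (n0 <= n)%N -> a * (2^-1) ^+ n < e.
Proof.
move=> e0; exists (Num.bound (`|a| / e)) => n le_n.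
have /upper_nthrootP := le_n; rewrite ltr_pdivrMr // => h.
apply: le_lt_trans (_ : `|a| * (2^-1) ^+ n < e).
  by rewrite ler_wpM2r ?ler_norm // exprn_ge0 // invr_ge0.
by rewrite exprVn ltr_pdivrMr ?exprn_gt0 // mulrC.
Qed.

Section CompleteNormTheory.
Variables (R : realType) (S : pzRingType) (nu : S -> R).
Hypothesis nuP : complete_norm nu.

Lemma nu_ge0 x : 0 <= nu x.
Proof.
have := nuD nuP x (- x); rewrite subrr (nu0 nuP) (nuN nuP) => h; lra.
Qed.

Lemma nuB x y : nu (x - y) <= nu x + nu y.
Proof. by rewrite -(nuN nuP y) (nuD nuP). Qed.

Lemma nuBC x y : nu (x - y) = nu (y - x).
Proof. by rewrite -(nuN nuP) opprB. Qed.

Lemma nu_sum I (r : seq I) (P : pred I) (F : I -> S) :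
  nu (\sum_(i <- r | P i) F i) <= \sum_(i <- r | P i) nu (F i).
Proof.
elim/big_rec2: _ => [|i y1 y2 _ h]; first by rewrite (nu0 nuP).
by apply: le_trans (nuD nuP _ _) _; rewrite lerD2l.
Qed.

Lemma nu_small_eq0 (x : S) : (forall e, 0 < e -> nu x <= e) -> x = 0.
Proof.
move=> h; apply: (nu0_eq0 nuP); apply/le_anti; rewrite nu_ge0 andbT.
by apply/ler_addgt0Pr => e e0; rewrite add0r h.
Qed.

(** The geometric series of [w] is Cauchy and its sum inverts 1 - w. Any bound below 1 would do;
    with 1/2 the tails have a closed form. *)
Lemma neumann (w : S) : nu w <= 2^-1 ->
  exists c, (1 - w) * c = 1 /\ c * (1 - w) = 1.
Proof.
move=> w_small.
(* The factor [nu 1] is needed at n = 0: for the entrywise norm on matrices the identity does not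
   have norm 1. *)
have pw n : nu (w ^+ n) <= nu 1 * (2^-1) ^+ n.
  elim: n => [|n IH]; first by rewrite !expr0 mulr1.
  rewrite exprS; apply: le_trans (nuM nuP _ _) _.
  by rewrite exprS mulrCA; apply: ler_pM; rewrite ?nu_ge0.
pose s n := \sum_(i < n) w ^+ i.
(* The bound is the exact sum of [nu 1] times the powers of 1/2 with exponents n to n + k - 1; being
   exact, it closes the induction on k. *)
have tail n k : nu (s (n + k)%N - s n) <= nu 1 * (2^-1) ^+ n * 2 * (1 - (2^-1) ^+ k).
  elim: k => [|k IH]; first by rewrite addn0 subrr (nu0 nuP) expr0 subrr mulr0.
  rewrite addnS {1}/s big_ord_recr /= -/(s (n + k)%N) addrAC.
  apply: le_trans (nuD nuP _ _) _; apply: le_trans (lerD IH (pw _)) _.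
  rewrite exprD exprS le_eqVlt; apply/orP; left; apply/eqP.
  by set a := nu 1; set x := _ ^+ n; set y := _ ^+ k; field.
have cau e : 0 < e -> exists n0, forall n, (n0 <= n)%N -> forall k, nu (s (n + k)%N - s n) < e.
  move=> e0; have [n0 h] := small_half_power (nu 1 * 2) e0.
  exists n0 => n /h {}h k; apply: le_lt_trans (tail n k) (le_lt_trans _ h).
  have hk : (2^-1 : R) ^+ k >= 0 by rewrite exprn_ge0 // invr_ge0.
  have hn : (2^-1 : R) ^+ n >= 0 by rewrite exprn_ge0 // invr_ge0.
  rewrite [in leRHS]mulrAC ler_piMr //; last by lra.
  by rewrite !mulr_ge0 // nu_ge0.
have [e e0|c cP] := nu_complete nuP (u := s).
  have [n0 h] := cau _ e0; exists n0 => m n hm hn.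
  have [mn|/ltnW nm] := leqP m n.
    by rewrite nuBC -(subnKC mn); exact: h.
  by rewrite -(subnKC nm); exact: h.
have sl n : (1 - w) * s n = 1 - w ^+ n by rewrite -opprB mulNr -subrX1 opprB.
have sr n : s n * (1 - w) = 1 - w ^+ n.
  rewrite -sl; apply/commr_sym/commr_sum => i _; apply/commrX/commr_sym.
  by apply: commrB; [exact: commr1|exact: commr_refl].
(* One index n makes both error terms of (1 - w) c - 1 = (1 - w)(c - s_n) - w^n small, and the same
   n serves the other side. Adding 1 to nu(1 - w) keeps the divisor positive. *)
have err e : 0 < e -> exists n, (nu (1 - w) + 1) * nu (c - s n) < e /\ nu (w ^+ n) < e.
  move=> e0; have q0 : 0 < nu (1 - w) + 1 by have := nu_ge0 (1 - w); lra.
  have [n0 h0] := cP _ (divr_gt0 e0 q0); have [n1 h1] := small_half_power (nu 1) e0.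
  exists (maxn n0 n1); have := h0 _ (leq_maxl n0 n1); rewrite ltr_pdivlMr // mulrC nuBC.
  by split=> //; apply: le_lt_trans (pw _) (h1 _ (leq_maxr n0 n1)).
have est a b n e : a = b - w ^+ n -> nu b <= nu (1 - w) * nu (c - s n) ->
    (nu (1 - w) + 1) * nu (c - s n) < e / 2 -> nu (w ^+ n) < e / 2 -> nu a <= e.
  move=> -> hb hn hw; apply: le_trans (nuB _ _) _.
  have := nu_ge0 (c - s n); lra.
exists c; split; apply/eqP; rewrite -subr_eq0; apply/eqP/nu_small_eq0 => e e0;
  have [n [hn hw]] := err _ (divr_gt0 e0 (ltr0Sn R 1)).
- apply: (est _ ((1 - w) * (c - s n)) n) => //; last exact: nuM nuP _ _.
  by rewrite mulrBr sl opprB addrAC addrA subrK.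
- apply: (est _ ((c - s n) * (1 - w)) n) => //; last by rewrite mulrC; exact: nuM nuP _ _.
  by rewrite mulrBl sr opprB addrAC addrA subrK.
Qed.

End CompleteNormTheory.

(** * Matrices over a ring with a complete norm *)

Section MatrixNorm.
Variables (R : realType) (S : pzRingType) (nu : S -> R).
Hypothesis nuP : complete_norm nu.

(** The entrywise sum is submultiplicative for rectangular products as well, and allows
    approximation entry by entry. *)
Definition mxnu m n (X : 'M[S]_(m, n)) : R := \sum_i \sum_j nu (X i j).

Lemma mxnu_ge m n (X : 'M[S]_(m, n)) i j : nu (X i j) <= mxnu X.
Proof.
rewrite /mxnu (bigD1 i) //= (bigD1 j) //= -!addrA lerDl.
by rewrite addr_ge0 ?sumr_ge0 // => *; rewrite ?sumr_ge0 // => *; exact: nu_ge0.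
Qed.

Lemma mxnu_ge0 m n (X : 'M[S]_(m, n)) : 0 <= mxnu X.
Proof. by rewrite !sumr_ge0 // => *; rewrite sumr_ge0 // => *; exact: nu_ge0. Qed.

Lemma mxnuD m n (X Y : 'M[S]_(m, n)) : mxnu (X + Y) <= mxnu X + mxnu Y.
Proof.
rewrite -big_split ler_sum // => i _; rewrite -big_split ler_sum // => j _.
by rewrite mxE (nuD nuP).
Qed.

Lemma mxnuM m n p (X : 'M[S]_(m, n)) (Y : 'M[S]_(n, p)) :
  mxnu (X *m Y) <= mxnu X * mxnu Y.
Proof.
rewrite /mxnu mulr_suml ler_sum // => i _.
apply: (@le_trans _ _ (\sum_j \sum_k nu (X i k) * nu (Y k j))).
  apply: ler_sum => j _; rewrite mxE; apply: le_trans (nu_sum nuP _ _ _) _.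
  by apply: ler_sum => k _; exact: nuM nuP _ _.
rewrite exchange_big mulr_suml ler_sum // => k _ /=.
rewrite -mulr_sumr ler_wpM2l ?nu_ge0 //.
by rewrite [leRHS](bigD1 k) //= lerDl sumr_ge0 // => *; rewrite sumr_ge0 // => *; exact: nu_ge0.
Qed.

Lemma complete_mxnu n : complete_norm (@mxnu n n).
Proof.
split.
- by rewrite /mxnu big1 // => i _; rewrite big1 // => j _; rewrite mxE (nu0 nuP).
- move=> X X0; apply/matrixP => i j; rewrite mxE; apply: (nu0_eq0 nuP).
  by apply/le_anti; rewrite (nu_ge0 nuP) -{1}X0 mxnu_ge.
- by move=> X; apply: eq_bigr => i _; apply: eq_bigr => j _; rewrite mxE (nuN nuP).
- exact: mxnuD.
- exact: mxnuM.
move=> u cau.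
have lim i j : exists l, forall e, 0 < e -> exists n0, forall k, (n0 <= k)%N ->
    nu (u k i j - l) < e.
  apply: (nu_complete nuP) => e /cau [n0 h]; exists n0 => p q hp hq.
  by apply: le_lt_trans (h _ _ hp hq); rewrite -[X in nu X](_ : (u p - u q) i j = _) ?mxnu_ge // !mxE.
pose l i j := projT1 (cid (lim i j)).
exists (\matrix_(i, j) l i j) => e e0.
(* The successor covers n = 0 and makes the sum of the n * n entry bounds strictly smaller than
   [e]. *)
have e'0 : 0 < e / (n * n).+1%:R by rewrite divr_gt0.
have N i j : exists n0, forall k, (n0 <= k)%N -> nu (u k i j - l i j) < e / (n * n).+1%:R.
  by rewrite /l; case: cid => /= x; apply.
pose N' i j := projT1 (cid (N i j)).
exists (\max_i \max_j N' i j) => k hk.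
have bd i j : nu (u k i j - l i j) <= e / (n * n).+1%:R.
  apply: ltW; rewrite /N' in hk; have := projT2 (cid (N i j)); apply.
  apply: leq_trans hk; apply: leq_trans (leq_bigmax (F := fun i => \max_j N' i j) i).
  exact: (leq_bigmax (F := N' i) j).
apply: le_lt_trans (_ : \sum_(i < n) \sum_(j < n) e / (n * n).+1%:R < e).
  by apply: ler_sum => i _; apply: ler_sum => j _; rewrite !mxE.
rewrite !sumr_const !card_ord -mulrnA -[ltLHS]mulr_natr -mulrA gtr_pMr // mulrC.
by rewrite ltr_pdivrMr // mul1r ltr_nat.
Qed.

End MatrixNorm.

(** * The index of idempotents that are scalar modulo an ideal *)

Record ideal (S : pzRingType) (I : S -> Prop) : Prop := Ideal {
  ideal0 : I 0;
  idealD : forall x y, I x -> I y -> I (x + y);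
  idealMl : forall x y, I y -> I (x * y);
  idealMr : forall x y, I x -> I (x * y) }.

Definition mx_in (S : Type) (I : S -> Prop) m n (X : 'M[S]_(m, n)) : Prop :=
  forall i j, I (X i j).

Section MatrixIdeal.
Variables (S : pzRingType) (I : S -> Prop).
Hypothesis idI : ideal I.

Lemma idealN x : I x -> I (- x).
Proof. by move=> Ix; rewrite -mulN1r; apply: idealMl. Qed.

Lemma ideal_sum J (r : seq J) (P : pred J) (f : J -> S) :
  (forall i, P i -> I (f i)) -> I (\sum_(i <- r | P i) f i).
Proof.
by move=> h; elim/big_ind: _ => //; [exact: ideal0|move=> x y; exact: idealD].
Qed.

Lemma mx_in0 m n : mx_in I (0 : 'M[S]_(m, n)).
Proof. by move=> i j; rewrite mxE; exact: ideal0. Qed.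

Lemma mx_inD m n (X Y : 'M[S]_(m, n)) : mx_in I X -> mx_in I Y -> mx_in I (X + Y).
Proof. by move=> IX IY i j; rewrite mxE; apply: idealD. Qed.

Lemma mx_inN m n (X : 'M[S]_(m, n)) : mx_in I X -> mx_in I (- X).
Proof. by move=> IX i j; rewrite mxE; apply: idealN. Qed.

Lemma mx_inB m n (X Y : 'M[S]_(m, n)) : mx_in I X -> mx_in I Y -> mx_in I (X - Y).
Proof. by move=> IX IY; apply: mx_inD => //; apply: mx_inN. Qed.

Lemma mx_inMl m n p (X : 'M[S]_(m, n)) (Y : 'M[S]_(n, p)) :
  mx_in I Y -> mx_in I (X *m Y).
Proof.
by move=> IY i j; rewrite mxE; apply: ideal_sum => k _; apply: idealMl.
Qed.

Lemma mx_inMr m n p (X : 'M[S]_(m, n)) (Y : 'M[S]_(n, p)) :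
  mx_in I X -> mx_in I (X *m Y).
Proof.
by move=> IX i j; rewrite mxE; apply: ideal_sum => k _; apply: idealMr.
Qed.

Lemma mx_in_block m n p q (X : 'M[S]_(m, p)) Y Z (T : 'M[S]_(n, q)) :
  mx_in I X -> mx_in I Y -> mx_in I Z -> mx_in I T -> mx_in I (block_mx X Y Z T).
Proof.
move=> IX IY IZ IT i j.
by case: (split_ordP i) => i' ->; case: (split_ordP j) => j' ->;
  rewrite ?block_mxEul ?block_mxEur ?block_mxEdl ?block_mxEdr.
Qed.

Lemma mx_in_row m n p (X : 'M[S]_(m, n)) (Y : 'M[S]_(m, p)) :
  mx_in I X -> mx_in I Y -> mx_in I (row_mx X Y).
Proof.
by move=> IX IY i j; case: (split_ordP j) => j' ->; rewrite ?row_mxEl ?row_mxEr.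
Qed.

Lemma mx_in_col m n p (X : 'M[S]_(m, n)) (Y : 'M[S]_(p, n)) :
  mx_in I X -> mx_in I Y -> mx_in I (col_mx X Y).
Proof.
by move=> IX IY i j; case: (split_ordP i) => i' ->; rewrite ?col_mxEu ?col_mxEd.
Qed.

End MatrixIdeal.

Section Index.
Variables (R : realType) (S : pzRingType) (nu : S -> R).
Hypothesis nuP : complete_norm nu.
Variables (C : numFieldType) (s : {rmorphism S -> C}) (c : {rmorphism C -> S}).
Hypothesis sK : forall z, s (c z) = z.
Variables (F L : S -> Prop) (tr : S -> C).
Hypotheses (idF : ideal F) (idL : ideal L) (FL : forall x, F x -> L x).
Hypothesis Lker : forall x, L x -> s x = 0.
Hypothesis trD : forall x y, L x -> L y -> tr (x + y) = tr x + tr y.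
Hypothesis trC : forall x l, L l -> tr (x * l) = tr (l * x).

(** Intended reading of this section: elements of [S] are operators paired with a scalar, [s] reads
    the scalar and [c] embeds scalars, [F] is finite rank, [L] trace class, [tr] the operator trace.
    By [sK], [c \o s] is an idempotent ring endomorphism, so scalar parts respect all matrix
    identities. *)
Definition scal m n (X : 'M[S]_(m, n)) : 'M[S]_(m, n) := map_mx (c \o s) X.

Lemma scalM m n p (X : 'M[S]_(m, n)) (Y : 'M[S]_(n, p)) :
  scal (X *m Y) = scal X *m scal Y.
Proof. exact: map_mxM. Qed.

Lemma scalD m n (X Y : 'M[S]_(m, n)) : scal (X + Y) = scal X + scal Y.
Proof. exact: map_mxD. Qed.

Lemma scalN m n (X : 'M[S]_(m, n)) : scal (- X) = - scal X.
Proof. exact: map_mxN. Qed.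

Lemma scalK m n (X : 'M[S]_(m, n)) : scal (scal X) = scal X.
Proof. by apply/matrixP => i j; rewrite !mxE /= sK. Qed.

Lemma scal_in (I : S -> Prop) m n (X : 'M[S]_(m, n)) :
  (forall x, I x -> s x = 0) -> mx_in I X -> scal X = 0.
Proof. by move=> kI IX; apply/matrixP => i j; rewrite !mxE /= kI ?rmorph0. Qed.

Lemma scal1 n : scal (1%:M : 'M[S]_n) = 1%:M.
Proof. exact: map_mx1. Qed.

Definition scalar_mod (I : S -> Prop) m n (X : 'M[S]_(m, n)) : Prop :=
  mx_in I (X - scal X).

Definition closure_ideal (I : S -> Prop) (x : S) : Prop :=
  forall e, 0 < e -> exists f, I f /\ nu (x - f) < e.
Local Notation K := (closure_ideal F).

Lemma sub_closure (I : S -> Prop) x : I x -> closure_ideal I x.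
Proof. by move=> Ix e e0; exists x; split=> //; rewrite subrr (nu0 nuP). Qed.

Lemma closure_idealP (I : S -> Prop) : ideal I -> ideal (closure_ideal I).
Proof.
move=> idI.
have q x e : 0 < e -> 0 < e / (nu x + 1).
  by move=> e0; rewrite divr_gt0 //; have := nu_ge0 nuP x; lra.
have b (x : S) (y e : R) : 0 <= y -> y < e / (nu x + 1) -> nu x * y < e.
  have x0 := nu_ge0 nuP x; move=> y0; rewrite ltr_pdivlMr; last by lra.
  by rewrite mulrDr mulr1 (mulrC y) => h; lra.
split.
- exact: sub_closure (ideal0 idI).
- move=> x y hx hy e e0.
  have [f [If fx]] := hx _ (divr_gt0 e0 (ltr0Sn R 1)).
  have [g [Ig gy]] := hy _ (divr_gt0 e0 (ltr0Sn R 1)).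
  exists (f + g); split; first exact: idealD.
  rewrite opprD addrACA; apply: le_lt_trans (nuD nuP _ _) _; lra.
- move=> x y hy e e0; have [f [If fy]] := hy _ (q x _ e0).
  exists (x * f); split; first exact: idealMl.
  by rewrite -mulrBr; apply: le_lt_trans (nuM nuP _ _) (b _ _ _ _ fy); exact: nu_ge0.
- move=> y x hy e e0; have [f [If fy]] := hy _ (q x _ e0).
  exists (f * x); split; first exact: idealMr.
  by rewrite -mulrBl; apply: le_lt_trans (nuM nuP _ _) _; rewrite mulrC b // (nu_ge0 nuP).
Qed.

Let idK : ideal K := closure_idealP idF.

Lemma mx_closure m n (X : 'M[S]_(m, n)) : mx_in K X ->
  forall e, 0 < e -> exists f, mx_in F f /\ mxnu nu (X - f) < e.
Proof.
move=> KX e e0.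
have e'0 : 0 < e / (m * n).+1%:R by rewrite divr_gt0.
pose f i j := projT1 (cid (KX i j _ e'0)).
exists (\matrix_(i, j) f i j); split.
  by move=> i j; rewrite mxE /f; case: cid => x [].
have bd i j : nu (X i j - f i j) <= e / (m * n).+1%:R.
  by have [_ /ltW] := projT2 (cid (KX i j _ e'0)).
apply: le_lt_trans (_ : \sum_(i < m) \sum_(j < n) e / (m * n).+1%:R < e).
  by apply: ler_sum => i _; apply: ler_sum => j _; rewrite !mxE.
rewrite !sumr_const !card_ord -mulrnA -[ltLHS]mulr_natr -mulrA gtr_pMr // mulrC.
by rewrite ltr_pdivrMr // mul1r ltr_nat mulnC.
Qed.

Section ScalarMod.
Variable I : S -> Prop.
Hypothesis idI : ideal I.

Lemma scalar_modM m n p (X : 'M[S]_(m, n)) (Y : 'M[S]_(n, p)) :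
  scalar_mod I X -> scalar_mod I Y -> scalar_mod I (X *m Y).
Proof.
move=> IX IY; rewrite /scalar_mod scalM.
have -> : X *m Y - scal X *m scal Y = (X - scal X) *m Y + scal X *m (Y - scal Y).
  by rewrite mulmxBl mulmxBr addrA subrK.
by apply: mx_inD => //; [apply: mx_inMr|apply: mx_inMl].
Qed.

Lemma scalar_modD m n (X Y : 'M[S]_(m, n)) :
  scalar_mod I X -> scalar_mod I Y -> scalar_mod I (X + Y).
Proof. by move=> IX IY; rewrite /scalar_mod scalD opprD addrACA; apply: mx_inD. Qed.

Lemma scalar_mod_scal m n (X : 'M[S]_(m, n)) : scalar_mod I (scal X).
Proof. by rewrite /scalar_mod scalK subrr; apply: mx_in0. Qed.

Lemma scalar_mod1 n : scalar_mod I (1%:M : 'M[S]_n).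
Proof. by rewrite -scal1; apply: scalar_mod_scal. Qed.

Lemma scalar_mod_in m n (X : 'M[S]_(m, n)) :
  (forall x, I x -> s x = 0) -> mx_in I X -> scalar_mod I X.
Proof. by move=> kI IX; rewrite /scalar_mod (scal_in kI) // subr0. Qed.

Lemma scalar_mod_block m n p q (X : 'M[S]_(m, p)) Y Z (T : 'M[S]_(n, q)) :
  scalar_mod I X -> scalar_mod I Y -> scalar_mod I Z -> scalar_mod I T ->
  scalar_mod I (block_mx X Y Z T).
Proof.
rewrite /scalar_mod /scal map_block_mx opp_block_mx add_block_mx; exact: mx_in_block.
Qed.

Lemma scalar_mod0 m n : scalar_mod I (0 : 'M[S]_(m, n)).
Proof. by rewrite /scalar_mod /scal map_mx0 subrr; apply: mx_in0. Qed.

Lemma scalar_mod_row m n p (X : 'M[S]_(m, n)) (Y : 'M[S]_(m, p)) :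
  scalar_mod I X -> scalar_mod I Y -> scalar_mod I (row_mx X Y).
Proof. rewrite /scalar_mod /scal map_row_mx opp_row_mx add_row_mx; exact: mx_in_row. Qed.

Lemma scalar_mod_col m n p (X : 'M[S]_(m, n)) (Y : 'M[S]_(p, n)) :
  scalar_mod I X -> scalar_mod I Y -> scalar_mod I (col_mx X Y).
Proof. rewrite /scalar_mod /scal map_col_mx opp_col_mx add_col_mx; exact: mx_in_col. Qed.

End ScalarMod.

Lemma scalar_modS (I J : S -> Prop) m n (X : 'M[S]_(m, n)) :
  (forall x, I x -> J x) -> scalar_mod I X -> scalar_mod J X.
Proof. by move=> IJ IX i j; apply: IJ. Qed.

Let Fker x : F x -> s x = 0. Proof. by move=> /FL/Lker. Qed.

Lemma tr0 : tr 0 = 0.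
Proof. by apply: (addIr (tr 0)); rewrite -trD ?addr0 ?add0r //; exact: ideal0. Qed.

Lemma tr_sum J (r : seq J) (P : pred J) (f : J -> S) :
  (forall i, P i -> L (f i)) ->
  tr (\sum_(i <- r | P i) f i) = \sum_(i <- r | P i) tr (f i).
Proof.
move=> h; suff [] : L (\sum_(i <- r | P i) f i) /\
  tr (\sum_(i <- r | P i) f i) = \sum_(i <- r | P i) tr (f i) by [].
elim/big_rec2: _ => [|i x y Pi [Ly <-]]; first by rewrite tr0; split=> //; exact: (ideal0 idL).
by rewrite trD //; [split=> //; apply: (idealD idL)|]; auto.
Qed.

Lemma tr_mulC m n (X : 'M[S]_(m, n)) (Y : 'M[S]_(n, m)) : mx_in L X ->
  tr (\tr (X *m Y)) = tr (\tr (Y *m X)).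
Proof.
move=> LX.
have LXY i k : L (X i k * Y k i) by apply: idealMr.
have LYX i k : L (Y i k * X k i) by apply: idealMl.
rewrite /mxtrace tr_sum => [|i _]; last by rewrite mxE; apply: ideal_sum.
rewrite [RHS]tr_sum => [|i _]; last by rewrite mxE; apply: ideal_sum.
under eq_bigr => i _ do rewrite mxE tr_sum //.
under [RHS]eq_bigr => i _ do rewrite mxE tr_sum //.
rewrite exchange_big; apply: eq_bigr => i _; apply: eq_bigr => j _.
by rewrite -trC.
Qed.

Definition tau n (X : 'M[S]_n) : C := tr (\tr (X - scal X)).

(** Neither factor lies in [L], so cyclicity of [tr] does not apply directly. The defect of X Y
    splits into two products, each with one factor in [L]; turning both around gives a splitting of
    the defect of Y X. *)
Lemma tau_mulC m n (X : 'M[S]_(m, n)) (Y : 'M[S]_(n, m)) :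
  scalar_mod L X -> scalar_mod L Y -> tau (X *m Y) = tau (Y *m X).
Proof.
move=> LX LY; rewrite /tau !scalM.
have -> : X *m Y - scal X *m scal Y = (X - scal X) *m Y + scal X *m (Y - scal Y).
  by rewrite mulmxBl mulmxBr addrA subrK.
have -> : Y *m X - scal Y *m scal X = Y *m (X - scal X) + (Y - scal Y) *m scal X.
  by rewrite mulmxBl mulmxBr addrA subrK.
have Ltr k (Z : 'M[S]_k) : mx_in L Z -> L (\tr Z) by move=> h; apply: ideal_sum.
have h1 := Ltr _ _ (mx_inMr idL Y LX).
have h2 := Ltr _ _ (mx_inMl idL (scal X) LY).
have h3 := Ltr _ _ (mx_inMl idL Y LX).
have h4 := Ltr _ _ (mx_inMr idL (scal X) LY).
by rewrite !mxtraceD (trD h1 h2) (trD h3 h4) (tr_mulC Y LX) (tr_mulC (scal X) LY).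
Qed.

Lemma tau_block m n (X : 'M[S]_m) (Y : 'M[S]_n) :
  scalar_mod L X -> scalar_mod L Y -> tau (block_mx X 0 0 Y) = tau X + tau Y.
Proof.
move=> LX LY; rewrite /tau /scal map_block_mx opp_block_mx add_block_mx mxtrace_block.
by rewrite trD //; apply: ideal_sum.
Qed.

Lemma mx_neumann n (w : 'M[S]_n) : mxnu nu w <= 2^-1 ->
  exists g : 'M[S]_n, (1%:M - w) *m g = 1%:M /\ g *m (1%:M - w) = 1%:M.
Proof. exact: (neumann (complete_mxnu nuP n)). Qed.

(* Modulo F the compression Q P of P to its scalar part Q is invertible from
   the range of P to that of Q: T Q P = P - f1 with T = g P Q, where g is a
   Neumann inverse.  Then y x = P for x = (Q P, f1)^T and y = ((P + f1) T, f1),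
   and x y differs from diag(Q, 0) by entries of F. *)
Lemma finite_idempotent n (P : 'M[S]_n) :
  P *m P = P -> scalar_mod K P ->
  exists (e : 'M[S]_(n + n)) (x : 'M[S]_(n + n, n)) (y : 'M[S]_(n, n + n)),
    [/\ scalar_mod F e, e *m e = e, y *m x = P, x *m y = e
      & forall I : S -> Prop, ideal I -> (forall z, F z -> I z) ->
          (forall z, I z -> s z = 0) ->
          scalar_mod I P -> scalar_mod I x /\ scalar_mod I y].
Proof.
move=> PP KP; set Q := scal P; set D := P - Q.
have QQ : Q *m Q = Q by rewrite -scalM PP.
(* One bound for [P] and [Q] together, so that a single approximation [f] makes both [w] and w' at
   most 1/2. *)
have [B [B0 BP BQ]] : exists B, [/\ 0 < B, mxnu nu P * mxnu nu P <= B
    & mxnu nu Q * mxnu nu Q <= B].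
  have h k (X : 'M[S]_k) : 0 <= mxnu nu X * mxnu nu X by rewrite mulr_ge0 ?mxnu_ge0.
  exists (mxnu nu P * mxnu nu P + mxnu nu Q * mxnu nu Q + 1).
  by have := h _ P; have := h _ Q; split; lra.
have e0 : 0 < 2^-1 / B by rewrite divr_gt0 ?invr_gt0.
have [f [Ff Dd]] := mx_closure KP e0; rewrite -/Q -/D in Dd.
have sandwich (X : 'M[S]_n) : mxnu nu X * mxnu nu X <= B ->
    mxnu nu (X *m (D - f) *m X) <= 2^-1.
  move=> hB; apply: le_trans (mxnuM nuP _ _) _.
  apply: (@le_trans _ _ (mxnu nu X * mxnu nu (D - f) * mxnu nu X)).
    by rewrite ler_wpM2r ?mxnu_ge0 // mxnuM.
  rewrite mulrAC; apply: (@le_trans _ _ (B * (2^-1 / B))).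
    by apply: ler_pM => //; rewrite ?mulr_ge0 ?mxnu_ge0 // ltW.
  by rewrite mulrCA divff ?mulr1 // gt_eqF.
set w := P *m (D - f) *m P; set w' := Q *m (D - f) *m Q.
have Pw : P *m w = w by rewrite /w !mulmxA PP.
have wP : w *m P = w by rewrite /w -!mulmxA PP.
have [g [wg gw]] := mx_neumann (sandwich _ BP).
have [g' [wg' _]] : exists g', (1%:M - - w') *m g' = 1%:M /\ g' *m (1%:M - - w') = 1%:M.
  apply: mx_neumann; have := sandwich _ BQ; rewrite -/w'; apply: le_trans.
  by rewrite le_eqVlt (nuN (complete_mxnu nuP n)) eqxx.
rewrite -/w in wg gw; rewrite opprK in wg'.
have gP : g *m P = P *m g.
  have comm : P *m (1%:M - w) = (1%:M - w) *m P.
    by rewrite mulmxBl mulmxBr Pw wP mulmx1 mul1mx.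
  by rewrite -[g *m P]mulmx1 -wg !mulmxA -(mulmxA g P) comm mulmxA gw mul1mx.
(* Since Q = P - D and D = (D - f) + f, compressing Q to the range of P gives P - w up to [F], which
   is invertible there. [QPQ] is the mirror statement. *)
have PQP : P *m Q *m P = P - w - P *m f *m P.
  rewrite /w mulmxBr mulmxBl opprB addrA addrAC addrK /D mulmxBr mulmxBl !PP opprB.
  by rewrite addrC subrK.
have QPQ : Q *m P *m Q = Q + w' + Q *m f *m Q.
  rewrite /w' mulmxBr mulmxBl -addrA subrK /D mulmxBr mulmxBl !QQ.
  by rewrite addrC subrK.
pose T := g *m P *m Q; pose f1 := g *m (P *m f *m P); pose U := Q *m P.
have TU : T *m U = P - f1.
  rewrite /T /U mulmxA -(mulmxA _ Q Q) QQ -!mulmxA (mulmxA P) PQP mulmxBr -/f1.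
  by congr (_ - _); rewrite -[X in X - w]mul1mx -{1}wP -mulmxBl mulmxA gw mul1mx.
have Ff1 : mx_in F f1 by apply: (mx_inMl idF); apply: (mx_inMr idF); apply: (mx_inMl idF).
have Pf1 : P *m f1 = f1 by rewrite /f1 mulmxA -gP -!mulmxA (mulmxA P P) PP.
have f1P : f1 *m P = f1 by rewrite /f1 -!mulmxA PP.
have UP : U *m P = U by rewrite /U -mulmxA PP.
(* [T] inverts [U] from the left modulo [F], and T', built from the other Neumann inverse, inverts
   it from the right modulo [F]; comparing them shows that [T] is also a right inverse modulo
   [F]. *)
have FUT : mx_in F (U *m T - Q).
  pose T' := P *m Q *m g'; pose h := Q *m f *m Q *m g'.
  have Fh : mx_in F h by do 2!apply: (mx_inMr idF); apply: (mx_inMl idF).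
  have UT' : U *m T' = Q + h.
    rewrite /T' !mulmxA UP QPQ mulmxDl -/h; congr (_ + _).
    rewrite -[RHS]mulmx1 -wg' mulmxA mulmxDr mulmx1; congr ((_ + _) *m _).
    by rewrite /w' !mulmxA QQ.
  have TQ : T *m Q = T by rewrite /T -!mulmxA QQ.
  have -> : U *m T - Q = h - U *m f1 *m T' - U *m T *m h.
    have {1}-> : U *m T = U *m T *m (U *m T' - h) by rewrite UT' addrK -mulmxA TQ.
    rewrite mulmxBr -[U *m T *m (U *m T')]mulmxA (mulmxA T U) TU mulmxBl mulmxBr.
    rewrite !(mulmxA U) UP UT' addrAC; congr (_ - _).
    by rewrite addrAC (addrC Q) addrK.
  by apply: mx_inB => //; [apply: mx_inB => //; apply: mx_inMr => //|]; apply: mx_inMl.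
(* The extra coordinate [f1] makes the left identity exact: T U = P - f1, and (P + f1)(P - f1) + f1
   f1 = P because [P] fixes [f1] on both sides. *)
pose x := col_mx U f1; pose y := row_mx ((P + f1) *m T) f1.
have yx : y *m x = P.
  rewrite /y /x mul_row_col -mulmxA TU mulmxDl !mulmxBr PP f1P Pf1.
  by rewrite addrA !subrK.
exists (x *m y), x, y; split=> //.
- rewrite /x /y mul_col_row; apply: scalar_mod_block; last first.
  + by apply: (scalar_mod_in Fker); apply: mx_inMl.
  + by apply: (scalar_mod_in Fker); apply: mx_inMr.
  + by apply: (scalar_mod_in Fker); apply: mx_inMl.
  rewrite mulmxDl mulmxDr; apply: scalar_modD => //.
    rewrite -[_ *m _](subrK Q); apply: scalar_modD => //; last exact: scalar_mod_scal.
    by apply: (scalar_mod_in Fker); rewrite mulmxA UP.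
  by apply: (scalar_mod_in Fker); apply: mx_inMl => //; apply: mx_inMr.
- have xP : x *m P = x by rewrite /x mul_col_mx UP f1P.
  by rewrite -!mulmxA (mulmxA y) yx mulmxA xP.
(* The same [x] and [y] serve every such ideal: the closure [K] defines the index, and [L] compares
   it with the trace. *)
move=> I idI FI Iker IP.
have IFm m1 m2 (X : 'M[S]_(m1, m2)) : mx_in F X -> scalar_mod I X.
  by move=> FX; apply: scalar_mod_in => // i j; apply: FI.
have Iw : mx_in I w.
  by apply: mx_inMr => //; apply: mx_inMl => //; apply: mx_inB => // i j; apply: FI.
have IQ : scalar_mod I Q by apply: scalar_mod_scal.
(* [I] need not be norm closed, so [g] cannot be treated as the limit of its series; the identity g
   = 1 + w g replaces the limit. *)
have Ig : scalar_mod I g.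
  have -> : g = 1%:M + w *m g by rewrite -{1}wg mulmxBl mul1mx subrK.
  by apply: scalar_modD => //; [exact: scalar_mod1|apply: scalar_mod_in => //; apply: mx_inMr].
have IU : scalar_mod I U by apply: scalar_modM.
have IT : scalar_mod I T by do !apply: scalar_modM => //.
split; first by apply: scalar_mod_col => //; apply: IFm.
by apply: scalar_mod_row; [apply: scalar_modM => //; apply: scalar_modD|]; auto.
Qed.

Lemma mxnu_mul_close m n (X : 'M[S]_(m, n)) (Y : 'M[S]_(n, m)) d : 0 < d ->
  exists eta, 0 < eta /\ forall X' Y', mxnu nu (X - X') < eta ->
    mxnu nu (Y - Y') < eta ->
    mxnu nu (X *m Y - X' *m Y') <= d /\ mxnu nu (Y *m X - Y' *m X') <= d.
Proof.
move=> d0; set q := mxnu nu X + mxnu nu Y + 1.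
have q0 : 0 < q by have := mxnu_ge0 nuP X; have := mxnu_ge0 nuP Y; rewrite /q; lra.
(* Deviations u and v below this value cost at most u |Y| + |X| v + u v; the summand 1 in [q]
   absorbs the quadratic term, as u and v are below 1. *)
exists (Num.min 1 (d / q)); rewrite lt_min ltr01 divr_gt0 //; split=> // X' Y'.
rewrite !lt_min !ltr_pdivlMr // => /andP[X1 Xq] /andP[Y1 Yq].
have gen k l (A A' : 'M[S]_(k, l)) (B B' : 'M[S]_(l, k)) :
    mxnu nu (A *m B - A' *m B') <=
    mxnu nu (A - A') * (mxnu nu B + mxnu nu (B - B')) + mxnu nu A * mxnu nu (B - B').
  have -> : A *m B - A' *m B' =
      (A - A') *m B + A *m (B - B') - (A - A') *m (B - B').
    rewrite [(A - A') *m (B - B')]mulmxBr opprB [RHS]addrC addrA subrK.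
    by rewrite [A *m (B - B')]mulmxBr mulmxBl [RHS]addrC addrA subrK.
  apply: le_trans (mxnuD nuP _ _) _.
  have h1 := mxnuD nuP ((A - A') *m B) (A *m (B - B')).
  have h2 := mxnuM nuP (A - A') B; have h3 := mxnuM nuP A (B - B').
  have h4 := mxnuM nuP (A - A') (B - B').
  have h5 := (nuN (complete_mxnu nuP k) ((A - A') *m (B - B'))).
  lra.
have := mxnu_ge0 nuP (X - X'); have := mxnu_ge0 nuP (Y - Y').
have := mxnu_ge0 nuP X; have := mxnu_ge0 nuP Y.
have := gen _ _ X X' Y Y'; have := gen _ _ Y Y' X X'.
rewrite /q in Xq Yq.
set a := mxnu nu X in Xq Yq *; set b := mxnu nu Y in Xq Yq *.
set u := mxnu nu (X - X') in X1 Xq *; set v := mxnu nu (Y - Y') in Y1 Yq *.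
by move=> h1 h2 b0 a0 v0 u0; split; [apply: le_trans h2 _|apply: le_trans h1 _]; nra.
Qed.

(* Approximating x and y modulo F, corrected on one side by Neumann inverses,
   realises the equivalence between e1 and e2 over the unitization of F, where
   tau is a trace. *)
Lemma tau_equiv m n (e1 : 'M[S]_m) (e2 : 'M[S]_n) (x : 'M[S]_(m, n)) y :
  e1 *m e1 = e1 -> e2 *m e2 = e2 -> scalar_mod F e1 -> scalar_mod F e2 ->
  scalar_mod K x -> scalar_mod K y -> x *m y = e1 -> y *m x = e2 ->
  tau e1 = tau e2.
Proof.
move=> id1 id2 Fe1 Fe2 Kx Ky xy yx.
pose X := e1 *m x *m e2; pose Y := e2 *m y *m e1.
have XY : X *m Y = e1.
  rewrite /X /Y !mulmxA -(mulmxA _ e2 e2) id2 -{1}yx !mulmxA -(mulmxA _ x y) xy.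
  by rewrite -(mulmxA e1 x y) xy !id1.
have YX : Y *m X = e2.
  rewrite /X /Y !mulmxA -(mulmxA _ e1 e1) id1 -{1}xy !mulmxA -(mulmxA _ y x) yx.
  by rewrite -(mulmxA e2 y x) yx !id2.
have half0 : 0 < 2^-1 :> R by rewrite invr_gt0.
have [eta [eta0 close]] := mxnu_mul_close X Y half0.
(* The scalar part of z is kept exactly and only the rest is approximated, after which the result is
   cut down to the corner. Equal scalar parts are what later puts [w] into [F] itself, not merely
   into scalars plus [F]. *)
have apx p q (a : 'M[S]_p) (b : 'M[S]_q) z : a *m a = a -> b *m b = b ->
    scalar_mod F a -> scalar_mod F b -> scalar_mod K z ->
    exists z', [/\ scalar_mod F z', a *m z' = z', z' *m b = z',
      mxnu nu (a *m z *m b - z') < eta & scal z' = scal (a *m z *m b)].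
  move=> ida idb Fa Fb Kz.
  have Cpos : 0 < mxnu nu a * mxnu nu b + 1.
    by have := mulr_ge0 (mxnu_ge0 nuP a) (mxnu_ge0 nuP b); lra.
  have [f [Ff fz]] := mx_closure Kz (divr_gt0 eta0 Cpos).
  exists (a *m (scal z + f) *m b); split.
  - apply: scalar_modM => //; apply: scalar_modM => //; apply: scalar_modD => //.
      exact: scalar_mod_scal.
    exact: (scalar_mod_in Fker).
  - by rewrite !mulmxA ida.
  - by rewrite -!mulmxA idb.
  - rewrite -mulmxBl -mulmxBr opprD addrA.
    apply: le_lt_trans (mxnuM nuP _ _) _.
    apply: le_lt_trans (_ : mxnu nu a * mxnu nu (z - scal z - f) * mxnu nu b < _).
      by rewrite ler_wpM2r ?mxnu_ge0 // mxnuM.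
    move: fz; rewrite ltr_pdivlMr // mulrDr mulr1 mulrAC mulrC => fz.
    by have := mxnu_ge0 nuP (z - scal z - f); lra.
  - by rewrite !scalM scalD scalK (scal_in Fker Ff) addr0.
have [x1 [Fx1 e1x x1e nx sx]] := apx _ _ _ _ _ id1 id2 Fe1 Fe2 Kx.
have [y1 [Fy1 e2y y1e ny sy]] := apx _ _ _ _ _ id2 id1 Fe2 Fe1 Ky.
have [] := close _ _ nx ny; rewrite XY YX => small1 small2.
have [g [wg _]] := mx_neumann small1; have [h [_ hw]] := mx_neumann small2.
set w := e1 - x1 *m y1 in small1 wg.
have e1w : e1 *m w = w by rewrite /w mulmxBr id1 mulmxA e1x.
have Fw : mx_in F w.
  have : scalar_mod F w.
    apply: scalar_modD => //; rewrite /scalar_mod scalN scalM.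
    rewrite -opprD; apply: mx_inN => //.
    by rewrite -scalM; apply: scalar_modM.
  rewrite /scalar_mod; suff -> : scal w = 0 by rewrite subr0.
  by rewrite scalD scalN scalM sx sy -scalM -/X -/Y XY subrr.
have Fg : scalar_mod F g.
  have -> : g = 1%:M + w *m g by rewrite -{1}wg mulmxBl mul1mx subrK.
  by apply: scalar_modD => //; [exact: scalar_mod1|apply: (scalar_mod_in Fker); apply: mx_inMr].
have x1y1 : x1 *m y1 = e1 *m (1%:M - w) by rewrite mulmxBr mulmx1 e1w /w opprB addrC subrK.
have y1x1 : y1 *m x1 = (1%:M - (e2 - y1 *m x1)) *m e2.
  rewrite mulmxBl mul1mx mulmxBl id2 -mulmxA x1e opprB addrC subrK //.
have x1y2 : x1 *m (y1 *m g) = e1 by rewrite mulmxA x1y1 -mulmxA wg mulmx1.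
have y3x1 : h *m y1 *m x1 = e2 by rewrite -mulmxA y1x1 mulmxA hw mul1mx.
(* A left and a right inverse of [x1] agree. Hence only [g] has to be shown scalar modulo [F], not
   [h]. *)
have y23 : e2 *m y1 *m g = h *m y1.
  by rewrite -y3x1 -!mulmxA x1y2 y1e.
rewrite -x1y2 tau_mulC; last 2 first.
- exact: scalar_modS FL Fx1.
- by apply: (scalar_modS FL); apply: scalar_modM.
by rewrite -{1}e2y y23 y3x1.
Qed.

Hypothesis tr_int : forall n (e : 'M[S]_n), e *m e = e -> scalar_mod F e ->
  exists k : int, tau e = k%:~R.
Hypothesis LK : forall x, L x -> K x.
Hypothesis Kker : forall x, K x -> s x = 0.

(** A relation rather than a function: any finite idempotent equivalent to [P] over scalars plus [K]
    may witness the index, and [index_equiv] shows that all witnesses agree. *)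
Definition is_index n (P : 'M[S]_n) (k : int) : Prop :=
  exists m (e : 'M[S]_m) (x : 'M[S]_(n, m)) (y : 'M[S]_(m, n)),
    [/\ scalar_mod F e, e *m e = e, scalar_mod K x, scalar_mod K y
      & [/\ x *m y = P, y *m x = e & tau e = k%:~R]].

Lemma index_exists n (P : 'M[S]_n) : P *m P = P -> scalar_mod K P ->
  exists k, is_index P k.
Proof.
move=> PP KP; have [e [x [y [Fe ee yx xy h]]]] := finite_idempotent PP KP.
have [k ek] := tr_int ee Fe; exists k; exists (n + n)%N, e, y, x.
by have [] := h K idK (fun z => @sub_closure F z) Kker KP.
Qed.

(** The equivalences of [P] with e and of [Q] with f are composed with a and b; then y a z and t b x
    link the finite idempotents e and f, and [tau_equiv] applies. *)
Lemma index_equiv m n (P : 'M[S]_m) (Q : 'M[S]_n) (a : 'M[S]_(m, n)) b k l :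
  P *m P = P -> scalar_mod K a -> scalar_mod K b -> a *m b = P -> b *m a = Q ->
  is_index P k -> is_index Q l -> k = l.
Proof.
move=> PP Ka Kb ab ba [p [e [x [y [Fe ee Kx Ky [xy yx ek]]]]]].
move=> [q [f [z [t [Ff ff Kz Kt [zt tz fl]]]]]].
apply/eqP; rewrite -(eqr_int C) -ek -fl; apply/eqP.
have Kyaz : scalar_mod K (y *m a *m z) by do !apply: scalar_modM.
have Ktbx : scalar_mod K (t *m b *m x) by do !apply: scalar_modM.
apply: (tau_equiv ee ff Fe Ff Kyaz Ktbx).
  have -> : y *m a *m z *m (t *m b *m x) = y *m (a *m (z *m t) *m b) *m x.
    by rewrite !mulmxA.
  have -> : a *m (z *m t) *m b = P by rewrite zt -ba mulmxA ab -mulmxA ab PP.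
  by rewrite -xy !mulmxA yx -mulmxA yx ee.
have -> : t *m b *m x *m (y *m a *m z) = t *m (b *m (x *m y) *m a) *m z.
  by rewrite !mulmxA.
have -> : b *m (x *m y) *m a = z *m t *m (z *m t) by rewrite xy zt -ab -ba !mulmxA.
by rewrite !mulmxA tz -(mulmxA f t z) tz ff -(mulmxA f t z) tz ff.
Qed.

Lemma index_block m n (P : 'M[S]_m) (Q : 'M[S]_n) k l :
  is_index P k -> is_index Q l -> is_index (block_mx P 0 0 Q) (k + l).
Proof.
move=> [p [e [x [y [Fe ee Kx Ky [xy yx ek]]]]]].
move=> [q [f [z [t [Ff ff Kz Kt [zt tz fl]]]]]].
exists (p + q)%N, (block_mx e 0 0 f), (block_mx x 0 0 z), (block_mx y 0 0 t).
have z0 := scalar_mod0 idF; have zK := scalar_mod0 idK.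
split; try exact: scalar_mod_block.
  by rewrite mulmx_block !mul0mx !mulmx0 !addr0 !add0r ee ff.
split; rewrite ?mulmx_block ?mul0mx ?mulmx0 ?addr0 ?add0r ?xy ?yx ?zt ?tz //.
by rewrite tau_block ?ek ?fl ?rmorphD //; apply: (scalar_modS FL).
Qed.

(** The witness can be chosen freely. The one from [finite_idempotent] is linked to [P] by matrices
    that are scalar modulo [L], and there [tau] is cyclic. *)
Lemma index_tau n (P : 'M[S]_n) k : P *m P = P -> scalar_mod L P ->
  is_index P k -> tau P = k%:~R.
Proof.
move=> PP LP Pk; have KP := scalar_modS LK LP.
have [e [x [y [Fe ee yx xy h]]]] := finite_idempotent PP KP.
have [Lx Ly] := h L idL FL Lker LP.
have [Kx Ky] := h K idK (fun z => @sub_closure F z) Kker KP.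
have [l el] := tr_int ee Fe.
have Pl : is_index P l by exists (n + n)%N, e, y, x.
by rewrite (index_equiv PP KP KP PP PP Pk Pl) -el -yx -xy tau_mulC.
Qed.

End Index.

(** * Extension of a bounded ring morphism from a dense image *)

Section Extension.
Variables (R : realType) (B Bb S : pzRingType) (nrm : Bb -> R) (nu : S -> R).
Variables (j : {rmorphism B -> Bb}) (psi : {rmorphism B -> S}).
Hypothesis nuP : complete_norm nu.
Hypothesis nrm0 : nrm 0 = 0.
Hypothesis nrmD : forall x y, nrm (x + y) <= nrm x + nrm y.
Hypothesis nrmN : forall x, nrm (- x) = nrm x.
Hypothesis nrmM : forall x y, nrm (x * y) <= nrm x * nrm y.
Hypothesis dense : forall x e, 0 < e -> exists b, nrm (x - j b) < e.
Hypothesis bounded : forall b, nu (psi b) <= nrm (j b).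

(** The closure of the graph of j b |-> psi b. Sums, opposites and products are verified on this
    relation, and only its uniqueness turns them into laws for a function, so no compatible
    approximating sequences have to be chosen. *)
Let gr (x : Bb) (y : S) : Prop :=
  forall e, 0 < e -> exists b, nrm (x - j b) < e /\ nu (y - psi b) < e.

Let gr_exists x : exists y, gr x y.
Proof.
have q n : 0 < (n.+1%:R : R)^-1 by rewrite invr_gt0.
pose u n := projT1 (cid (dense x (q n))).
have uP n : nrm (x - j (u n)) < n.+1%:R^-1 by rewrite /u; case: cid.
have arch (e : R) : 0 < e -> exists n0, forall n, (n0 <= n)%N -> n.+1%:R^-1 < e.
  move=> e0; exists (Num.bound e^-1) => n le_n.
  rewrite invf_plt ?posrE //; apply: lt_trans (archi_boundP _) _.
    by rewrite invr_ge0 ltW.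
  by rewrite ltr_nat ltnS.
have [e e0|y yP] := nu_complete nuP (u := psi \o u).
  have [n0 h] := arch _ (divr_gt0 e0 (ltr0Sn R 1)).
  exists n0 => m n /h hm /h hn; rewrite /= -rmorphB; apply: le_lt_trans (bounded _) _.
  have -> : j (u m - u n) = (x - j (u n)) + - (x - j (u m)).
    by rewrite rmorphB opprB [RHS]addrC addrA subrK.
  apply: le_lt_trans (nrmD _ _) _; rewrite nrmN; have := lt_trans (uP m) hm; have := lt_trans (uP n) hn; lra.
exists y => e e0; have [n0 h] := arch _ e0; have [n1 h1] := yP _ e0.
exists (u (maxn n0 n1)); split.
  by apply: lt_trans (uP _) (h _ _); exact: leq_maxl.
by rewrite (nuBC nuP); apply: h1; exact: leq_maxr.
Qed.

Let gr_unique x y z : gr x y -> gr x z -> y = z.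
Proof.
move=> xy xz; apply/eqP; rewrite -subr_eq0; apply/eqP/(nu_small_eq0 nuP) => e e0.
have [b [xb yb]] := xy _ (divr_gt0 e0 (ltr0Sn R 3)).
have [b' [xb' zb]] := xz _ (divr_gt0 e0 (ltr0Sn R 3)).
have -> : y - z = (y - psi b) - (z - psi b') + psi (b - b').
  by rewrite rmorphB opprB [RHS]addrAC !addrA !subrK.
have h1 := nuD nuP (y - psi b - (z - psi b')) (psi (b - b')).
have h2 := nuB nuP (y - psi b) (z - psi b').
have h3 := bounded (b - b').
have h4 : nrm (j (b - b')) <= nrm (x - j b') + nrm (x - j b).
  have -> : j (b - b') = (x - j b') + - (x - j b).
    by rewrite rmorphB opprB [RHS]addrC addrA subrK.
  by rewrite -(nrmN (x - j b)); exact: nrmD.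
lra.
Qed.

Let grD x x' y y' : gr x y -> gr x' y' -> gr (x + x') (y + y').
Proof.
move=> xy xy' e e0; have [b [xb yb]] := xy _ (divr_gt0 e0 (ltr0Sn R 1)).
have [b' [xb' yb']] := xy' _ (divr_gt0 e0 (ltr0Sn R 1)).
exists (b + b'); rewrite !rmorphD !opprD ![_ + (- _ - _)]addrACA.
have := nrmD (x - j b) (x' - j b'); have := nuD nuP (y - psi b) (y' - psi b').
by split; lra.
Qed.

Let gr_j b : gr (j b) (psi b).
Proof.
by move=> e e0; exists b; rewrite !subrr (nu0 nuP) nrm0.
Qed.

Let grN x y : gr x y -> gr (- x) (- y).
Proof.
move=> xy e /xy [b [xb yb]]; exists (- b).
by rewrite !rmorphN -!opprD nrmN (nuN nuP).
Qed.

Let grM x x' y y' : gr x y -> gr x' y' -> gr (x * x') (y * y').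
Proof.
move=> xy xy' e e0.
have nrm_ge0 z : 0 <= nrm z by have := nrmD z (- z); rewrite subrr nrm0 nrmN; lra.
pose q := nrm x + nrm x' + nu y + nu y' + 1.
have [q1 q2 q3] : [/\ 0 < q, nrm x + nrm x' + 1 <= q & nu y + nu y' + 1 <= q].
  have := nrm_ge0 x; have := nrm_ge0 x'; have := nu_ge0 nuP y; have := nu_ge0 nuP y'.
  by rewrite /q; split; lra.
have d0 : 0 < Num.min 1 (e / q) by rewrite lt_min ltr01 divr_gt0.
have [b [xb yb]] := xy _ d0; have [b' [xb' yb']] := xy' _ d0; exists (b * b').
have split_prod (T : pzRingType) (a a' c c' : T) :
    a * a' - c * c' = (a - c) * a' + a * (a' - c') - (a - c) * (a' - c').
  rewrite [(a - c) * (a' - c')]mulrBr opprB [RHS]addrC addrA subrK.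
  by rewrite [a * (a' - c')]mulrBr mulrBl [RHS]addrC addrA subrK.
have close a a' d d' : 0 <= a -> 0 <= a' -> 0 <= d -> 0 <= d' -> a + a' + 1 <= q ->
    d < Num.min 1 (e / q) -> d' < Num.min 1 (e / q) -> d * a' + a * d' + d * d' < e.
  move=> a0 a'0 d'0 d''0 hq; rewrite !lt_min !ltr_pdivlMr // => /andP[? ?] /andP[? ?].
  by nra.
split; rewrite rmorphM split_prod.
  apply: le_lt_trans (nrmD _ _) _; rewrite nrmN.
  apply: le_lt_trans (close (nrm x) (nrm x') _ _ _ _ (nrm_ge0 (x - j b)) (nrm_ge0 (x' - j b')) q2 xb xb') => //.
  by rewrite lerD ?nrmM //; apply: le_trans (nrmD _ _) _; rewrite lerD ?nrmM.
apply: le_lt_trans (nuB nuP _ _) _.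
apply: le_lt_trans (close (nu y) (nu y') _ _ _ _ (nu_ge0 nuP (y - psi b)) (nu_ge0 nuP (y' - psi b')) q3 yb yb');
  rewrite ?(nu_ge0 nuP) //.
by rewrite lerD ?(nuM nuP) //; apply: le_trans (nuD nuP _ _) _; rewrite lerD ?(nuM nuP).
Qed.

Lemma dense_extension : exists Psi : {rmorphism Bb -> S},
  (forall b, Psi (j b) = psi b) /\
  (forall x e, 0 < e -> exists b, nu (Psi x - psi b) < e).
Proof.
pose f x := projT1 (cid (gr_exists x)).
have fP x : gr x (f x) by rewrite /f; case: cid.
have fB : {morph f : x y / x - y}.
  by move=> x y; apply: gr_unique (fP _) (grD (fP _) (grN (fP _))).
have fM : monoid_morphism f.
  split=> [|x y]; last exact: gr_unique (fP _) (grM (fP _) (fP _)).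
  by rewrite -(rmorph1 j) -(rmorph1 psi); apply: gr_unique (fP _) (gr_j _).
pose fm := GRing.isZmodMorphism.Build _ _ f fB.
pose fr := GRing.isMonoidMorphism.Build _ _ f fM.
pose Psi : {rmorphism Bb -> S} := HB.pack f fm fr.
exists Psi; split=> [b|x e /(fP x) [b [_ h]]]; last by exists b.
exact: gr_unique (fP _) (gr_j _).
Qed.

End Extension.

(** * Hilbert spaces *)

Section RealNorm.
Variables (R : realType) (V : normedZmodType R[i]).

(** Norms take values in [R[i]]; this real copy is available to real arithmetic, suprema and
    infima. *)
Definition nr (x : V) : R := complex.Re `|x|.

Lemma nrE (x : V) : (nr x)%:C%C = `|x|.
Proof. by apply: RRe_real; rewrite ger0_real. Qed.

Lemma nr_ge0 (x : V) : 0 <= nr x.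
Proof. by rewrite -ler0c nrE. Qed.

Lemma nr0 : nr (0 : V) = 0.
Proof. by rewrite /nr normr0. Qed.

Lemma nr_eq0 (x : V) : nr x = 0 -> x = 0.
Proof. by move=> x0; apply/eqP; rewrite -normr_eq0 -nrE x0. Qed.

Lemma nrN (x : V) : nr (- x) = nr x.
Proof. by rewrite /nr normrN. Qed.

Lemma nrD (x y : V) : nr (x + y) <= nr x + nr y.
Proof. by rewrite -lecR rmorphD /= !nrE ler_normD. Qed.

Lemma nrB (x y : V) : nr (x - y) <= nr x + nr y.
Proof. by rewrite -(nrN y) nrD. Qed.

Lemma nrBC (x y : V) : nr (x - y) = nr (y - x).
Proof. by rewrite /nr distrC. Qed.

Lemma nr_sum I (r : seq I) (P : pred I) (F : I -> V) :
  nr (\sum_(i <- r | P i) F i) <= \sum_(i <- r | P i) nr (F i).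
Proof.
elim/big_rec2: _ => [|i y1 y2 _ h]; first by rewrite nr0.
by apply: le_trans (nrD _ _) _; rewrite lerD2l.
Qed.

Lemma nr_small_eq (x y : V) : (forall e, 0 < e -> nr (x - y) <= e) -> x = y.
Proof.
move=> h; apply/eqP; rewrite -subr_eq0; apply/eqP/nr_eq0/le_anti.
by rewrite nr_ge0 andbT; apply/ler_addgt0Pr => e e0; rewrite add0r h.
Qed.

End RealNorm.

Lemma nrM (R : realType) (x y : R[i]) : nr (x * y) = nr x * nr y.
Proof. by apply: complexI; rewrite rmorphM /= !nrE normrM. Qed.

Lemma nr_conj (R : realType) (x : R[i]) : nr x^* = nr x.
Proof. by rewrite /nr norm_conjC. Qed.

Lemma nr_real (R : realType) (x : R) : 0 <= x -> nr (x%:C%C) = x.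
Proof. by move=> x0; rewrite /nr ger0_norm ?ler0c. Qed.

Lemma Re_le_nr (R : realType) (x : R[i]) : complex.Re x <= nr x.
Proof.
by apply: le_trans (ler_norm _) _; rewrite -lecR nrE; exact: normc_ge_Re.
Qed.

Lemma ReM_real (R : realType) (a : R) (x : R[i]) : complex.Re (a%:C%C * x) = a * complex.Re x.
Proof. by case: x => b c /=; rewrite mul0r subr0. Qed.

Section Hilbert.
Variables (R : realType) (H : hilbertType R).
Implicit Types x y z : H.

Lemma nrZ (k : R[i]) x : nr (k *: x) = nr k * nr x.
Proof. by apply: complexI; rewrite rmorphM /= !nrE normrZ. Qed.

Lemma innerDl x y z : inner (x + y) z = inner x z + inner y z.
Proof. by have := inner_linear 1 x y z; rewrite scale1r mul1r. Qed.

Lemma inner0l z : inner (0 : H) z = 0.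
Proof. by apply: (addIr (inner 0 z)); rewrite -innerDl !add0r. Qed.

Lemma innerZl k x z : inner (k *: x) z = k * inner x z.
Proof. by have := inner_linear k x 0 z; rewrite !addr0 inner0l addr0. Qed.

Lemma innerNl x z : inner (- x) z = - inner x z.
Proof. by rewrite -scaleN1r innerZl mulN1r. Qed.

Lemma innerBl x y z : inner (x - y) z = inner x z - inner y z.
Proof. by rewrite innerDl innerNl. Qed.

Lemma inner_suml I (r : seq I) (P : pred I) (F : I -> H) z :
  inner (\sum_(i <- r | P i) F i) z = \sum_(i <- r | P i) inner (F i) z.
Proof. by apply: (big_morph (fun x => inner x z)) => [x y|]; rewrite ?innerDl ?inner0l. Qed.

Lemma innerDr x y z : inner x (y + z) = inner x y + inner x z.
Proof. by rewrite inner_conj innerDl rmorphD /= -!inner_conj. Qed.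

Lemma inner0r z : inner z (0 : H) = 0.
Proof. by rewrite inner_conj inner0l rmorph0. Qed.

Lemma innerZr k x z : inner x (k *: z) = k^* * inner x z.
Proof. by rewrite inner_conj innerZl rmorphM /= -inner_conj. Qed.

Lemma innerNr x z : inner x (- z) = - inner x z.
Proof. by rewrite inner_conj innerNl rmorphN /= -inner_conj. Qed.

Lemma innerBr x y z : inner x (y - z) = inner x y - inner x z.
Proof. by rewrite innerDr innerNr. Qed.

Lemma inner_sumr I (r : seq I) (P : pred I) (F : I -> H) z :
  inner z (\sum_(i <- r | P i) F i) = \sum_(i <- r | P i) inner z (F i).
Proof. by apply: (big_morph (inner z)) => [x y|]; rewrite ?innerDr ?inner0r. Qed.

Lemma inner_nr x : inner x x = (nr x ^+ 2)%:C%C.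
Proof. by rewrite inner_norm -nrE rmorphXn. Qed.

Lemma nr_inner_eq x y : (forall z, inner x z = inner y z) -> x = y.
Proof.
move=> h; apply/eqP; rewrite -subr_eq0; apply/eqP/nr_eq0/eqP.
rewrite -sqrf_eq0; apply/eqP/(@complexI R).
by rewrite -inner_nr innerBl h subrr.
Qed.

Definition orthonormal_family (I : eqType) (e : I -> H) : Prop :=
  forall i j, inner (e i) (e j) = (i == j)%:R.

Lemma orthonormal_nr (I : eqType) (e : I -> H) i : orthonormal_family e -> nr (e i) = 1.
Proof.
move=> oe; have := oe i i; rewrite inner_nr eqxx => /(congr1 (@complex.Re R)) /= /eqP.
by rewrite sqrf_eq1 => /orP[/eqP //|/eqP h]; have := nr_ge0 (e i); rewrite h; lra.
Qed.

Section Bessel.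
Variables (I : eqType) (e : I -> H) (oe : orthonormal_family e).

Definition proj (r : seq I) x : H := \sum_(i <- r) inner x (e i) *: e i.

Lemma inner_proj r x k : uniq r -> k \in r -> inner (proj r x) (e k) = inner x (e k).
Proof.
move=> ur kr; rewrite inner_suml (bigD1_seq k) //= innerZl oe eqxx mulr1 big1 ?addr0 //.
by move=> i /negPf ik; rewrite innerZl oe ik mulr0.
Qed.

Lemma proj_nr r x : uniq r -> nr (proj r x) ^+ 2 = \sum_(i <- r) nr (inner x (e i)) ^+ 2.
Proof.
move=> ur; apply: complexI; rewrite -inner_nr rmorph_sum /= {2}/proj inner_sumr.
rewrite !big_seq; apply: eq_bigr => i ir.
by rewrite innerZr inner_proj // rmorphXn /= nrE normCKC.
Qed.

Lemma bessel_eq r x : uniq r ->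
  nr (x - proj r x) ^+ 2 = nr x ^+ 2 - \sum_(i <- r) nr (inner x (e i)) ^+ 2.
Proof.
move=> ur; have o : inner (x - proj r x) (proj r x) = 0.
  rewrite {2}/proj inner_sumr big_seq big1 // => i ir.
  by rewrite innerZr innerBl inner_proj // subrr mulr0.
apply: complexI; rewrite rmorphB /= -proj_nr // -!inner_nr.
rewrite [LHS]innerBl [X in _ - X]inner_conj o rmorph0 subr0 innerBr; congr (_ - _).
by move/eqP: o; rewrite innerBl subr_eq0 => /eqP.
Qed.
End Bessel.
End Hilbert.

Section Limits.
Variable R : realType.

Lemma totally_cvgP (I : choiceType) (V : normedModType R[i]) (f : {fset I} -> V) (l : V) :
  (f @ totally --> l)%classic <->
  forall e : R, 0 < e -> exists J0 : {fset I}, forall J : {fset I}, (J0 `<=` J)%fset -> nr (l - f J) < e.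
Proof.
have FT : Filter (@totally I) by apply: filter_filter; exact: totally_filter.
split=> [/cvgrPdist_lt h e e0|h].
  have e0' : (0 : R[i]) < e%:C%C by rewrite ltcR.
  have [J0 _ hJ] := h _ e0'.
  by exists J0 => J /hJ /=; rewrite -nrE ltcR.
apply/cvgrPdist_lt => e e0; have [J0 hJ] : exists J0 : {fset I}, forall J : {fset I},
    (J0 `<=` J)%fset -> nr (l - f J) < complex.Re e.
  by apply: h; rewrite -ltcR RRe_real // gtr0_real.
exists J0 => // J /= /hJ; rewrite -nrE -ltcR RRe_real // gtr0_real //.
Qed.

Lemma filter_complete (V : completeNormedModType R[i]) (F : set_system V) :
  ProperFilter F ->
  (forall e : R, 0 < e -> exists x : V, F [set y | nr (x - y) < e]%classic) ->
  exists l : V, forall e : R, 0 < e -> F [set y | nr (l - y) < e]%classic.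
Proof.
move=> FF h; have /cauchy_cvgP cF : cauchy F.
  apply: cauchy_exP => e e0; have [|x hx] := h (complex.Re e).
    by rewrite -ltcR RRe_real // gtr0_real.
  exists x; apply: filterS hx => y /=.
  by rewrite -ball_normE /= -ltcR nrE RRe_real // gtr0_real.
exists (lim F) => e e0.
have := cF; move/cvgrPdist_lt => /(_ e%:C%C); rewrite ltcR => /(_ e0).
by apply: filterS => y /=; rewrite -nrE ltcR.
Qed.
End Limits.

Section ComplexComplete.
Variable R : realType.

Lemma normc_le (z : R[i]) : nr z <= `|complex.Re z| + `|complex.Im z|.
Proof.
case: z => a b; rewrite /nr normc_def /=.
rewrite -ler_sqr ?nnegrE ?sqrtr_ge0 ?addr_ge0 // sqr_sqrtr ?addr_ge0 ?sqr_ge0 //.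
by rewrite sqrrD !real_normK ?num_real // addrAC lerDl mulrn_wge0 ?mulr_ge0.
Qed.

Lemma Im_le_nr (z : R[i]) : `|complex.Im z| <= nr z.
Proof.
case: z => a b; rewrite /nr normc_def /=.
by rewrite -sqrtr_sqr ler_wsqrtr // lerDr sqr_ge0.
Qed.

Lemma Re_norm_le_nr (z : R[i]) : `|complex.Re z| <= nr z.
Proof. by rewrite -lecR nrE; exact: normc_ge_Re. Qed.

(** Real and imaginary parts do not increase [nr], so they push the filter to Cauchy filters on [R],
    whose limits are reassembled through [normc_le]. *)
Lemma complex_cauchy_cvg (F : set_system (R[i]^o)) : ProperFilter F -> cauchy F -> cvg F.
Proof.
move=> FF /cauchyP h.
have part (p : R[i] -> R) : (forall x y, p (x - y) = p x - p y) ->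
    (forall z, `|p z| <= nr z) -> exists a : R, forall e, 0 < e ->
    F [set z : R[i]^o | `|a - p z| < e]%classic.
  move=> pB ple; have : cauchy (p @ F)%classic.
    apply: cauchy_exP => e e0.
    have [|x hx] := h e%:C%C; first by rewrite /= ltcR.
    exists (p x); suff : F (p @^-1` (ball (p x) e))%classic by [].
    apply: filterS hx => y; rewrite -ball_normE /= -nrE ltcR => hy.
    rewrite -ball_normE /= -pB; exact: le_lt_trans (ple _) hy.
  move=> /cauchy_cvgP /cvgrPdist_lt cp; exists (lim (p @ F)%classic) => e e0.
  exact: cp.
have [a ha] := part (@complex.Re R) (fun x y => raddfB _ x y) Re_norm_le_nr.
have [b hb] := part (@complex.Im R) (fun x y => raddfB _ x y) Im_le_nr.
apply/cvg_ex; exists (Complex a b : R[i]^o); apply/cvgrPdist_lt => e e0.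
have [d d0 ->] : exists2 d, 0 < d & e = d%:C%C.
  exists (complex.Re e); last by rewrite RRe_real ?gtr0_real.
  by rewrite -ltcR RRe_real ?gtr0_real.
have d2 : 0 < d / 2 by rewrite divr_gt0.
near=> z; rewrite -nrE ltcR; apply: le_lt_trans (normc_le _) _.
rewrite !raddfB /=.
have h1 : `|a - complex.Re z| < d / 2 by near: z; exact: ha.
have h2 : `|b - complex.Im z| < d / 2 by near: z; exact: hb.
lra.
Unshelve. all: by end_near. Qed.

Definition complex_complete : completeNormedModType R[i] :=
  HB.pack (R[i]^o) (Uniform_isComplete.Build (R[i]^o) complex_cauchy_cvg).

End ComplexComplete.

Lemma seq_complete (R : realType) (V : completeNormedModType R[i]) (u : nat -> V) :
  (forall e, 0 < e -> exists n0, forall m n, (n0 <= m)%N -> (n0 <= n)%N ->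
     nr (u m - u n) < e) ->
  exists l, forall e, 0 < e -> exists n0, forall n, (n0 <= n)%N -> nr (u n - l) < e.
Proof.
move=> h; have [e e0|l hl] := @filter_complete R V (u @ \oo)%classic _.
  have [n0 hn] := h _ e0; exists (u n0); exists n0 => // n /= le_n; exact: hn.
exists l => e /hl [n0 _ hn]; exists n0 => n le_n; rewrite nrBC; exact: hn.
Qed.

Section Orthonormal.
Variables (R : realType) (H : hilbertType R).
Implicit Types x y z : H.

Lemma bessel (I : eqType) (e : I -> H) r x : orthonormal_family e -> uniq r ->
  \sum_(i <- r) nr (inner x (e i)) ^+ 2 <= nr x ^+ 2.
Proof.
by move=> oe ur; rewrite -subr_ge0 -bessel_eq // sqr_ge0.
Qed.

Lemma orthonormal_unit x : x != 0 -> orthonormal_family (fun _ : unit => ((nr x)^-1)%:C%C *: x).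
Proof.
move=> x0 [] []; rewrite eqxx innerZl innerZr inner_nr.
have n0 : nr x != 0 by apply: contraNneq x0 => /nr_eq0 ->.
have -> : (((nr x)^-1)%:C%C)^* = ((nr x)^-1)%:C%C :> R[i].
  by apply/CrealP; rewrite complex_real.
rewrite -!rmorphM /=; suff -> : (nr x)^-1 * ((nr x)^-1 * nr x ^+ 2) = 1 by [].
by field.
Qed.

(** This is Bessel's inequality for the one-element orthonormal family y / |y|. *)
Lemma cauchy_schwarz x y : nr (inner x y) <= nr x * nr y.
Proof.
have [->|y0] := eqVneq y 0; first by rewrite inner0r !nr0 mulr0.
have n0 : 0 < nr y by rewrite lt_neqAle nr_ge0 andbT eq_sym; apply: contraNneq y0 => /nr_eq0 ->.
have := bessel x (orthonormal_unit y0) (isT : uniq [:: tt]).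
rewrite big_seq1 innerZr nrM nr_conj nr_real ?invr_ge0 ?nr_ge0 //.
rewrite ler_sqr ?nnegrE ?mulr_ge0 ?invr_ge0 ?nr_ge0 //.
by rewrite ler_pdivrMl // mulrC.
Qed.

(** [has_trace] speaks of complete bases only, whereas the estimates start from finite orthonormal
    families; this is the bridge. With an empty family it provides a basis. *)
Lemma orthonormal_extend (K : choiceType) (e0 : K -> H) : orthonormal_family e0 ->
  exists (I : choiceType) (e : I -> H) (f : K -> I),
    [/\ orthonormal_basis e, injective f & forall k, e (f k) = e0 k].
Proof.
move=> oe0.
pose ons (A : set H) := forall x y, A x -> A y -> inner x y = (x == y)%:R.
have inj0 : injective e0.
  move=> k l kl; apply/eqP; have := oe0 k l; rewrite kl oe0 eqxx.
  by case: (k == l) => // /eqP; rewrite oner_eq0.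
pose A0 := range e0.
have ons0 : ons A0.
  by move=> _ _ [k _ <-] [l _ <-]; rewrite oe0 (inj_eq inj0).
(* Zorn runs over the sets that are orthonormal together with the range of [e0], so the union of an
   empty chain qualifies. *)
have [|A [PA maxA]] := @Zorn_bigcup H (fun A => ons (A0 `|` A)%classic).
  move=> F FP tot x y.
  have up B C : F B -> F C -> exists D, [/\ F D, (B `<=` D)%classic & (C `<=` D)%classic].
    by move=> FB FC; case: (tot _ _ FB FC) => h; [exists C|exists B]; split.
  move=> [hx|[B FB Bx]] [hy|[D FD Dy]].
  - exact: ons0.
  - by apply: (FP D FD); [left|right].
  - by apply: (FP B FB); [right|left].
  - have [G [FG BG DG]] := up _ _ FB FD.
    by apply: (FP G FG); right; [exact: BG|exact: DG].
pose I : choiceType := set_type (A0 `|` A)%classic.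
have fP k : e0 k \in (A0 `|` A)%classic by rewrite inE; left; exists k.
exists I, (fun i : I => val i), (fun k => exist _ (e0 k) (fP k)); split=> //; last first.
  by move=> k l [/inj0].
split=> [[x xA] [y yA]|x hx].
  by rewrite /= (PA x y (set_mem xA) (set_mem yA)).
apply: contrapT => /eqP x0.
have ox := orthonormal_unit x0; set z := ((nr x)^-1)%:C%C *: x in ox.
have zz : inner z z = 1 by rewrite (ox tt tt) eqxx.
have zA y : (A0 `|` A)%classic y -> inner z y = 0.
  by move=> yA; rewrite innerZl (hx (exist _ y (mem_set yA))) mulr0.
have Az y : (A0 `|` A)%classic y -> inner y z = 0.
  by move=> yA; rewrite inner_conj zA // rmorph0.
have zn y : (A0 `|` A)%classic y -> (z == y) = false.
  move=> yA; apply/eqP => zy; have := zA _ yA; rewrite -zy zz => /eqP.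
  by rewrite oner_eq0.
apply: (maxA (A `|` [set z])%classic).
  split=> [y|sub]; first by left.
  have Az' : A z by apply: sub; right.
  by have := zn z (or_intror Az'); rewrite eqxx.
move=> u v; rewrite setUA => -[uA|/= ->] [vA|/= ->].
- exact: PA.
- by rewrite Az // eq_sym zn.
- by rewrite zA // zn.
- by rewrite zz eqxx.
Qed.

End Orthonormal.

Section Expansion.
Variables (R : realType) (H : hilbertType R).

(** A basis is only assumed maximal, so convergence has to come from completeness: the sums of
    squared coefficients increase and are bounded by Bessel, and near their supremum the projections
    differ little. *)
Lemma onb_expand (I : choiceType) (e : I -> H) (x : H) : orthonormal_basis e ->
  forall d : R, 0 < d -> exists J0 : {fset I}, forall J : {fset I}, (J0 `<=` J)%fset ->
    nr (x - proj e J x) < d.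
Proof.
move=> [oe max].
pose s (J : {fset I}) := \sum_(i <- J) nr (inner x (e i)) ^+ 2.
have cau (J0 J : {fset I}) : (J0 `<=` J)%fset ->
    nr (proj e J x - proj e J0 x) ^+ 2 = s J - s J0.
  move=> /fsubsetP sub.
  have h i : i \in J -> inner (proj e J x) (e i) = inner x (e i).
    by move=> iJ; rewrite inner_proj.
  have -> : proj e J0 x = proj e J0 (proj e J x).
    by rewrite [LHS]/proj [RHS]/proj !big_seq; apply: eq_bigr => i /sub /h ->.
  rewrite bessel_eq // proj_nr //; congr (_ - _).
  by rewrite /s !big_seq; apply: eq_bigr => i /sub /h ->.
pose V : set R := range s.
have supV : has_sup V.
  split; first by exists (s fset0), fset0.
  by exists (nr x ^+ 2) => _ [J _ <-]; exact: bessel.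
have near_sup (d : R) : 0 < d -> exists J0 : {fset I}, forall J : {fset I}, (J0 `<=` J)%fset ->
    nr (proj e J x - proj e J0 x) < d.
  move=> d0; have [_ [J0 _ <-] hJ0] := sup_adherent (exprn_gt0 2 d0) supV.
  exists J0 => J sub; rewrite -ltr_sqr ?nnegrE ?nr_ge0 ?ltW // cau //.
  have : s J <= sup V by apply: sup_upper_bound => //; exists J.
  by move: hJ0; lra.
have [d d0|l hl] := @filter_complete R H _
    (fmap_proper_filter (fun J : {fset I} => proj e J x) (@totally_filter I)).
  have [J0 hJ0] := near_sup d d0; exists (proj e J0 x); exists J0 => // J /= /hJ0.
  by rewrite nrBC.
(* The limit has the coefficients of x along every basis vector, so x - l is orthogonal to the basis
   and vanishes by [max]. *)
suff xl : x = l.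
  move=> d /hl [J0 _ h]; exists J0 => J sub; rewrite {1}xl; exact: (h J sub).
apply/eqP; rewrite -subr_eq0; apply/eqP/max => i; apply/nr_small_eq => d d0.
have [J0 _ hJ] := hl _ d0; rewrite subr0.
have sub : (J0 `<=` J0 `|` [fset i])%fset by exact: fsubsetUl.
have iJ : i \in (J0 `|` [fset i])%fset by rewrite !inE eqxx orbT.
rewrite innerBl -(inner_proj oe x (fset_uniq _) iJ) -innerBl.
apply: le_trans (cauchy_schwarz _ _) _; rewrite (orthonormal_nr i oe) mulr1 nrBC ltW //.
exact: hJ sub.
Qed.

End Expansion.

(** * Bounded operators *)

Section Operators.
Variables (R : realType) (H : hilbertType R).
Implicit Types x y z : H.

(** Requiring an adjoint yields linearity for free and avoids the Riesz representation theorem; for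
    a representation the adjoint of pi(a) is pi(star a). *)
Definition adjointable (T : H -> H) : Prop :=
  (exists T', forall x y, inner (T x) y = inner x (T' y)) /\
  (exists M : R, 0 <= M /\ forall x, nr (T x) <= M * nr x).

Record op := Op { opf :> H -> H; opP : adjointable opf }.

HB.instance Definition _ := gen_eqMixin op.
HB.instance Definition _ := gen_choiceMixin op.

Lemma op_ext (S T : op) : (forall x, S x = T x) -> S = T.
Proof.
case: S T => [S SP] [T TP] /= ST; have {}ST : S = T by apply/funext.
by subst T; congr Op; exact: Prop_irrelevance.
Qed.

Fact adjointable0 : adjointable (fun=> 0).
Proof.
split; first by exists (fun=> 0) => x y; rewrite inner0l inner0r.
by exists 0; split=> // x; rewrite nr0 mul0r.
Qed.

Fact adjointable1 : adjointable id.
Proof. by split; [exists id|exists 1; split=> // x; rewrite mul1r]. Qed.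

Fact adjointableD (S T : op) : adjointable (fun x => S x + T x).
Proof.
case: S T => [S [[S' SP] [M [M0 SM]]]] [T [[T' TP] [N [N0 TN]]]] /=; split.
  by exists (fun y => S' y + T' y) => x y; rewrite innerDl innerDr SP TP.
exists (M + N); split=> [|x]; first exact: addr_ge0.
by rewrite mulrDl; apply: le_trans (nrD _ _) (lerD _ _).
Qed.

Fact adjointableM (S T : op) : adjointable (fun x => S (T x)).
Proof.
case: S T => [S [[S' SP] [M [M0 SM]]]] [T [[T' TP] [N [N0 TN]]]] /=; split.
  by exists (fun y => T' (S' y)) => x y; rewrite SP TP.
exists (M * N); split=> [|x]; first exact: mulr_ge0.
by apply: le_trans (SM _) _; rewrite -mulrA ler_wpM2l.
Qed.

Fact adjointable_rank1 x y : adjointable (fun z => inner z y *: x).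
Proof.
split; first by exists (fun z => inner z x *: y) => z t;
  rewrite innerZl innerZr -inner_conj mulrC.
exists (nr y * nr x); split=> [|z]; first by rewrite mulr_ge0 ?nr_ge0.
rewrite nrZ mulrAC (mulrC (nr y)) ler_wpM2r ?nr_ge0 //; exact: cauchy_schwarz.
Qed.

Fact adjointableZ (k : R[i]) : adjointable (fun x => k *: x).
Proof.
split; first by exists (fun x => k^* *: x) => x y; rewrite innerZl innerZr conjCK.
by exists (nr k); split=> [|x]; rewrite ?nr_ge0 ?nrZ.
Qed.

Definition op_scale k : op := Op (adjointableZ k).
Definition op_zero : op := Op adjointable0.
Definition op_one : op := Op adjointable1.
Definition op_add (S T : op) : op := Op (adjointableD S T).
Definition op_mul (S T : op) : op := Op (adjointableM S T).
Definition op_opp (T : op) : op := op_mul (op_scale (-1)) T.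
Definition rank1 x y : op := Op (adjointable_rank1 x y).

Lemma opD_arg (T : op) x y : T (x + y) = T x + T y.
Proof.
case: T => [T [[T' TP] _]] /=; apply: nr_inner_eq => z.
by rewrite innerDl !TP innerDl.
Qed.

Lemma opZ_arg (T : op) k x : T (k *: x) = k *: T x.
Proof.
case: T => [T [[T' TP] _]] /=; apply: nr_inner_eq => z.
by rewrite innerZl !TP innerZl.
Qed.

Fact op_addA : associative op_add.
Proof. by move=> S T U; apply: op_ext => x /=; rewrite addrA. Qed.
Fact op_addC : commutative op_add.
Proof. by move=> S T; apply: op_ext => x /=; rewrite addrC. Qed.
Fact op_add0 : left_id op_zero op_add.
Proof. by move=> S; apply: op_ext => x /=; rewrite add0r. Qed.
Fact op_addN : left_inverse op_zero op_opp op_add.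
Proof. by move=> S; apply: op_ext => x /=; rewrite scaleN1r addNr. Qed.

HB.instance Definition _ := GRing.isZmodule.Build op op_addA op_addC op_add0 op_addN.

Fact op_mulA : associative op_mul.
Proof. by move=> S T U; apply: op_ext. Qed.
Fact op_mul1 : left_id op_one op_mul.
Proof. by move=> S; apply: op_ext. Qed.
Fact op_mul1r : right_id op_one op_mul.
Proof. by move=> S; apply: op_ext. Qed.
Fact op_mulDl : left_distributive op_mul op_add.
Proof. by move=> S T U; apply: op_ext. Qed.
Fact op_mulDr : right_distributive op_mul op_add.
Proof. by move=> S T U; apply: op_ext => x /=; rewrite opD_arg. Qed.

HB.instance Definition _ := GRing.Zmodule_isPzRing.Build op
  op_mulA op_mul1 op_mul1r op_mulDl op_mulDr.

Lemma op_addE (S T : op) x : (S + T) x = S x + T x. Proof. by []. Qed.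
Lemma op_mulE (S T : op) x : (S * T) x = S (T x). Proof. by []. Qed.
Lemma op_oppE (T : op) x : (- T) x = - T x. Proof. by rewrite -scaleN1r. Qed.
Lemma op_subE (S T : op) x : (S - T) x = S x - T x.
Proof. by rewrite op_addE op_oppE. Qed.

Lemma op_sumE I (r : seq I) (P : pred I) (F : I -> op) x :
  (\sum_(i <- r | P i) F i) x = \sum_(i <- r | P i) F i x.
Proof. by apply: (big_morph (fun T : op => T x)). Qed.

Lemma op0_arg (T : op) : T 0 = 0.
Proof. by have := opZ_arg T 0 0; rewrite !scale0r. Qed.

Lemma opB_arg (T : op) x y : T (x - y) = T x - T y.
Proof. by rewrite opD_arg -!(scaleN1r y) opZ_arg scaleN1r. Qed.

Lemma op_sum_arg (T : op) I (r : seq I) (P : pred I) (F : I -> H) :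
  T (\sum_(i <- r | P i) F i) = \sum_(i <- r | P i) T (F i).
Proof. by apply: (big_morph T); [exact: opD_arg|exact: op0_arg]. Qed.

Definition adj (T : op) : H -> H := projT1 (cid (proj1 (opP T))).

Lemma adjP (T : op) x y : inner (T x) y = inner x (adj T y).
Proof. by rewrite /adj; case: cid => /= ?; apply. Qed.

Lemma adjP' (T : op) x y : inner (adj T x) y = inner x (T y).
Proof. by rewrite inner_conj -adjP -inner_conj. Qed.

(** From |T'x|^2 = <T T'x, x> <= M |T'x| |x|, where T' is the adjoint, after division by |T'x|. *)
Lemma adj_bound (T : op) M : 0 <= M -> (forall x, nr (T x) <= M * nr x) ->
  forall x, nr (adj T x) <= M * nr x.
Proof.
move=> M0 TM x; have [->|] := eqVneq (nr (adj T x)) 0; first by rewrite mulr_ge0 ?nr_ge0.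
move=> n0; have p : 0 < nr (adj T x) by rewrite lt_neqAle eq_sym n0 nr_ge0.
rewrite -(ler_pM2l p) -expr2.
have -> : nr (adj T x) ^+ 2 = complex.Re (inner (T (adj T x)) x) by rewrite adjP inner_nr.
apply: le_trans (Re_le_nr _) _; apply: le_trans (cauchy_schwarz _ _) _.
by rewrite mulrCA mulrA ler_wpM2r ?nr_ge0.
Qed.

Definition op_bounds (T : op) : set R :=
  [set M | 0 <= M /\ forall x, nr (T x) <= M * nr x]%classic.

Definition opnorm (T : op) : R := inf (op_bounds T).

Lemma op_bounds_inf (T : op) : has_inf (op_bounds T).
Proof.
split; first by have [M MP] := proj2 (opP T); exists M.
by exists 0 => M [].
Qed.

Lemma opnorm_ge0 (T : op) : 0 <= opnorm T.
Proof. by apply: lb_le_inf; [case: (op_bounds_inf T)|move=> M []]. Qed.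

Lemma opnorm_le (T : op) M : 0 <= M -> (forall x, nr (T x) <= M * nr x) -> opnorm T <= M.
Proof. by move=> M0 TM; apply: ge_inf; [case: (op_bounds_inf T)|split]. Qed.

Lemma opnormP (T : op) x : nr (T x) <= opnorm T * nr x.
Proof.
have [x0|] := eqVneq (nr x) 0.
  have := opZ_arg T 0 x; rewrite (nr_eq0 x0) !scale0r => ->.
  by rewrite nr0 mulr0.
move=> n0; have p : 0 < nr x by rewrite lt_neqAle eq_sym n0 nr_ge0.
rewrite -ler_pdivrMr //; apply: lb_le_inf; first by case: (op_bounds_inf T).
by move=> M [M0 TM]; rewrite ler_pdivrMr.
Qed.

End Operators.

Section OperatorNorm.
Variables (R : realType) (H : hilbertType R).
Local Notation op := (op H).
Implicit Types (S T A f : op) (x y z : H).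

Lemma nr_lim_le (V : normedModType R[i]) (u : nat -> V) (l : V) (C : R) n0 :
  (forall e, 0 < e -> exists n1, forall n, (n1 <= n)%N -> nr (u n - l) < e) ->
  (forall n, (n0 <= n)%N -> nr (u n) <= C) -> nr l <= C.
Proof.
move=> ul uC; apply/ler_addgt0Pr => e e0; have [n1 h] := ul _ e0.
have := h _ (leq_maxr n0 n1); have := uC _ (leq_maxl n0 n1).
set n := maxn n0 n1 => h1 h2; rewrite -[l](subrK (u n)) addrC.
by apply: le_trans (nrD _ _) _; rewrite nrBC lerD // ltW // nrBC.
Qed.

Lemma adjB S T y : adj (S - T) y = adj S y - adj T y.
Proof.
apply: nr_inner_eq => z.
by rewrite innerBl !adjP' op_subE innerBr.
Qed.

Lemma adj_opnorm T y : nr (adj T y) <= opnorm T * nr y.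
Proof. by apply: adj_bound; [exact: opnorm_ge0|exact: opnormP]. Qed.

Lemma opnorm_complete : complete_norm (@opnorm R H).
Proof.
split.
- by apply/le_anti; rewrite opnorm_ge0 andbT opnorm_le // => x; rewrite nr0 mul0r.
- move=> T T0; apply: op_ext => x; apply/nr_eq0/le_anti; rewrite nr_ge0 andbT.
  by have := opnormP T x; rewrite T0 mul0r.
- move=> T; congr inf; apply/seteqP; split=> M [M0 TM]; split=> // x.
    by have := TM x; rewrite op_oppE nrN.
  by rewrite op_oppE nrN.
- move=> S T; apply: opnorm_le => [|x]; first by rewrite addr_ge0 ?opnorm_ge0.
  by rewrite mulrDl; apply: le_trans (nrD _ _) (lerD (opnormP _ _) (opnormP _ _)).
- move=> S T; apply: opnorm_le => [|x]; first by rewrite mulr_ge0 ?opnorm_ge0.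
  rewrite -mulrA; apply: le_trans (opnormP S (T x)) _.
  by rewrite ler_wpM2l ?opnorm_ge0 ?opnormP.
move=> u cau.
(* Stated for a general F so that it applies to the operators and to their adjoints: the limit
   operator must come with an adjoint. *)
have conv (F : op -> H -> H) : (forall S T y, F (S - T) y = F S y - F T y) ->
    (forall T y, nr (F T y) <= opnorm T * nr y) ->
    forall y, exists l, forall e, 0 < e -> exists n0, forall n, (n0 <= n)%N ->
      nr (F (u n) y - l) < e.
  move=> FB Fb y; apply: seq_complete => e e0.
  have p : 0 < nr y + 1 by have := nr_ge0 y; lra.
  have [n0 h] := cau _ (divr_gt0 e0 p); exists n0 => m n hm hn.
  rewrite -FB; apply: le_lt_trans (Fb _ _) _.
  have := h _ _ hm hn; rewrite ltr_pdivlMr //.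
  by have := opnorm_ge0 (u m - u n); lra.
have cvT := conv (fun T x => T x) (@op_subE R H) (@opnormP R H).
have cvA := conv (fun T x => adj T x) adjB adj_opnorm.
pose T x := projT1 (cid (cvT x)); pose A x := projT1 (cid (cvA x)).
have TP x : forall e, 0 < e -> exists n0, forall n, (n0 <= n)%N -> nr (u n x - T x) < e.
  by rewrite /T; case: cid.
have AP x : forall e, 0 < e -> exists n0, forall n, (n0 <= n)%N -> nr (adj (u n) x - A x) < e.
  by rewrite /A; case: cid.
have bd e : 0 < e -> exists n0, forall n, (n0 <= n)%N -> forall x, nr (u n x - T x) <= e * nr x.
  move=> /cau [n0 h]; exists n0 => n hn x.
  apply: (@nr_lim_le _ (fun m => u n x - u m x) _ _ n0) => [d d0|m hm].
    have [n1 h1] := TP x _ d0; exists n1 => m /h1.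
    by rewrite opprB [_ + (T x - _)]addrC addrA subrK nrBC.
  rewrite -op_subE; apply: le_trans (opnormP _ _) _.
  by rewrite ler_wpM2r ?nr_ge0 // ltW // h.
have adT : adjointable T.
  split.
    exists A => x y; apply: nr_small_eq => e e0.
    have p : 0 < nr x + nr y + 1 by have := nr_ge0 x; have := nr_ge0 y; lra.
    have [n0 h0] := TP x _ (divr_gt0 e0 p); have [n1 h1] := AP y _ (divr_gt0 e0 p).
    have {}h0 := h0 _ (leq_maxl n0 n1); have {}h1 := h1 _ (leq_maxr n0 n1).
    set n := maxn n0 n1 in h0 h1.
    have -> : inner (T x) y - inner x (A y) =
        - inner (u n x - T x) y + inner x (adj (u n) y - A y).
      by rewrite innerBl innerBr adjP opprB addrA subrK.
    apply: le_trans (nrD _ _) _; rewrite nrN.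
    move: h0 h1; rewrite !ltr_pdivlMr // => h0 h1.
    have := cauchy_schwarz (u n x - T x) y; have := cauchy_schwarz x (adj (u n) y - A y).
    have := nr_ge0 (u n x - T x); have := nr_ge0 (adj (u n) y - A y).
    have := nr_ge0 x; have := nr_ge0 y; move: h0 h1.
    set a := nr (u n x - T x); set b := nr (adj (u n) y - A y); nra.
  have [n0 h] := bd 1 ltr01; exists (opnorm (u n0) + 1); split=> [|x].
    by have := opnorm_ge0 (u n0); lra.
  rewrite -[T x](subrK (u n0 x)) mulrDl addrC; apply: le_trans (nrD _ _) _.
  by rewrite lerD ?opnormP // nrBC h.
exists (Op adT) => e e0; have [n0 h] := bd _ (divr_gt0 e0 (ltr0Sn R 1)).
exists n0 => n hn; apply: le_lt_trans (_ : e / 2 < e); last by lra.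
by apply: opnorm_le => [|x]; [lra|rewrite op_subE h].
Qed.

Lemma mul_rank1 A x y : A * rank1 x y = rank1 (A x) y.
Proof. by apply: op_ext => z /=; rewrite opZ_arg. Qed.

Lemma rank1_mul A x y : rank1 x y * A = rank1 x (adj A y).
Proof. by apply: op_ext => z /=; rewrite adjP. Qed.

Definition finite_rank T : Prop :=
  exists r : seq (H * H), T = \sum_(p <- r) rank1 p.1 p.2.

Lemma finite_rank_ideal : ideal finite_rank.
Proof.
split.
- by exists [::]; rewrite big_nil.
- by move=> _ _ [r ->] [r' ->]; exists (r ++ r'); rewrite big_cat.
- move=> A _ [r ->]; exists [seq (A p.1, p.2) | p <- r].
  by rewrite big_map mulr_sumr; apply: eq_bigr => p _; rewrite mul_rank1.
- move=> _ A [r ->]; exists [seq (p.1, adj A p.2) | p <- r].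
  by rewrite big_map mulr_suml; apply: eq_bigr => p _; rewrite rank1_mul.
Qed.

(** * Trace norm and trace *)

(** Bessel families of bound 1. Contractions preserve this class but not orthonormality, and this is
    why the trace norm built on it is compatible with multiplication by operators. *)
Definition contractive (s : seq H) : Prop :=
  forall x, \sum_(a <- s) nr (inner x a) ^+ 2 <= nr x ^+ 2.

(* The trace norm of T is at most C: the pairings run over the images of
   orthonormal systems under contractions. *)
Definition tnorm_le T (C : R) : Prop := forall r : seq (H * H),
  contractive (unzip1 r) -> contractive (unzip2 r) ->
  nr (\sum_(p <- r) inner (T p.1) p.2) <= C.

(** The trace norm closure of the finite rank operators. No absolute value occurs, so ideal
    properties and cyclicity follow by approximation; [trace_class_ideal] makes the connection with
    |T|. *)
Definition trace_ideal T : Prop :=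
  forall e, 0 < e -> exists f, finite_rank f /\ tnorm_le (T - f) e.

Lemma contractive_map (g g' : H -> H) s : (forall x y, inner x (g y) = inner (g' x) y) ->
  (forall x, nr (g' x) <= nr x) -> contractive s -> contractive (map g s).
Proof.
move=> gg' g1 cs x; rewrite big_map; apply: le_trans (_ : nr (g' x) ^+ 2 <= _).
  by under eq_bigr => a _ do rewrite gg'; apply: cs.
by rewrite ler_sqr ?nnegrE ?nr_ge0.
Qed.

Lemma contractive_orthonormal (I : eqType) (e : I -> H) s : orthonormal_family e -> uniq s ->
  contractive (map e s).
Proof. by move=> oe us x; rewrite big_map; exact: bessel. Qed.

Lemma tnormD S T C D : tnorm_le S C -> tnorm_le T D -> tnorm_le (S + T) (C + D).
Proof.
move=> SC TD r r1 r2; under eq_bigr => p _ do rewrite op_addE innerDl.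
by rewrite big_split; apply: le_trans (nrD _ _) (lerD (SC _ r1 r2) (TD _ r1 r2)).
Qed.

(** Dividing by it turns [A] into a contraction, also when [A] is 0. *)
Let norm1 A := opnorm A + 1.
Let norm1_gt0 A : 0 < norm1 A.
Proof. by have := opnorm_ge0 A; rewrite /norm1; lra. Qed.
Let scaled A x (g : H -> H) : (forall y, nr (g y) <= opnorm A * nr y) ->
  nr ((norm1 A)^-1%:C%C *: g x) <= nr x.
Proof.
move=> gA; rewrite nrZ nr_real; last by rewrite invr_ge0 ltW.
rewrite ler_pdivrMl //.
by apply: le_trans (gA x) _; rewrite ler_wpM2r ?nr_ge0 // /norm1; lra.
Qed.
Let norm1_conj A : ((norm1 A)^-1%:C%C)^* = (norm1 A)^-1%:C%C.
Proof. by apply/CrealP; rewrite complex_real. Qed.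
Let norm1K A (z : R[i]) : (norm1 A)%:C%C * ((norm1 A)^-1%:C%C * z) = z.
Proof. by rewrite mulrA -rmorphM /= divff ?mul1r // gt_eqF. Qed.

Lemma tnormMl A T C : tnorm_le T C -> tnorm_le (A * T) ((opnorm A + 1) * C).
Proof.
move=> TC r r1 r2; pose g y : H := (norm1 A)^-1%:C%C *: adj A y.
have -> : \sum_(p <- r) inner ((A * T) p.1) p.2 =
    (norm1 A)%:C%C * \sum_(p <- [seq (p.1, g p.2) | p <- r]) inner (T p.1) p.2.
  rewrite big_map mulr_sumr; apply: eq_bigr => p _.
  by rewrite op_mulE adjP innerZr norm1_conj norm1K.
rewrite nrM nr_real; last exact: ltW.
rewrite ler_pM2l //; apply: TC; rewrite /unzip1 /unzip2 -map_comp //.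
rewrite (@eq_map _ _ _ (g \o snd)) // map_comp.
apply: (@contractive_map _ (fun x => (norm1 A)^-1%:C%C *: A x)) => // [x y|x].
  by rewrite innerZr norm1_conj innerZl adjP.
by apply: scaled; exact: opnormP.
Qed.

Lemma tnormMr A T C : tnorm_le T C -> tnorm_le (T * A) ((opnorm A + 1) * C).
Proof.
move=> TC r r1 r2; pose g y : H := (norm1 A)^-1%:C%C *: A y.
have -> : \sum_(p <- r) inner ((T * A) p.1) p.2 =
    (norm1 A)%:C%C * \sum_(p <- [seq (g p.1, p.2) | p <- r]) inner (T p.1) p.2.
  rewrite big_map mulr_sumr; apply: eq_bigr => p _.
  by rewrite op_mulE opZ_arg innerZl norm1K.
rewrite nrM nr_real; last exact: ltW.
rewrite ler_pM2l //; apply: TC; rewrite /unzip1 /unzip2 -map_comp //.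
rewrite (@eq_map _ _ _ (g \o fst)) // map_comp.
apply: (@contractive_map _ (fun x => (norm1 A)^-1%:C%C *: adj A x)) => // [x y|x].
  by rewrite innerZr norm1_conj innerZl adjP'.
by apply: scaled; exact: adj_opnorm.
Qed.

Lemma tnorm_opnorm T C : 0 <= C -> tnorm_le T C -> opnorm T <= C.
Proof.
move=> C0 TC; apply: opnorm_le => // x.
have [x0|x0] := eqVneq x 0; first by rewrite x0 op0_arg nr0 mulr0.
have [->|Tx0] := eqVneq (T x) 0; first by rewrite nr0 mulr_ge0 ?nr_ge0.
have pos y : y != 0 -> 0 < nr y.
  by move=> y0; rewrite lt_neqAle nr_ge0 andbT eq_sym; apply: contraNneq y0 => /nr_eq0 ->.
have unit y : y != 0 -> contractive [:: ((nr y)^-1)%:C%C *: y].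
  by move=> y0; have := contractive_orthonormal (orthonormal_unit y0) (isT : uniq [:: tt]).
have := TC [:: (((nr x)^-1)%:C%C *: x, ((nr (T x))^-1)%:C%C *: T x)] (unit _ x0) (unit _ Tx0).
rewrite big_seq1 /= opZ_arg innerZl innerZr !nrM nr_conj inner_nr !nr_real ?invr_ge0 ?sqr_ge0 ?nr_ge0 //.
have -> : (nr x)^-1 * ((nr (T x))^-1 * nr (T x) ^+ 2) = nr (T x) / nr x.
  by field; rewrite !gt_eqF ?pos.
by rewrite ler_pdivrMr ?pos.
Qed.

Lemma trace_ideal_compact T : trace_ideal T -> closure_ideal (@opnorm R H) finite_rank T.
Proof.
move=> LT e e0; have [f [Ff hf]] := LT _ (divr_gt0 e0 (ltr0Sn R 1)).
exists f; split=> //; apply: le_lt_trans (tnorm_opnorm _ hf) _; lra.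
Qed.

Lemma trace_idealP : ideal trace_ideal.
Proof.
split.
- move=> e e0; exists 0; split; first exact: (ideal0 finite_rank_ideal).
  move=> r _ _; rewrite subr0 big1 ?nr0 ?ltW // => p _; exact: inner0l.
- move=> S T LS LT e e0.
  have [f [Ff hf]] := LS _ (divr_gt0 e0 (ltr0Sn R 1)).
  have [g [Fg hg]] := LT _ (divr_gt0 e0 (ltr0Sn R 1)).
  exists (f + g); split; first exact: (idealD finite_rank_ideal).
  rewrite opprD addrACA; have := tnormD hf hg.
  by rewrite (_ : e / 2 + e / 2 = e) //; lra.
- move=> A T LT e e0; have [f [Ff hf]] := LT _ (divr_gt0 e0 (norm1_gt0 A)).
  exists (A * f); split; first exact: (idealMl finite_rank_ideal).
  by have := tnormMl A hf; rewrite mulrBr /norm1 mulrC divfK // gt_eqF ?norm1_gt0.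
- move=> T A LT e e0; have [f [Ff hf]] := LT _ (divr_gt0 e0 (norm1_gt0 A)).
  exists (f * A); split; first exact: (idealMr finite_rank_ideal).
  by have := tnormMr A hf; rewrite mulrBl /norm1 mulrC divfK // gt_eqF ?norm1_gt0.
Qed.

Lemma finite_rank_trace T : finite_rank T -> trace_ideal T.
Proof.
move=> FT e e0; exists T; split=> // r _ _.
by rewrite subrr big1 ?nr0 ?ltW // => p _; exact: inner0l.
Qed.

End OperatorNorm.

Section Trace.
Variables (R : realType) (H : hilbertType R).
Local Notation op := (op H).
Implicit Types (S T A f : op) (x y z : H).

Lemma has_traceP (T : H -> H) (t : R[i]) : has_trace T t <->
  forall (I : choiceType) (e : I -> H), orthonormal_basis e -> forall d : R, 0 < d ->
    exists J0 : {fset I}, forall J : {fset I}, (J0 `<=` J)%fset ->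
      nr (t - \sum_(i <- J) inner (T (e i)) (e i)) < d.
Proof.
have psE (I : choiceType) (e : I -> H) (J : {fset I}) :
    partial_sum (fun i => inner (T (e i)) (e i) : R[i]^o) J =
    \sum_(i <- J) inner (T (e i)) (e i).
  by rewrite /partial_sum big_seq_fsetE.
split=> [h I e oe d d0|h I e oe].
  have /totally_cvgP /(_ d d0) [J0 hJ] := h I e oe.
  by exists J0 => J /hJ; rewrite psE.
by apply/totally_cvgP => d /(h I e oe) [J0 hJ]; exists J0 => J /hJ; rewrite psE.
Qed.

Lemma has_trace_ext (T T' : H -> H) t : (forall x, T x = T' x) ->
  has_trace T t -> has_trace T' t.
Proof. by move=> /funext ->. Qed.

(** Since [has_trace] quantifies over all bases, the uniqueness of its value depends on there being
    one. *)
Lemma onb_exists : exists (I : choiceType) (e : I -> H), orthonormal_basis e.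
Proof.
have [|I [e [_ [oe _ _]]]] := @orthonormal_extend R H void (of_void H).
  by case.
by exists I, e.
Qed.

Lemma has_traceD S T s t : has_trace S s -> has_trace T t -> has_trace (S + T) (s + t).
Proof.
move=> /has_traceP hS /has_traceP hT; apply/has_traceP => I e oe d d0.
have [J1 h1] := hS I e oe _ (divr_gt0 d0 (ltr0Sn R 1)).
have [J2 h2] := hT I e oe _ (divr_gt0 d0 (ltr0Sn R 1)).
exists (J1 `|` J2)%fset => J; rewrite fsubUset => /andP[/h1 {}h1 /h2 {}h2].
under eq_bigr => i _ do rewrite op_addE innerDl.
rewrite big_split /= opprD addrACA; apply: le_lt_trans (nrD _ _) _; lra.
Qed.

Lemma has_trace_tnorm T C t : tnorm_le T C -> has_trace T t -> nr t <= C.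
Proof.
move=> TC /has_traceP hT; have [I [e oe]] := onb_exists.
apply/ler_addgt0Pr => d d0; have [J hJ] := hT I e oe _ d0.
have {hJ} := hJ J (fsubset_refl _); set u := \sum_(i <- _) _ => hu.
have : nr u <= C.
  have := TC [seq (e i, e i) | i <- J]; rewrite big_map; apply.
    rewrite /unzip1 -map_comp; exact: (contractive_orthonormal (proj1 oe)).
  rewrite /unzip2 -map_comp; exact: (contractive_orthonormal (proj1 oe)).
rewrite -[t](subrK u) => hC; apply: le_trans (nrD _ _) _; lra.
Qed.

Lemma has_trace_opp T t : has_trace T t -> has_trace (- T) (- t).
Proof.
move=> /has_traceP hT; apply/has_traceP => I e oe d /(hT I e oe) [J0 hJ].
exists J0 => J /hJ; under [in X in _ -> X]eq_bigr => i _ do rewrite op_oppE innerNl.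
by rewrite sumrN -opprD nrN.
Qed.

Lemma has_trace_uniq T s t : has_trace T s -> has_trace T t -> s = t.
Proof.
move=> hs ht; apply: nr_small_eq => e e0.
have := has_traceD hs (has_trace_opp ht); rewrite subrr.
apply: has_trace_tnorm => r _ _; rewrite big1 ?nr0 ?ltW // => p _; exact: inner0l.
Qed.

(** The partial sum over J is <proj_J x, y>, so this is the expansion of x in the basis. *)
Lemma has_trace_rank1 x y : has_trace (rank1 x y) (inner x y).
Proof.
apply/has_traceP => I e oe d d0.
have p : 0 < nr y + 1 by have := nr_ge0 y; lra.
have [J0 h] := onb_expand x oe (divr_gt0 d0 p); exists J0 => J /h {}h.
have -> : \sum_(i <- J) inner (rank1 x y (e i)) (e i) = inner (proj e J x) y.
  rewrite inner_suml; apply: eq_bigr => i _ /=.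
  by rewrite !innerZl mulrC.
rewrite -innerBl; apply: le_lt_trans (cauchy_schwarz _ _) _.
by move: h; rewrite ltr_pdivlMr //; have := nr_ge0 (x - proj e J x); lra.
Qed.

Lemma has_trace0 : has_trace (0 : op) 0.
Proof.
apply/has_traceP => I e oe d d0; exists fset0 => J _.
by rewrite big1 ?subr0 ?nr0 // => i _; exact: inner0l.
Qed.

Lemma has_trace_sum J (r : seq J) (F : J -> op) (t : J -> R[i]) :
  (forall i, has_trace (F i) (t i)) ->
  has_trace (\sum_(i <- r) F i) (\sum_(i <- r) t i).
Proof.
move=> h; elim: r => [|i r IH]; first by rewrite !big_nil; exact: has_trace0.
by rewrite !big_cons; exact: (@has_traceD (F i) _ (t i) _ (h i) IH).
Qed.

Lemma trace_exists T : trace_ideal T -> exists t, has_trace T t.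
Proof.
move=> LT.
(* The approximate value t, the trace of a finite rank approximation, serves all bases at once. A
   limit found in one basis is therefore the limit in every other. *)
have apx d : 0 < d -> exists t, forall (I : choiceType) (e : I -> H),
    orthonormal_basis e -> exists J0 : {fset I}, forall J : {fset I}, (J0 `<=` J)%fset ->
      nr (t - \sum_(i <- J) inner (T (e i)) (e i)) < d.
  move=> d0; have [_ [[r ->] fd]] := LT _ (divr_gt0 d0 (ltr0Sn R 1)).
  set f := \sum_(p <- r) _ in fd.
  have /has_traceP ft : has_trace f (\sum_(p <- r) inner p.1 p.2).
    by apply: has_trace_sum => p; exact: has_trace_rank1.
  exists (\sum_(p <- r) inner p.1 p.2) => I e oe.
  have [J0 hJ] := ft I e oe _ (divr_gt0 d0 (ltr0Sn R 1)); exists J0 => J /hJ.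
  set t := \sum_(p <- r) _; set u := \sum_(i <- J) _; set v := \sum_(i <- J) _ => h.
  have : nr (v - u) <= d / 2.
    have := fd [seq (e i, e i) | i <- J]; rewrite big_map.
    under eq_bigr => i _ do rewrite op_subE innerBl.
    rewrite sumrB; apply.
      rewrite /unzip1 -map_comp; exact: (contractive_orthonormal (proj1 oe)).
    rewrite /unzip2 -map_comp; exact: (contractive_orthonormal (proj1 oe)).
  have -> : t - v = (t - u) + (u - v) by rewrite addrA subrK.
  rewrite (nrBC v) => h'; apply: le_lt_trans (nrD _ _) _; lra.
have [I [e oe]] := onb_exists.
have [d d0|t ht] := @filter_complete R (complex_complete R) _ (fmap_proper_filter
    (fun J : {fset I} => \sum_(i <- J) inner (T (e i)) (e i) : complex_complete R) (@totally_filter I)).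
  have [t /(_ I e oe) [J0 hJ]] := apx _ d0; exists t; exists J0 => //.
exists t; apply/has_traceP => I' e' oe' d d0.
have d3 : 0 < d / 3 by rewrite divr_gt0.
have [s hs] := apx _ d3; have [J1 h1] := hs I' e' oe'; have [J2 h2] := hs I e oe.
have [J3 _ h3] := ht _ d3.
have {}h2 := h2 _ (fsubsetUl J2 J3); have {}h3 := h3 _ (fsubsetUr J2 J3).
exists J1 => J /h1 {}h1; set v := \sum_(i <- J) _ in h1 *.
move: h2 h3 => /=; set w := \sum_(i <- _) _ => h2 h3.
have -> : t - v = (t - w) - (s - w) + (s - v) by rewrite opprB !addrA !subrK.
apply: le_lt_trans (nrD _ _) _; apply: le_lt_trans (lerD (nrB _ _) (lexx _)) _.
have -> : d = d / 3 + d / 3 + d / 3 by lra.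
by rewrite !ltrD.
Qed.

Definition Tr (T : op) : R[i] := xget 0 [set t | has_trace T t]%classic.

Lemma TrP T : trace_ideal T -> has_trace T (Tr T).
Proof. by move=> /trace_exists; exact: xgetPex. Qed.

Lemma Tr_eq T t : has_trace T t -> Tr T = t.
Proof.
move=> ht; apply: (@has_trace_uniq T _ _ _ ht).
by apply: xgetPex; exists t.
Qed.

Lemma TrD S T : trace_ideal S -> trace_ideal T -> Tr (S + T) = Tr S + Tr T.
Proof. by move=> /TrP hS /TrP hT; exact/Tr_eq/(has_traceD hS hT). Qed.

Lemma Tr_tnorm S T C : trace_ideal S -> trace_ideal T -> tnorm_le (S - T) C ->
  nr (Tr S - Tr T) <= C.
Proof.
move=> /TrP hS /TrP hT hC; apply: has_trace_tnorm hC _.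
exact: (has_traceD hS (has_trace_opp hT)).
Qed.

(** By trace norm approximation of [T] it suffices to treat rank one operators, where both sides
    equal <A x, y>. *)
Lemma Tr_mulC A T : trace_ideal T -> Tr (A * T) = Tr (T * A).
Proof.
have idL := trace_idealP H; move=> LT; apply: nr_small_eq => e e0.
have p : 0 < opnorm A + 1 by have := opnorm_ge0 A; lra.
have [f [Ff fT]] := LT _ (divr_gt0 (divr_gt0 e0 (ltr0Sn R 1)) p).
have Lf := finite_rank_trace Ff.
have half : (opnorm A + 1) * (e / 2 / (opnorm A + 1)) = e / 2.
  by rewrite mulrC divfK // gt_eqF.
have h1 : nr (Tr (A * T) - Tr (A * f)) <= e / 2.
  apply: Tr_tnorm; [exact: (idealMl idL)|exact: (idealMl idL)|].
  by rewrite -mulrBr -half; apply: tnormMl.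
have h2 : nr (Tr (T * A) - Tr (f * A)) <= e / 2.
  apply: Tr_tnorm; [exact: (idealMr idL)|exact: (idealMr idL)|].
  by rewrite -mulrBl -half; apply: tnormMr.
have ff : Tr (A * f) = Tr (f * A).
  have [r ->] := Ff; rewrite mulr_sumr mulr_suml.
  transitivity (\sum_(p <- r) inner (A p.1) p.2).
    by apply/Tr_eq/has_trace_sum => q; rewrite mul_rank1; exact: has_trace_rank1.
  by apply/esym/Tr_eq/has_trace_sum => q; rewrite rank1_mul adjP; exact: has_trace_rank1.
have -> : Tr (A * T) - Tr (T * A) = (Tr (A * T) - Tr (A * f)) - (Tr (T * A) - Tr (f * A)).
  by rewrite ff opprB addrA subrK.
by apply: le_trans (nrB _ _) _; lra.
Qed.

End Trace.

(** * Orthonormal and singular vectors of finite families *)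

Section SingularValues.
Variables (R : realType) (H : hilbertType R).
Local Notation op := (op H).

(** The last clause stands for the membership of the h_k in the span of [g]: whatever is orthogonal
    to [g] is orthogonal to them. *)
Lemma gram_schmidt (g : seq H) : exists (K : finType) (h : K -> H),
  [/\ orthonormal_family h,
      forall a, a \in g -> a = \sum_k inner a (h k) *: h k
    & forall x, (forall a, a \in g -> inner a x = 0) -> forall k, inner (h k) x = 0].
Proof.
elim: g => [|b g [K [h [oh sp orth]]]].
  exists void, (of_void H); split=> [[]|a|x _ []]; by rewrite in_nil.
pose c := b - proj h (index_enum K) b.
have pE x k : inner (proj h (index_enum K) x) (h k) = inner x (h k).
  by rewrite inner_proj ?index_enum_uniq ?mem_index_enum.
have [c0|c0] := eqVneq c 0.
  exists K, h; split=> //.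
    move=> a; rewrite inE => /orP[/eqP ->|/sp //].
    by apply/eqP; rewrite -subr_eq0; apply/eqP; rewrite -[RHS]c0.
  by move=> x hx k; apply: orth => a ag; apply: hx; rewrite inE ag orbT.
pose z := ((nr c)^-1)%:C%C *: c.
have zz : inner z z = 1 by have := orthonormal_unit c0 tt tt; rewrite eqxx.
have zh k : inner z (h k) = 0 by rewrite innerZl innerBl pE subrr mulr0.
have hz k : inner (h k) z = 0 by rewrite inner_conj zh rmorph0.
exists (option K), (fun o => if o is Some k then h k else z); split.
- by move=> [k|] [l|] //=; rewrite oh.
- move=> a; rewrite inE => /orP[/eqP ->|ag].
    have n0 : nr c != 0 by apply: contraNneq c0 => /nr_eq0 ->.
    have bz : inner b z = (nr c)%:C%C.
      have -> : b = c + proj h (index_enum K) b by rewrite subrK.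
      rewrite innerDl [X in _ + X]inner_suml big1 ?addr0 => [|k _]; last by rewrite innerZl hz mulr0.
      rewrite innerZr inner_nr (_ : _^* = ((nr c)^-1)%:C%C); last first.
        by apply/CrealP; rewrite complex_real.
      by rewrite -rmorphM /= expr2 mulrA mulVf // mul1r.
    rewrite (bigD1 None) //= (reindex_omap (@Some K) id) /=; last by case.
    rewrite bz scalerA -rmorphM /= divff // scale1r.
    under eq_bigl => k do rewrite eqxx.
    by rewrite subrK.
  rewrite (bigD1 None) //= (reindex_omap (@Some K) id) /=; last by case.
  under eq_bigl => k do rewrite eqxx.
  have -> : inner a z = 0.
    by rewrite (sp a ag) inner_suml big1 // => k _; rewrite innerZl hz mulr0.
  by rewrite scale0r add0r -sp.
- move=> x hx; have hk k : inner (h k) x = 0.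
    by apply: orth => a ag; apply: hx; rewrite inE ag orbT.
  case=> [k|]; first exact: hk.
  rewrite innerZl innerBl hx ?mem_head // [X in _ - X]inner_suml big1 ?subr0 ?mulr0 // => k _.
  by rewrite innerZl hk mulr0.
Qed.

(** The right singular vectors of [T] restricted to the span of [g]: the matrix of all <T h_k, T
    h_l> is Hermitian, and the unitary matrix that diagonalises it carries the h_k to vectors with
    pairwise orthogonal images. *)
Lemma singular_basis (T : op) (g : seq H) : exists n (h : 'I_n -> H),
  [/\ orthonormal_family h, forall k l, k != l -> inner (T (h k)) (T (h l)) = 0,
      forall a, a \in g -> a = \sum_k inner a (h k) *: h k
    & forall x, (forall a, a \in g -> inner a x = 0) -> forall k, inner (h k) x = 0].
Proof.
have [K [h' [oh' sp' orth']]] := gram_schmidt g.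
pose n := #|K|; pose h (i : 'I_n) := h' (enum_val i).
have oh : orthonormal_family h.
  by move=> i j; rewrite oh' (inj_eq enum_val_inj).
have sp a : a \in g -> a = \sum_i inner a (h i) *: h i.
  move=> /sp' {1}->; rewrite (reindex (@enum_val K xpredT)) //=.
  exact/onW_bij/enum_val_bij.
pose M : 'M[R[i]]_n := \matrix_(k, l) inner (T (h k)) (T (h l)).
have Mn : M \is normalmx.
  apply/normalmxP; suff -> : (M ^t*)%sesqui = M by [].
  by apply/matrixP => k l; rewrite !mxE -inner_conj.
have /orthomx_spectralP := Mn; set P := spectralmx M => eM.
have uP : P \is unitarymx by exact: spectral_unitarymx.
have PP := unitarymxP uP.
have PP' : (P ^t*)%sesqui *m P = 1%:M by exact: mulmx1C.
have diag : P *m M *m (P ^t*)%sesqui = diag_mx (spectral_diag M).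
  rewrite {1}eM !mulmxA mulmxV ?spectral_unit // mul1mx -mulmxA PP mulmx1 //.
pose f i := \sum_k P i k *: h k.
have fh i j : inner (f i) (h j) = P i j.
  rewrite inner_suml (bigD1 j) //= innerZl oh eqxx mulr1 big1 ?addr0 //.
  by move=> k /negPf kj; rewrite innerZl oh kj mulr0.
have innerf x j : inner x (f j) = \sum_k inner x (h k) * (P ^t*)%sesqui k j.
  by rewrite inner_sumr; apply: eq_bigr => k _; rewrite innerZr !mxE mulrC.
have spf a : \sum_k inner a (h k) *: h k = \sum_k inner a (f k) *: f k.
  under [RHS]eq_bigr => k _ do rewrite innerf scaler_suml.
  rewrite exchange_big /=; apply: eq_bigr => k _.
  under eq_bigr => i _ do rewrite /f scaler_sumr.
  have coef l : \sum_i (inner a (h k) * (P ^t*)%sesqui k i) *: (P i l *: h l) =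
      (inner a (h k) * (k == l)%:R) *: h l.
    under eq_bigr => i _ do rewrite scalerA -mulrA.
    rewrite -scaler_suml -mulr_sumr; have := congr1 (fun X : 'M_n => X k l) PP'.
    by rewrite !mxE => ->.
  rewrite exchange_big /=; under eq_bigr => l _ do rewrite coef.
  rewrite (bigD1 k) //= eqxx mulr1 big1 ?addr0 // => l lk.
  by rewrite eq_sym (negPf lk) mulr0 scale0r.
exists n, f; split.
- move=> i j; rewrite innerf; have := congr1 (fun X : 'M_n => X i j) PP.
  by rewrite !mxE => <-; apply: eq_bigr => k _; rewrite fh.
- move=> i j ij; have := congr1 (fun X : 'M_n => X i j) diag.
  rewrite [RHS]mxE (negPf ij) mulr0n => <-.
  rewrite /f !op_sum_arg inner_sumr mxE; apply: eq_bigr => l _.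
  rewrite opZ_arg innerZr mulrC inner_suml !mxE; congr (_ * _).
  by apply: eq_bigr => k _; rewrite opZ_arg innerZl !mxE.
- by move=> a /sp {1}->; exact: spf.
- move=> x hx i; rewrite inner_suml big1 // => k _.
  by rewrite innerZl orth' // mulr0.
Qed.

End SingularValues.

(** * Operators whose absolute value has a trace *)

Section TraceClass.
Variables (R : realType) (H : hilbertType R).
Local Notation op := (op H).

(** Polarization over the complex numbers: <P z, z> is real for every z, and comparing x + y with x
    + i y forces symmetry. *)
Lemma sesquilinear_symmetric (P : H -> H) : linear P -> (forall x, 0 <= inner (P x) x) ->
  forall x y, inner (P x) y = inner x (P y).
Proof.
move=> linP posP x y.
have PD a b : P (a + b) = P a + P b by have := linP 1 a b; rewrite !scale1r.
have PZ k a : P (k *: a) = k *: P a.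
  have P0 : P 0 = 0 by apply: (addIr (P 0)); rewrite -PD !add0r.
  by have := linP k a 0; rewrite P0 !addr0.
have sym z : inner (P z) z = inner z (P z).
  by rewrite [RHS]inner_conj; apply/esym/CrealP/ger0_real.
have D a b : inner (P a) b - inner a (P b) = - (inner (P b) a - inner b (P a)).
  have /eqP := sym (a + b); rewrite -subr_eq0 !PD !(innerDl, innerDr) !sym => /eqP h.
  by apply/eqP; rewrite -addr_eq0; apply/eqP; apply: etrans h; ring.
have h1 := D x y; have h2 := D x ('i *: y).
move: h1 h2; rewrite !PZ !innerZl !innerZr.
set p := inner (P x) y; set q := inner (P y) x; set r := inner x (P y); set s := inner y (P x).
have -> : ('i : R[i])^* = - 'i by exact: conjCi.
move=> h1 h2.
have h3 : 'i * (p - r) = 'i * (q - s).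
  by apply: oppr_inj; transitivity (- 'i * p - - 'i * r); [ring|rewrite h2; ring].
have {}h3 := mulfI (neq0Ci _) h3; apply/eqP; rewrite -subr_eq0; move: h1; rewrite -h3 => /eqP.
by rewrite -addr_eq0 -mulr2n mulrn_eq0.
Qed.

Lemma ler_sum_subset (I : eqType) (s t : seq I) (F : I -> R) : uniq s -> uniq t ->
  {subset s <= t} -> (forall i, 0 <= F i) -> \sum_(i <- s) F i <= \sum_(i <- t) F i.
Proof.
move=> us ut st F0; rewrite [leRHS](bigID (mem s)) /=.
have -> : \sum_(i <- s) F i = \sum_(i <- t | i \in s) F i.
  rewrite -[RHS]big_filter; apply/perm_big/uniq_perm; rewrite ?filter_uniq // => i.
  by rewrite mem_filter; case: (boolP (i \in s)) => // /st ->.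
by rewrite lerDl sumr_ge0.
Qed.

Section PositiveTrace.
Variables (P : H -> H) (tau : R[i]).
Hypothesis posP : forall x, 0 <= inner (P x) x.
Hypothesis trP : has_trace P tau.
Let p x := complex.Re (inner (P x) x).

Let p_ge0 x : 0 <= p x.
Proof. by rewrite -ler0c /p RRe_real ?ger0_real. Qed.

(** After completion to a basis, the additional diagonal terms are nonnegative, so the finite sum
    stays below the limit. *)
Lemma positive_trace_lower (K : choiceType) (e : K -> H) (s : seq K) :
  orthonormal_family e -> uniq s -> \sum_(k <- s) p (e k) <= complex.Re tau.
Proof.
move=> oe us; have [I [b [f [ob injf bf]]]] := orthonormal_extend oe.
apply/ler_addgt0Pr => d d0; have /has_traceP /(_ I b ob d d0) [J0 hJ] := trP.
pose J := (J0 `|` seq_fset tt (map f s))%fset.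
have {hJ} := hJ J (fsubsetUl _ _); set u := \sum_(i <- J) _ => hJ.
have : \sum_(k <- s) p (e k) <= complex.Re u.
  rewrite raddf_sum /=; under eq_bigr => k _ do rewrite -bf.
  rewrite -(big_map f xpredT (fun i => p (b i))).
  apply: ler_sum_subset => [||i hi|i]; rewrite ?map_inj_uniq ?fset_uniq ?p_ge0 //.
  by rewrite !inE seq_fsetE hi orbT.
have : complex.Re u - complex.Re tau <= nr (tau - u).
  by rewrite nrBC -raddfB Re_le_nr.
lra.
Qed.

(** [J] is chosen so that its diagonal terms exhaust the trace up to d. A family orthogonal to these
    vectors is orthonormal together with them, so [positive_trace_lower] leaves at most d for it. *)
Lemma positive_trace_tail (d : R) : 0 < d ->
  exists (I : choiceType) (b : I -> H) (J : {fset I}), orthonormal_family b /\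
    forall n (h : 'I_n -> H), orthonormal_family h ->
      (forall k i, i \in J -> inner (h k) (b i) = 0) -> \sum_k p (h k) <= d.
Proof.
move=> d0; have [I [b ob]] := onb_exists H.
have /has_traceP /(_ I b ob d d0) [J hJ] := trP; have {}hJ := hJ J (fsubset_refl _).
exists I, b, J; split; first exact: (proj1 ob).
move=> n h oh hb; pose e (k : 'I_n + J) := match k with inl k => h k | inr i => b (val i) end.
have oe : orthonormal_family e.
  move=> [k|i] [l|l] /=.
  - by rewrite oh.
  - by rewrite hb // (valP l).
  - by rewrite inner_conj hb ?(valP i) // rmorph0.
  - by rewrite (proj1 ob).
have := positive_trace_lower oe (index_enum_uniq _).
rewrite big_sumType /= -(big_seq_fsetE _ J xpredT (fun i => p (b i))) /=.
move: hJ; set u := \sum_(i <- J) inner _ _ => hJ.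
have -> : \sum_(i <- J) p (b i) = complex.Re u by rewrite raddf_sum.
have : complex.Re tau - complex.Re u <= nr (tau - u) by rewrite -raddfB Re_le_nr.
lra.
Qed.

End PositiveTrace.

(** Cauchy-Schwarz from a b <= (q/2) a^2 + b^2/(2q) with q = m + d; the slack d keeps q positive
    when m = 0. *)
Lemma sum_mul_le (I : Type) (r : seq I) (a b : I -> R) (m : R) : 0 <= m ->
  (forall i, 0 <= a i) -> (forall i, 0 <= b i) ->
  \sum_(i <- r) a i ^+ 2 <= 1 -> \sum_(i <- r) b i ^+ 2 <= m ^+ 2 ->
  \sum_(i <- r) a i * b i <= m.
Proof.
move=> m0 a0 b0 ha hb; apply/ler_addgt0Pr => d d0; set q := m + d.
have q0 : 0 < q by rewrite /q; lra.
have term i : a i * b i <= (q / 2) * a i ^+ 2 + (2 * q)^-1 * b i ^+ 2.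
  have -> : (q / 2) * a i ^+ 2 + (2 * q)^-1 * b i ^+ 2 =
      a i * b i + (q * a i - b i) ^+ 2 / (2 * q) by field; rewrite gt_eqF.
  by rewrite lerDl divr_ge0 ?sqr_ge0 ?mulr_ge0 // ltW.
apply: le_trans (ler_sum _ (fun i _ => term i)) _; rewrite big_split /= -!mulr_sumr.
have h1 : q / 2 * (\sum_(i <- r) a i ^+ 2) <= q / 2.
  by rewrite ler_piMr // divr_ge0 // ltW.
have h2 : (2 * q)^-1 * (\sum_(i <- r) b i ^+ 2) <= q / 2.
  rewrite ler_pdivrMl ?mulr_gt0 //; apply: le_trans hb _.
  have -> : 2 * q * (q / 2) = q ^+ 2 by field.
  by rewrite ler_sqr ?nnegrE // ?(ltW q0) // /q; lra.
lra.
Qed.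

(* If T has absolute value P, compressing to the orthogonal complement of a
   large part of an orthonormal basis makes P small in trace; the singular
   value decomposition there gives orthonormal h_k and f_k = P h_k / |T h_k|
   with |T h_k| = <P h_k, f_k>, which is bounded by Cauchy-Schwarz for P. *)
Lemma trace_class_ideal (T : op) : trace_class T -> trace_ideal T.
Proof.
move=> [_ [P [[[linP _] posP absP] [tau trP]]]] e e0.
have symP := sesquilinear_symmetric linP posP.
pose p x := complex.Re (inner (P x) x).
have PZ k a : P (k *: a) = k *: P a.
  have P0 : P 0 = 0 by have := linP (-1) 0 0; rewrite !scaleN1r oppr0 addr0 addNr.
  by have := linP k a 0; rewrite P0 !addr0.
have PD a b : P (a + b) = P a + P b by have := linP 1 a b; rewrite !scale1r.
have PT x y : inner (P x) (P y) = inner (T x) (T y) by rewrite -symP absP.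
have nrP x : nr (P x) = nr (T x).
  apply/eqP; rewrite -(@eqrXn2 _ 2) ?nr_ge0 //; apply/eqP/(@complexI R).
  by rewrite -!inner_nr PT.
have t0 : 0 <= complex.Re tau.
  have := positive_trace_lower posP trP (_ : orthonormal_family (of_void H)) (_ : uniq [::]).
  by rewrite big_nil; apply => // -[].
set t := complex.Re tau in t0.
(* Weighted Cauchy-Schwarz for the form of [P], obtained from <P(s x - y), s x - y> >= 0; the weight
   will offset a small tail against the full trace. *)
have cs (s : R) x y : 0 < s -> complex.Re (inner (P x) y) <= (s * p x + s^-1 * p y) / 2.
  move=> s0; have := posP (s%:C%C *: x - y).
  have conjs : (s%:C%C)^* = s%:C%C :> R[i] by apply/CrealP; rewrite complex_real.
  have -> : inner (P (s%:C%C *: x - y)) (s%:C%C *: x - y) = s%:C%C * (s%:C%C * inner (P x) x)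
      - s%:C%C * inner (P x) y - s%:C%C * inner (P y) x + inner (P y) y.
    rewrite -scaleN1r PD !PZ !(innerDl, innerDr) !(innerZl, innerZr) conjs.
    by rewrite (_ : (-1)^* = -1 :> R[i]); [ring|rewrite rmorphN rmorph1].
  rewrite lecE => /andP[_]; rewrite raddfD !raddfB /= !ReM_real -/(p x) -/(p y).
  have -> : complex.Re (inner (P y) x) = complex.Re (inner (P x) y).
    by rewrite symP inner_conj; case: (inner (P x) y).
  set c := complex.Re _ => h; rewrite ler_pdivlMr //.
  have -> : s * p x + s^-1 * p y = c * 2 + s^-1 * (s * (s * p x) - s * c - s * c + p y).
    by field; rewrite gt_eqF.
  by rewrite lerDl mulr_ge0 // invr_ge0 ltW.
(* With the tail of [P] at most e/s and the full trace equal to t, the bound (s (e/s) + t/s)/2 is at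
   most e, since t/s <= e. *)
pose s := t / e + 1.
have s0 : 0 < s by have := divr_ge0 t0 (ltW e0); rewrite /s; lra.
have [I [b [J [ob tail]]]] := positive_trace_tail posP trP (divr_gt0 e0 s0).
pose E : op := \sum_(i <- J) rank1 (b i) (b i).
have EE x : E x = proj b J x by rewrite /E op_sumE.
exists (T * E); split.
  by apply: (idealMl (finite_rank_ideal H)); exists [seq (b i, b i) | i <- J]; rewrite big_map.
move=> r r1 r2; pose g := [seq a.1 - proj b J a.1 | a <- r].
have [n [h [oh dh sp orth]]] := singular_basis T g.
have hb k i : i \in J -> inner (h k) (b i) = 0.
  move=> iJ; apply: orth => _ /mapP[a _ ->].
  by rewrite innerBl inner_proj // subrr.
have bh k i : i \in J -> inner (b i) (h k) = 0.
  by move=> iJ; rewrite inner_conj hb // rmorph0.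
have ph_small := tail n h oh hb; rewrite -/p in ph_small.
pose mu k := nr (T (h k)).
have mu_ge0 k : 0 <= mu k by exact: nr_ge0.
have term a : a \in r -> inner ((T - T * E) a.1) a.2 =
    \sum_k inner a.1 (h k) * inner (T (h k)) a.2.
  move=> ar; have ag : a.1 - proj b J a.1 \in g by apply/mapP; exists a.
  rewrite op_subE op_mulE EE -opB_arg (sp _ ag) op_sum_arg inner_suml.
  apply: eq_bigr => k _; rewrite opZ_arg innerZl; congr (_ * _).
  rewrite innerBl [X in _ - X]inner_suml big_seq big1 ?subr0 // => i iJ.
  by rewrite innerZl bh // mulr0.
have -> : \sum_(a <- r) inner ((T - T * E) a.1) a.2 =
    \sum_k \sum_(a <- r) inner a.1 (h k) * inner (T (h k)) a.2.
  by rewrite exchange_big /= !big_seq; apply: eq_bigr => a /term.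
(* For fixed k, [r1] at the unit vector h_k bounds one factor by 1 and [r2] at T h_k bounds the
   other by [mu k]; from here on the test system has disappeared. *)
apply: le_trans (nr_sum _ _ _) _; apply: (@le_trans _ _ (\sum_k mu k)).
  apply: ler_sum => k _; apply: le_trans (nr_sum _ _ _) _.
  under eq_bigr => a _ do rewrite nrM.
  apply: sum_mul_le => [|i|i||]; rewrite ?nr_ge0 //.
    have := r1 (h k); rewrite big_map (orthonormal_nr k oh) expr1n; apply: le_trans.
    by rewrite le_eqVlt; apply/orP; left; apply/eqP/eq_bigr => a _; rewrite inner_conj nr_conj.
  by have := r2 (T (h k)); rewrite big_map.
pose f k := ((mu k)^-1)%:C%C *: P (h k).
(* Indices with T h_k = 0 add nothing to the sum of the [mu k], but for them f_k would be 0 instead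
   of a unit vector. *)
pose K : finType := {k : 'I_n | mu k != 0}.
have muV k : (((mu k)^-1)%:C%C)^* = ((mu k)^-1)%:C%C :> R[i].
  by apply/CrealP; rewrite complex_real.
have muP (k : 'I_n) : mu k != 0 -> inner (P (h k)) (f k) = (mu k)%:C%C.
  move=> m0; rewrite innerZr muV inner_nr nrP -/(mu k) -rmorphM /=.
  by rewrite expr2 mulrA mulVf // mul1r.
have of_ : orthonormal_family (fun k : K => f (val k)).
  move=> k l; rewrite innerZl innerZr muV PT.
  have [->|kl] := eqVneq k l; last by rewrite dh ?(inj_eq val_inj) // !mulr0.
  have m0 : mu (val l) != 0 := valP l.
  rewrite inner_nr -/(mu _) -!rmorphM /=.
  by have -> : (mu (val l))^-1 * ((mu (val l))^-1 * mu (val l) ^+ 2) = 1 by field.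
have pf : \sum_(k | mu k != 0) p (f k) <= t.
  have := positive_trace_lower posP trP of_ (index_enum_uniq _).
  by rewrite -/p -(big_sub [pred k | mu k != 0] (fun k => p (f k))).
have p0 x : 0 <= p x by rewrite -ler0c /p RRe_real ?ger0_real.
have mu_le : \sum_k mu k <= (s * (\sum_k p (h k)) + s^-1 * t) / 2.
  apply: (@le_trans _ _ (\sum_(k | mu k != 0) (s * p (h k) + s^-1 * p (f k)) / 2)).
    rewrite (bigID (fun k => mu k == 0)) /= big1 ?add0r => [|k /eqP //].
    apply: ler_sum => k mk; apply: le_trans (cs s (h k) (f k) s0).
    by rewrite muP.
  rewrite -mulr_suml ler_wpM2r ?invr_ge0 // big_split /= -!mulr_sumr.
  rewrite lerD // ?ler_wpM2l ?invr_ge0 // ?(ltW s0) //.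
  by rewrite [leRHS](bigID (fun k => mu k != 0)) /= lerDl sumr_ge0.
apply: le_trans mu_le _.
have h1 : s * (\sum_k p (h k)) <= e.
  by move: ph_small; rewrite ler_pdivlMr // mulrC.
have h2 : s^-1 * t <= e.
  by rewrite ler_pdivrMl // /s mulrDl divfK ?gt_eqF // mul1r lerDl ltW.
lra.
Qed.

End TraceClass.

(** * Operators with a scalar symbol *)

(** Rank factorization A = c r with r c = 1 turns the trace into that of an identity matrix of size
    the rank. *)
Lemma mxtrace_idem (K : fieldType) n (A : 'M[K]_n) : A *m A = A -> \tr A = (\rank A)%:R.
Proof.
move=> AA; move: (mulmx_base A) (row_base_free A) (col_base_full A).
move: (col_base A) (row_base A) => c r cr fr fc; have rc : r *m c = 1%:M.
  apply: (row_free_inj fr); apply: (row_full_inj fc).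
  by rewrite /= mul1mx !mulmxA cr -mulmxA cr AA.
by rewrite -{1}cr mxtrace_mulC rc mxtrace1.
Qed.

Section Symbol.
Variables (R : realType) (H : hilbertType R).

(** The scalar is carried as a separate coordinate since the operator need not determine it: on a
    finite-dimensional [H] every operator is compact. *)
Definition symb_op : pzRingType := (op H * R[i])%type.

Definition symb_norm (X : symb_op) : R := opnorm X.1 + nr X.2.

Definition symb_scalar (k : R[i]) : symb_op := (op_scale H k, k).

Fact symb_scalar_zmod : {morph symb_scalar : x y / x - y}.
Proof.
move=> x y; congr pair; apply: op_ext => z; rewrite op_subE /=; exact: scalerBl.
Qed.

Fact symb_scalar_monoid : monoid_morphism symb_scalar.
Proof.
split; first by congr pair; apply: op_ext => z /=; rewrite scale1r.
by move=> x y; congr pair; apply: op_ext => z /=; rewrite scalerA.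
Qed.

HB.instance Definition _ := GRing.isZmodMorphism.Build _ _ symb_scalar symb_scalar_zmod.
HB.instance Definition _ := GRing.isMonoidMorphism.Build _ _ symb_scalar symb_scalar_monoid.

Definition symb : {rmorphism symb_op -> R[i]} := snd.

Lemma symb_complete : complete_norm symb_norm.
Proof.
have opP := opnorm_complete H; split.
- by rewrite /symb_norm (nu0 opP) nr0 addr0.
- move=> [T k] /= h; have := opnorm_ge0 T; have := nr_ge0 k; rewrite /symb_norm /= in h => k0 T0.
  by congr pair; [apply: (nu0_eq0 opP)|apply: nr_eq0]; lra.
- by move=> X; rewrite /symb_norm (nuN opP) nrN.
- move=> X Y; rewrite /symb_norm addrACA.
  by apply: lerD; [exact: (nuD opP)|exact: nrD].
- move=> X Y; rewrite /symb_norm nrM mulrDl !mulrDr.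
  have := nuM opP X.1 Y.1; have := opnorm_ge0 X.1; have := opnorm_ge0 Y.1.
  have := nr_ge0 X.2; have := nr_ge0 Y.2; rewrite /=.
  set a := nr X.2; set b := nr Y.2; set c := opnorm X.1; set d := opnorm Y.1 => b0 a0 d0 c0 h.
  by have := mulr_ge0 a0 d0; have := mulr_ge0 b0 c0; lra.
move=> u cau.
have [e /cau [n0 h]|T hT] := nu_complete opP (u := fun n => (u n).1).
  exists n0 => m n hm hn; apply: le_lt_trans (h _ _ hm hn).
  by rewrite /symb_norm /= lerDl nr_ge0.
have [e /cau [n0 h]|k hk] := @seq_complete R (complex_complete R) (fun n => (u n).2).
  exists n0 => m n hm hn; apply: le_lt_trans (h _ _ hm hn).
  by rewrite /symb_norm /= lerDr opnorm_ge0.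
exists (T, k) => e e0.
have [n0 h0] := hT _ (divr_gt0 e0 (ltr0Sn R 1)).
have [n1 h1] := hk _ (divr_gt0 e0 (ltr0Sn R 1)).
exists (maxn n0 n1) => n; rewrite geq_max => /andP[/h0 {}h0 /h1 {}h1].
have {}h1 : nr ((u n).2 - k) < e / 2 := h1.
by rewrite /symb_norm /=; lra.
Qed.

Definition symb_finite (X : symb_op) : Prop := finite_rank X.1 /\ X.2 = 0.
Definition symb_trace (X : symb_op) : Prop := trace_ideal X.1 /\ X.2 = 0.
Definition symb_compact : symb_op -> Prop := closure_ideal symb_norm symb_finite.
Definition symb_Tr (X : symb_op) : R[i] := Tr X.1.

Lemma symb_ideal (I : op H -> Prop) : ideal I ->
  ideal (fun X : symb_op => I X.1 /\ X.2 = 0).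
Proof.
move=> idI; split.
- by split=> //; exact: (ideal0 idI).
- by move=> X Y [IX X0] [IY Y0]; split; [exact: (idealD idI)|rewrite /= X0 Y0 addr0].
- by move=> X Y [IY Y0]; split; [exact: (idealMl idI)|rewrite /= Y0 mulr0].
- by move=> X Y [IX X0]; split; [exact: (idealMr idI)|rewrite /= X0 mul0r].
Qed.

Lemma symb_compact_ker (X : symb_op) : symb_compact X -> symb X = 0.
Proof.
move=> KX; apply: nr_small_eq => e /KX [f [[_ f0]]]; rewrite /symb_norm /= f0 => h.
by have := opnorm_ge0 (X.1 - f.1); rewrite subr0 in h *; lra.
Qed.

Lemma symb_trace_compact (X : symb_op) : symb_trace X -> symb_compact X.
Proof.
move=> [LX X0] e e0; have [f [Ff hf]] := trace_ideal_compact LX e0.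
by exists (f, 0); split=> //; rewrite /symb_norm /= X0 subr0 nr0 addr0.
Qed.

Local Notation scal := (scal symb symb_scalar).
Local Notation tau := (tau symb symb_scalar symb_Tr).

(* The entries of e minus its symbol have their ranges in the span of finitely
   many vectors h_k; compressing the entries of e to that span gives an
   idempotent complex matrix X. *)
Lemma symb_Tr_int n (e : 'M[symb_op]_n) : e *m e = e ->
  scalar_mod symb symb_scalar symb_finite e -> exists k : int, tau e = k%:~R.
Proof.
move=> ee Fe; pose D i j : op H := ((e - scal e) i j).1.
have eD i j : (e i j).1 = op_scale H (e i j).2 + D i j.
  by rewrite /D !mxE /= addrC subrK.
have DF i j : exists r : seq (H * H), D i j = \sum_(p <- r) rank1 p.1 p.2.
  by have [] := Fe i j.
pose r i j := projT1 (cid (DF i j)).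
have rP i j : D i j = \sum_(p <- r i j) rank1 p.1 p.2 by rewrite /r; case: cid.
pose g := flatten [seq unzip1 (r ij.1 ij.2) | ij <- index_enum ('I_n * 'I_n)%type].
have gP i j p : p \in r i j -> p.1 \in g.
  move=> pr; apply/flattenP; exists (unzip1 (r i j)); last by apply/mapP; exists p.
  by apply/mapP; exists (i, j); rewrite ?mem_index_enum.
(* With [T] = 0 this only provides an orthonormal basis of the span of [g], indexed by ordinals. *)
have [d [h [oh _ sp _]]] := singular_basis (0 : op H) g.
have spD i j x : D i j x = \sum_k inner (D i j x) (h k) *: h k.
  rewrite rP op_sumE; under [RHS]eq_bigr => k _ do rewrite inner_suml scaler_suml.
  rewrite exchange_big /= !big_seq; apply: eq_bigr => p pr.
  rewrite {1}(sp _ (gP _ _ _ pr)) scaler_sumr; apply: eq_bigr => k _.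
  by rewrite innerZl scalerA.
have sph k : h k = \sum_l inner (h k) (h l) *: h l.
  rewrite (bigD1 k) //= oh eqxx scale1r big1 ?addr0 // => l /negPf lk.
  by rewrite oh eq_sym lk scale0r.
(* Scalars and the operators [D i j] preserve the span of the h_k. Compression to it is thus
   multiplicative on the entries, and [B] inherits idempotence from [e]. *)
have spe i j k : (e i j).1 (h k) = \sum_l inner ((e i j).1 (h k)) (h l) *: h l.
  rewrite eD op_addE [in LHS]spD /= {1}sph scaler_sumr -big_split /=.
  by apply: eq_bigr => l _; rewrite scalerA -scalerDl innerDl innerZl.
pose X i j : 'M[R[i]]_d := \matrix_(k, l) inner ((e i j).1 (h l)) (h k).
pose B := \mxblock_(i, j) X i j.
have BB : B *m B = B.
  rewrite mul_mxblock; apply: eq_mxblock => i j; apply/matrixP => k l.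
  rewrite summxE [RHS]mxE -[in RHS]ee mxE.
  rewrite (_ : (\sum_m e i m * e m j).1 = \sum_m (e i m).1 * (e m j).1); last first.
    exact: (big_morph (@fst (op H) R[i])).
  rewrite op_sumE inner_suml; apply: eq_bigr => m _; rewrite op_mulE spe op_sum_arg.
  rewrite inner_suml mxE; apply: eq_bigr => p _.
  by rewrite !mxE opZ_arg innerZl mulrC.
have trX i : \tr (X i i) = (e i i).2 *+ d + Tr (D i i).
  have -> : Tr (D i i) = \sum_k inner (D i i (h k)) (h k).
    have trD : has_trace (D i i) (\sum_(p <- r i i) inner p.1 p.2).
      by rewrite rP; apply: has_trace_sum => p; exact: has_trace_rank1.
    rewrite (Tr_eq trD).
    under [RHS]eq_bigr => k _ do rewrite rP op_sumE inner_suml.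
    rewrite [RHS]exchange_big /= !big_seq; apply: eq_bigr => p pr.
    rewrite {1}(sp _ (gP _ _ _ pr)) inner_suml; apply: eq_bigr => k _.
    by rewrite /= !innerZl mulrC.
  rewrite -[d in _ *+ d]card_ord -sumr_const -big_split; apply: eq_bigr => k _.
  by rewrite !mxE eD op_addE innerDl /= innerZl oh eqxx mulr1.
pose e0 := map_mx symb e.
have e00 : e0 *m e0 = e0 by rewrite -map_mxM ee.
(* The trace of [B] counts the scalar part once per vector of the span, that is d times; removing
   these copies leaves the traces of the [D i i]. Both traces of idempotent complex matrices are
   ranks. *)
have -> : tau e = (\rank B)%:R - (\rank e0)%:R *+ d.
  rewrite -(mxtrace_idem BB) -(mxtrace_idem e00) mxtrace_mxblock.
  under eq_bigr => i _ do rewrite trX.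
  rewrite big_split /= sumrMnl.
  have -> : \tr e0 = \sum_i (e i i).2 by apply: eq_bigr => i _; rewrite mxE.
  rewrite addrAC subrr add0r /tau /symb_Tr.
  rewrite (_ : (\tr _).1 = \sum_i D i i); last exact: (big_morph (@fst (op H) R[i])).
  apply/Tr_eq/has_trace_sum => i; apply: TrP; apply: finite_rank_trace.
  by have [] := Fe i i.
exists ((\rank B)%:Z - (\rank e0)%:Z *+ d).
by rewrite rmorphB rmorphMn /= -!pmulrn.
Qed.

End Symbol.

Section ComplexHilbert.
Variable R : realType.

Let cinner (x y : complex_complete R) : R[i] := (x : R[i]) * (y : R[i])^*.

Fact cinner_linear k (x y z : complex_complete R) :
  cinner (k *: x + y) z = k * cinner x z + cinner y z.
Proof. by rewrite /cinner mulrDl; congr (_ + _); rewrite mulrA. Qed.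

Fact cinner_conj (x y : complex_complete R) : cinner y x = (cinner x y)^*.
Proof. by rewrite /cinner rmorphM /= conjCK mulrC. Qed.

Fact cinner_norm (x : complex_complete R) : cinner x x = `|x| ^+ 2.
Proof. by rewrite /cinner -normCK. Qed.

Definition complex_hilbert : hilbertType R :=
  Hilbert cinner_linear cinner_conj cinner_norm.
End ComplexHilbert.

(** * Extending the representation and the character to the envelope *)

Section Representation.
Variables (R : realType) (B A : starAlgType R) (iota : {lrmorphism B -> A}).
Hypothesis iota_star : star_preserving iota.

Lemma rep_restrict (H : hilbertType R) (pi : A -> H -> H) :
  is_rep pi -> is_rep (fun b => pi (iota b)).
Proof.
move=> [bd lin one mul st]; split=> [b|k a b x|x|a b x|a x y]; first exact: bd.
- by rewrite linearP lin.
- by rewrite rmorph1 one.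
- by rewrite rmorphM mul.
- by rewrite st iota_star.
Qed.

(** Seen as a representation on a one-dimensional Hilbert space, the character is among those
    dominated by the envelope norm; so [eps] extends together with pi. *)
Lemma character_rep (eps : {lrmorphism A -> R[i] | *%R}) :
  (forall a, eps (star a) = (eps a)^*) ->
  is_rep (fun a (x : complex_hilbert R) => eps a *: x).
Proof.
move=> eps_star; split.
- move=> a; split=> [k x y|]; first by rewrite scalerDr !scalerA mulrC.
  by exists (nr (eps a)) => x; rewrite nrE normrZ.
- by move=> k a b x; rewrite linearP scalerDl scalerA.
- by move=> x; rewrite rmorph1 scale1r.
- by move=> a b x; rewrite rmorphM scalerA.
- by move=> a x y; rewrite innerZl innerZr eps_star conjCK.
Qed.

Lemma rep_adjointable (H : hilbertType R) (pi : A -> H -> H) :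
  is_rep pi -> forall a, adjointable (pi a).
Proof.
move=> [bd _ _ _ st] a; split; first by exists (pi (star a)).
have [_ [M MP]] := bd a; exists (Num.max M 0); split; first by rewrite le_max lexx orbT.
move=> x; apply: (@le_trans _ _ (M * nr x)).
  by have := MP x; rewrite -!nrE -rmorphM lecR.
by rewrite ler_wpM2r ?nr_ge0 // le_max lexx.
Qed.

Definition rep_op (H : hilbertType R) (pi : A -> H -> H) (pi_rep : is_rep pi) (a : A) : op H :=
  Op (rep_adjointable pi_rep a).

Section SymbolRep.
Variables (H : hilbertType R) (pi : A -> H -> H) (pi_rep : is_rep pi).
Variable eps : {lrmorphism A -> R[i] | *%R}.

Definition rep_symb (a : A) : symb_op H := (rep_op pi_rep a, eps a).

Fact rep_symb_zmod : {morph rep_symb : x y / x - y}.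
Proof.
move=> x y; rewrite /rep_symb rmorphB; congr pair; apply: op_ext => z.
rewrite op_subE /= -[X in pi X](_ : (-1) *: y + x = _); last by rewrite scaleN1r addrC.
by rewrite (rep_linear pi_rep) scaleN1r addrC.
Qed.

Fact rep_symb_monoid : monoid_morphism rep_symb.
Proof.
split; rewrite /rep_symb.
  by rewrite rmorph1; congr pair; apply: op_ext => z; exact: (rep1 pi_rep).
by move=> x y; rewrite rmorphM; congr pair; apply: op_ext => z; exact: (repM pi_rep).
Qed.

HB.instance Definition _ := GRing.isZmodMorphism.Build _ _ rep_symb rep_symb_zmod.
HB.instance Definition _ := GRing.isMonoidMorphism.Build _ _ rep_symb rep_symb_monoid.

End SymbolRep.

Section Envelope.
Variables (Bbar : starAlgType R) (nrm : Bbar -> R) (j : {lrmorphism B -> Bbar}).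
Hypothesis envelope : is_cstar_envelope nrm j.
Variable eps : {lrmorphism A -> R[i] | *%R}.
Hypothesis eps_star : forall a, eps (star a) = (eps a)^*.
Variables (H : hilbertType R) (pi : A -> H -> H) (pi_rep : is_rep pi).
Hypothesis pi_eps : forall b : B,
  trace_class (fun x : H => pi (iota b) x - eps (iota b) *: x).

Local Notation psi := (rep_symb pi_rep eps).

Lemma rep_symb_trace (b : B) :
  symb_trace (psi (iota b) - symb_scalar H (symb H (psi (iota b)))).
Proof.
split; last by rewrite /= subrr.
apply: trace_class_ideal; have := pi_eps b; congr trace_class.
by apply/funext => x; rewrite op_subE.
Qed.

Let cn := envelope_norm envelope.

Lemma cnormN x : nrm (- x) = nrm x.
Proof.
apply: (@complexI R); have := cnormZ cn (-1) x.
by rewrite scaleN1r normrN normr1 mul1r.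
Qed.

Lemma cnorm_zero : nrm 0 = 0.
Proof. by apply: (@complexI R); have := cnormZ cn 0 0; rewrite scale0r normr0 mul0r. Qed.

Lemma cnorm_ge0 x : 0 <= nrm x.
Proof. have := cnormD cn x (- x); rewrite subrr cnorm_zero cnormN; lra. Qed.

Lemma rep_symb_bounded b : symb_norm (psi (iota b)) <= 2 * nrm (j b).
Proof.
rewrite mulr_natl mulr2n lerD //=.
  apply: opnorm_le => [|x]; first exact: cnorm_ge0.
  have := envelope_ub envelope (rep_restrict pi_rep) b x.
  by rewrite -!nrE -rmorphM lecR.
have := envelope_ub envelope (rep_restrict (character_rep eps_star)) b 1.
by rewrite normrZ normr1 !mulr1 -nrE lecR.
Qed.

Lemma symb_norm_scalar k : symb_norm (symb_scalar H k) <= 2 * nr k.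
Proof.
rewrite mulr_natl mulr2n lerD //= opnorm_le ?nr_ge0 // => x.
by rewrite /= nrZ.
Qed.

Lemma envelope_extension : exists Psi : {rmorphism Bbar -> symb_op H},
  (forall b, Psi (j b) = psi (iota b)) /\
  (forall x, symb_compact (Psi x - symb_scalar H (symb H (Psi x)))).
Proof.
have sc := symb_complete H.
(* The norm of [Bbar] is doubled so that [rep_symb_bounded] becomes a bound with constant 1;
   doubling preserves submultiplicativity. *)
have [||||x e e0|b|Psi [Pj Pd]] := @dense_extension R B Bbar (symb_op H) (fun x => 2 * nrm x)
    (@symb_norm R H) j (rep_symb pi_rep eps \o iota : {rmorphism B -> symb_op H}) sc.
- by rewrite cnorm_zero mulr0.
- by move=> x y; have := cnormD cn x y; lra.
- by move=> x; rewrite cnormN.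
- move=> x y; have := cnormM cn x y; have := mulr_ge0 (cnorm_ge0 x) (cnorm_ge0 y); lra.
- have [b hb] := envelope_dense envelope x (divr_gt0 e0 (ltr0Sn R 1)).
  by exists b; lra.
- exact: rep_symb_bounded.
exists Psi; split=> // x e e0.
(* The quarters add up: e/4 for [z], twice e/4 for its scalar part, e/4 for the approximation of the
   trace class defect of b. *)
have [b hb] := Pd x _ (divr_gt0 e0 (ltr0Sn R 3)).
have [f [Ff hf]] := symb_trace_compact (rep_symb_trace b) (divr_gt0 e0 (ltr0Sn R 3)).
exists f; split=> //; set z := Psi x - _ in hb.
rewrite -/(psi (iota b)) /= in hb.
have -> : Psi x - symb_scalar H (symb H (Psi x)) - f =
    z - symb_scalar H (symb H z) + (psi (iota b) - symb_scalar H (symb H (psi (iota b))) - f).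
  have acd (V : zmodType) (p q r s t : V) : p - r - t = p - q - (r - s) + (q - s - t).
    by rewrite opprD [_ + (- r - _)]addrACA -opprD addrA subrK.
  rewrite /z [symb H (_ - _)]rmorphB [symb_scalar H (_ - _)]rmorphB; exact: acd.
apply: le_lt_trans (nuD sc _ _) _; apply: le_lt_trans (lerD (nuB sc _ _) (lexx _)) _.
have h1 := symb_norm_scalar (symb H z).
have h2 : nr (symb H z) <= symb_norm z by rewrite /symb_norm lerDr opnorm_ge0.
lra.
Qed.

End Envelope.
End Representation.

(** * Bimodules with a dual basis *)

Section DualBasis.
Variables (S T : nzRingType) (E : bimodule S T).

(** The dual basis form of being finitely generated and projective. Index sets are arbitrary finite
    types, so that direct sums and tensor products use I + J and I * J without renumbering. *)
Definition dual_basis (I : finType) (g : I -> E) (phi : I -> E -> T) : Prop :=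
  [/\ forall i x y, phi i (x + y) = phi i x + phi i y,
      forall i (t : T) x, phi i ((t : T^c) *: x) = phi i x * t
    & forall x, \sum_i (phi i x : T^c) *: g i = x].

Section Theory.
Variables (I : finType) (g : I -> E) (phi : I -> E -> T).
Hypothesis gphi : dual_basis g phi.

Lemma dual_basisD i x y : phi i (x + y) = phi i x + phi i y.
Proof. by case: gphi. Qed.

Lemma dual_basisZ i (t : T) x : phi i ((t : T^c) *: x) = phi i x * t.
Proof. by case: gphi. Qed.

Lemma dual_basisK x : \sum_i (phi i x : T^c) *: g i = x.
Proof. by case: gphi. Qed.

Lemma dual_basis_sum i J (r : seq J) (P : pred J) (F : J -> E) :
  phi i (\sum_(j <- r | P j) F j) = \sum_(j <- r | P j) phi i (F j).
Proof.
apply: (big_morph (phi i)); first exact: dual_basisD.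
by apply: (addIr (phi i 0)); rewrite -dual_basisD !add0r.
Qed.

Lemma dual_basis_expand i x : phi i x = \sum_j phi i (g j) * phi j x.
Proof.
rewrite -{1}(dual_basisK x) dual_basis_sum; apply: eq_bigr => j _.
exact: dual_basisZ.
Qed.

Lemma dual_basis_linear (M : lmodType T^c) (m : I -> M) :
  linear (fun x : E => \sum_i (phi i x : T^c) *: m i).
Proof.
move=> t x y; rewrite scaler_sumr -big_split; apply: eq_bigr => i _ /=.
by rewrite dual_basisD dual_basisZ scalerDl scalerA.
Qed.

Lemma dual_basis_projective : projective E.
Proof.
move=> M N q f surj; pose m i := projT1 (cid (surj (f (g i)))).
pose h : {linear E -> M} := HB.pack (fun x : E => \sum_i (phi i x : T^c) *: m i)
  (GRing.isLinear.Build _ _ _ _ _ (dual_basis_linear m)).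
exists h => x; rewrite /= linear_sum -[in RHS](dual_basisK x) linear_sum.
by apply: eq_bigr => i _; rewrite !linearZ /= /m; case: cid => /= y ->.
Qed.

End Theory.

Lemma dual_basis_reindex (I J : finType) (g : I -> E) (phi : I -> E -> T) (f : J -> I) :
  bijective f -> dual_basis g phi -> dual_basis (g \o f) (fun j => phi (f j)).
Proof.
move=> bf [pD pZ pK]; split=> [j x y|j t x|x]; rewrite ?pD ?pZ //=.
by rewrite -[RHS]pK [RHS](reindex f) //=; exact: onW_bij.
Qed.

Section Coordinates.
Variables (n : nat) (g : 'I_n -> E) (phi : 'I_n -> E -> T).
Hypothesis gphi : dual_basis g phi.

Definition dual_gram : 'M[T]_n := \matrix_(i, j) phi i (g j).

Fact synthesis_linear :
  linear (fun v : 'cV[T^c]_n => \sum_i (v i ord0 : T^c) *: g i).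
Proof.
move=> t v w; rewrite scaler_sumr -big_split; apply: eq_bigr => i _ /=.
by rewrite !mxE scalerDl scalerA.
Qed.

Definition synthesis : {linear 'cV[T^c]_n -> E} :=
  HB.pack (fun v : 'cV[T^c]_n => \sum_i (v i ord0 : T^c) *: g i)
    (GRing.isLinear.Build _ _ _ _ _ synthesis_linear).

Fact analysis_linear : linear (fun x => \col_i (phi i x : T^c) : 'cV[T^c]_n).
Proof.
move=> t x y; apply/matrixP => i k.
by rewrite !mxE (dual_basisD gphi) (dual_basisZ gphi).
Qed.

Definition analysis : {linear E -> 'cV[T^c]_n} :=
  HB.pack (fun x => \col_i (phi i x : T^c) : 'cV[T^c]_n)
    (GRing.isLinear.Build _ _ _ _ _ analysis_linear).

Lemma analysisK x : synthesis (analysis x) = x.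
Proof. by rewrite -[RHS](dual_basisK gphi); apply: eq_bigr => i _; rewrite mxE. Qed.

Lemma synthesisK (v : 'cV[T]_n) : (analysis (synthesis v) : 'cV[T]_n) = dual_gram *m v.
Proof.
apply/matrixP => i k; rewrite ord1 !mxE (dual_basis_sum gphi).
by apply: eq_bigr => j _; rewrite (dual_basisZ gphi) mxE.
Qed.

Lemma dual_gram_idem : dual_gram *m dual_gram = dual_gram.
Proof.
apply/matrixP => i k; rewrite !mxE (dual_basis_expand gphi).
by apply: eq_bigr => j _; rewrite !mxE.
Qed.

Lemma dual_basis_iso : iso_idem E dual_gram.
Proof.
exists analysis; split; first exact: can_inj analysisK.
move=> x; split=> [[e <-]|[y ->]]; last by exists (synthesis y); exact: synthesisK.
by exists (analysis e : 'cV[T]_n); rewrite -synthesisK analysisK.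
Qed.

Lemma dual_basis_fg : finitely_generated E.
Proof. by exists n, synthesis => x; exists (analysis x); exact: analysisK. Qed.

End Coordinates.

Lemma fg_projective_dual_basis : finitely_generated E -> projective E ->
  exists n (g : 'I_n -> E) phi, dual_basis g phi.
Proof.
move=> [n [F Fs]] /(_ _ _ F idfun Fs) [h Fh].
exists n, (fun i => F (delta_mx i ord0)), (fun i x => (h x : 'cV[T^c]_n) i ord0).
split=> [i x y|i t x|x]; first by rewrite linearD mxE.
  by rewrite linearZ mxE.
rewrite -[RHS]Fh [in RHS](matrix_sum_delta (h x)) linear_sum; apply: eq_bigr => i _.
by rewrite big_ord1 linearZ.
Qed.

(** The generators are the preimages of the columns of [p], and the coordinate functions are those
    of the embedding. *)
Lemma iso_idem_dual_basis N (p : 'M[T]_N) : p *m p = p -> iso_idem E p ->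
  exists (g : 'I_N -> E) phi, dual_basis g phi /\ p = dual_gram g phi.
Proof.
move=> pp [f [finj fim]].
have ex j : exists e, (f e : 'cV[T]_N) = col j p.
  by apply/fim; exists (delta_mx j ord0); rewrite colE.
pose g j := projT1 (cid (ex j)).
have gP j : (f (g j) : 'cV[T]_N) = col j p by rewrite /g; case: cid.
have fp e : p *m (f e : 'cV[T]_N) = f e.
  by have [y ->] := (fim (f e)).1 (ex_intro _ e erefl); rewrite mulmxA pp.
exists g, (fun i e => (f e : 'cV[T]_N) i ord0); split.
  split=> [i x y|i t x|x]; first by rewrite linearD mxE.
    by rewrite linearZ mxE.
  apply: finj; rewrite linear_sum; apply/matrixP => i k; rewrite (ord1 k) summxE.
  rewrite -[in RHS](fp x) [RHS]mxE; apply: eq_bigr => j _.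
  by rewrite linearZ mxE gP mxE.
by apply/matrixP => i j; rewrite mxE gP mxE.
Qed.

(** The two transition matrices. By this equivalence ch does not depend on the idempotent
    representing [E]. *)
Lemma dual_gram_equiv (m n : nat) (g : 'I_m -> E) phi (h : 'I_n -> E) psi :
  dual_basis g phi -> dual_basis h psi ->
  exists (x : 'M[T]_(m, n)) (y : 'M[T]_(n, m)),
    x *m y = dual_gram g phi /\ y *m x = dual_gram h psi.
Proof.
move=> gphi hpsi; exists (\matrix_(i, j) phi i (h j)), (\matrix_(i, j) psi i (g j)).
have gen k l (a : 'I_k -> E) al (b : 'I_l -> E) be : dual_basis a al -> dual_basis b be ->
    (\matrix_(i, j) al i (b j)) *m (\matrix_(i, j) be i (a j)) = dual_gram a al.
  move=> ha hb; apply/matrixP => i j; rewrite !mxE -[in RHS](dual_basisK hb (a j)).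
  rewrite (dual_basis_sum ha); apply: eq_bigr => r _.
  by rewrite !mxE (dual_basisZ ha).
by split; apply: gen.
Qed.

End DualBasis.

Lemma iso_idem_bimod_iso (S T : nzRingType) (E F : bimodule S T) N (p : 'M[T]_N) :
  bimod_iso E F -> iso_idem E p -> iso_idem F p.
Proof.
move=> [f [[f' fK f'K] _]] [h [hinj him]].
have f'lin : linear f' by move=> t x y; apply: (can_inj fK); rewrite linearP !f'K.
pose f'l : {linear F -> E} := HB.pack f' (GRing.isLinear.Build _ _ _ _ _ f'lin).
exists (h \o f'l : {linear F -> 'cV[T^c]_N}); split; first exact: inj_comp hinj (can_inj f'K).
move=> x; rewrite -him; split=> [[e <-]|[e <-]]; first by exists (f' e).
by exists (f e); rewrite /= fK.
Qed.

(** * Trivializations expressed in coordinates *)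

Section Trivial.
Variables (B A : nzRingType) (iota : {rmorphism B -> A}).

Definition trivial_data (E : bimodule B B) (I K : finType) (g : I -> E) (phi : I -> E -> B)
    (u : I -> K -> A) (v : K -> I -> A) : Prop :=
  [/\ dual_basis g phi,
      forall k l, \sum_i v k i * u i l = (k == l)%:R
    & forall i j, \sum_k u i k * v k j = iota (phi i (g j))].

(* The left action of B on A^r restricts to that of E. *)
Definition left_data (E : bimodule B B) (I K : finType) (g : I -> E) (phi : I -> E -> B)
    (u : I -> K -> A) (v : K -> I -> A) : Prop :=
  forall b i j, \sum_k u i k * iota b * v k j = iota (phi i (lact b (g j))).

Section Extend.
Variables (E : bimodule B B) (n : nat) (g : 'I_n -> E) (phi : 'I_n -> E -> B).
Hypothesis gphi : dual_basis g phi.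
Local Notation EA := (tensor_bimod E (ext_bimod iota)).

Local Notation tens1 e := (tens (F := ext_bimod iota) e (1 : A) : EA).

Let coord (i : 'I_n) (x : E * ext_bimod iota) : A := iota (phi i x.1) * (x.2 : A).

Let coord_kills i : kills (@tensor_rel B B A E (ext_bimod iota)) (coord i).
Proof.
apply: kills_balanced => [e e' f|e f f'|e t f]; rewrite /coord /=.
- by rewrite (dual_basisD gphi) rmorphD mulrDl.
- exact: mulrDr.
- by rewrite (dual_basisZ gphi) rmorphM -mulrA.
Qed.

Definition ext_coord i : EA -> A := pres_lift (coord i).

Lemma ext_coord_tens i e a : ext_coord i (tens e a) = iota (phi i e) * (a : A).
Proof. exact: (pres_lift_gen _ (coord_kills i)). Qed.

Lemma ext_coordD i : {morph ext_coord i : x y / x + y}.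
Proof. exact: (pres_liftD (coord_kills i)). Qed.

Lemma ext_scale_tens (a : A) e (c : ext_bimod iota) :
  (a : A^c) *: (tens e c : EA) = tens e ((c : A) * a : ext_bimod iota).
Proof. exact: tensor_scale_tens. Qed.

Lemma ext_coordZ i (a : A) (x : EA) : ext_coord i ((a : A^c) *: x) = ext_coord i x * a.
Proof.
move: x; apply: tensor_ext => [x y|x y|e c].
- by rewrite scalerDr ext_coordD.
- by rewrite ext_coordD mulrDl.
- by rewrite ext_scale_tens !ext_coord_tens mulrA.
Qed.

Lemma ext_coord_sum i J (r : seq J) (P : pred J) (F : J -> EA) :
  ext_coord i (\sum_(j <- r | P j) F j) = \sum_(j <- r | P j) ext_coord i (F j).
Proof.
apply: (big_morph (ext_coord i)); first exact: ext_coordD.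
by apply: (addIr (ext_coord i 0)); rewrite -ext_coordD !add0r.
Qed.

Lemma ext_tensD e : {morph (fun a : ext_bimod iota => tens e a : EA) : a b / a + b}.
Proof. by move=> a b; exact: tensDr. Qed.

Lemma tens_suml_ext J (r : seq J) (P : pred J) (F : J -> E) (a : ext_bimod iota) :
  (tens (\sum_(j <- r | P j) F j) a : EA) = \sum_(j <- r | P j) tens (F j) a.
Proof.
apply: (big_morph (fun e => tens e a : EA)); first by move=> x y; exact: tensDl.
by apply: (addIr (tens 0 a : EA)); rewrite -tensDl !add0r.
Qed.

Lemma ext_coordK (x : EA) : \sum_i (tens (g i) (ext_coord i x : ext_bimod iota) : EA) = x.
Proof.
move: x; apply: tensor_ext => [x y|//|e a].
  by rewrite -big_split; apply: eq_bigr => i _; rewrite ext_coordD ext_tensD.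
rewrite -[in RHS](dual_basisK gphi e) tens_suml_ext; apply: eq_bigr => i _.
by rewrite ext_coord_tens tens_mid.
Qed.

Section OfTrivialization.
Variables (r : nat) (Phi : {linear EA -> 'cV[A^c]_r}).
Hypothesis triv : trivialization Phi.

Lemma trivialization_data : exists u v,
  @trivial_data E 'I_n 'I_r g phi u v /\ (left_compatible Phi -> left_data g phi u v).
Proof.
have [Psi PhiK PsiK] := triv.
have Psi_lin : linear Psi by move=> t x y; apply: (can_inj PhiK); rewrite linearP !PsiK.
pose L : {linear 'cV[A^c]_r -> EA} := HB.pack Psi (GRing.isLinear.Build _ _ _ _ _ Psi_lin).
(* [u] holds the coordinates of the preimages of the unit vectors, [v] the images of the
   generators. *)
pose u i k := ext_coord i (L (delta_mx k ord0)).
pose v k i := (Phi (tens1 (g i))) k ord0 : A.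
have uE i (y : 'cV[A]_r) : \sum_k u i k * y k ord0 = ext_coord i (L (y : 'cV[A^c]_r)).
  rewrite [in RHS](matrix_sum_delta (y : 'cV[A^c]_r)) linear_sum ext_coord_sum; apply: eq_bigr => k _.
  by rewrite big_ord1 linearZ ext_coordZ.
have LPhi x : L (Phi x) = x := PhiK x.
exists u, v; split; first split=> //.
- move=> k l; have := ext_coordK (L (delta_mx l ord0)).
  move=> /(congr1 Phi); rewrite [RHS]PsiK linear_sum => /matrixP /(_ k ord0).
  rewrite summxE [RHS]mxE eqxx andbT => <-; apply: eq_bigr => i _.
  rewrite -/(u i l) -[X in tens _ X]mul1r -ext_scale_tens linearZ mxE //.
- by move=> i j; rewrite (uE i (Phi (tens1 (g j)))) LPhi ext_coord_tens mulr1.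
move=> lc b i j.
have lb : lact b (tens1 (g j)) = tens1 (lact b (g j)) by exact: tensor_lact_tens.
have := uE i (Phi (tens1 (lact b (g j)))); rewrite LPhi ext_coord_tens mulr1 => <-.
apply: eq_bigr => k _; rewrite -mulrA; congr (_ * _).
by rewrite -lb lc mxE.
Qed.
End OfTrivialization.

Section ToTrivialization.
Variables (r : nat) (u : 'I_n -> 'I_r -> A) (v : 'I_r -> 'I_n -> A).
Hypothesis data : trivial_data g phi u v.

Let vu k l : \sum_i v k i * u i l = (k == l)%:R. Proof. by case: data. Qed.
Let uv i j : \sum_k u i k * v k j = iota (phi i (g j)). Proof. by case: data. Qed.

Fact triv_map_linear :
  linear (fun x : EA => (\col_k \sum_i v k i * ext_coord i x) : 'cV[A^c]_r).
Proof.
move=> t x y; apply/matrixP => k l; rewrite !mxE.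
transitivity ((\sum_i v k i * ext_coord i x) * (t : A) + \sum_i v k i * ext_coord i y) => //.
rewrite mulr_suml -big_split; apply: eq_bigr => i _ /=.
by rewrite ext_coordD ext_coordZ mulrDr mulrA.
Qed.

Definition triv_map : {linear EA -> 'cV[A^c]_r} :=
  HB.pack (fun x : EA => (\col_k \sum_i v k i * ext_coord i x) : 'cV[A^c]_r)
    (GRing.isLinear.Build _ _ _ _ _ triv_map_linear).

Lemma triv_mapE x k : (triv_map x : 'cV[A]_r) k ord0 = \sum_i v k i * ext_coord i x.
Proof. by rewrite mxE. Qed.

(** The inverse sends y to the sum of the g_i (x) (u y)_i. One composite reduces through [uv] to the
    expansion [ext_coordK]; the other is v (u v) u y, settled by applying [vu] twice. *)
Lemma triv_map_bijective : trivialization triv_map.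
Proof.
exists (fun y => \sum_i tens (g i) ((\sum_k u i k * (y : 'cV[A]_r) k ord0) : ext_bimod iota)).
  move=> x; rewrite -[RHS]ext_coordK; apply: eq_bigr => i _; congr tens.
  under eq_bigr => k _ do rewrite triv_mapE mulr_sumr.
  rewrite exchange_big /=.
  under eq_bigr => j _ do under eq_bigr => k _ do rewrite mulrA.
  under eq_bigr => j _ do rewrite -mulr_suml uv.
  rewrite -[x in RHS]ext_coordK ext_coord_sum; apply: eq_bigr => j _.
  by rewrite ext_coord_tens.
move=> y; apply/matrixP => k l; rewrite (ord1 l) triv_mapE.
transitivity (\sum_i v k i * \sum_l u i l * (y : 'cV[A]_r) l ord0).
  apply: eq_bigr => i _; congr (_ * _); rewrite ext_coord_sum.
  under eq_bigr => j _ do rewrite ext_coord_tens mulr_sumr.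
  rewrite exchange_big /=; apply: eq_bigr => m _.
  under eq_bigr => j _ do rewrite mulrA.
  rewrite -mulr_suml; congr (_ * _).
  under eq_bigr => j _ do rewrite -uv mulr_suml.
  rewrite exchange_big /=.
  under eq_bigr => p _ do (under eq_bigr => j _ do rewrite -mulrA); rewrite /=.
  under eq_bigr => p _ do rewrite -mulr_sumr vu.
  rewrite (bigD1 m) //= eqxx mulr1 big1 ?addr0 // => p /negPf pm.
  by rewrite pm mulr0.
under eq_bigr => i _ do rewrite mulr_sumr.
rewrite exchange_big /= (bigD1 k) //= [X in _ + X]big1 ?addr0 => [|m /negPf mk].
  under eq_bigr => i _ do rewrite mulrA.
  by rewrite -mulr_suml vu eqxx mul1r.
under eq_bigr => i _ do rewrite mulrA.
by rewrite -mulr_suml vu eq_sym mk mul0r.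
Qed.

Lemma triv_map_left : left_data g phi u v -> left_compatible triv_map.
Proof.
move=> ld b x; apply/matrixP => k l; rewrite (ord1 l) [RHS]mxE triv_mapE triv_mapE.
have lphi e i : iota (phi i (lact b e)) = \sum_m u i m * (iota b * \sum_j v m j * iota (phi j e)).
  rewrite -{1}(dual_basisK gphi e).
  have -> : lact b (\sum_j (phi j e : B^c) *: g j) = \sum_j (phi j e : B^c) *: lact b (g j).
    rewrite (big_morph (lact b) (@lactD _ _ E b) (_ : lact b 0 = 0)).
      by apply: eq_bigr => j _; rewrite lactZ.
    by apply: (addIr (lact b 0)); rewrite -lactD !add0r.
  rewrite (dual_basis_sum gphi) rmorph_sum.
  under eq_bigr => j _ do rewrite (dual_basisZ gphi) rmorphM -ld mulr_suml.
  rewrite exchange_big /=; apply: eq_bigr => m _; rewrite !mulr_sumr.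
  by apply: eq_bigr => j _; rewrite !mulrA.
move: x; apply: tensor_ext => [x y|x y|e a].
- by rewrite -big_split; apply: eq_bigr => i _; rewrite lactD ext_coordD mulrDr.
- rewrite -mulrDr -big_split; congr (_ * _); apply: eq_bigr => i _.
  by rewrite ext_coordD mulrDr.
have -> : lact b (tens e a : EA) = tens (lact b e) a by exact: tensor_lact_tens.
under eq_bigr => i _ do rewrite ext_coord_tens lphi mulrA mulr_sumr.
under [in RHS]eq_bigr => i _ do rewrite ext_coord_tens mulrA.
rewrite -!mulr_suml exchange_big /= mulrA; congr (_ * _).
under eq_bigr => m _ do (under eq_bigr => i _ do rewrite mulrA); rewrite /=.
under eq_bigr => m _ do rewrite -mulr_suml vu.
rewrite (bigD1 k) //= eqxx mul1r [X in _ + X]big1 ?addr0 // => m /negPf mk.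
by rewrite eq_sym mk mul0r.
Qed.

End ToTrivialization.
End Extend.
End Trivial.

(** * Membership in terms of coordinate data; unit and direct sum *)

Section Closure.
Variables (B A : nzRingType) (iota : {rmorphism B -> A}).
Local Notation triv := (trivial_data iota).
Local Notation leftd := (left_data iota).

Lemma in_Vect_data (E : bimodule B B) : in_Vect iota E ->
  exists n r (g : 'I_n -> E) phi (u : 'I_n -> 'I_r -> A) v, (0 < r)%N /\ triv g phi u v.
Proof.
move=> [fg pr [r [Phi [r0 triv_Phi]]]].
have [n [g [phi gphi]]] := fg_projective_dual_basis fg pr.
have [u [v [uv _]]] := trivialization_data gphi triv_Phi.
by exists n, r, g, phi, u, v.
Qed.

Lemma in_Vect_bi_data (E : bimodule B B) : in_Vect_bi iota E ->
  exists n r (g : 'I_n -> E) phi (u : 'I_n -> 'I_r -> A) v,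
    [/\ (0 < r)%N, triv g phi u v & leftd g phi u v].
Proof.
move=> [fg pr [r [Phi [r0 triv_Phi lc]]]].
have [n [g [phi gphi]]] := fg_projective_dual_basis fg pr.
have [u [v [uv ld]]] := trivialization_data gphi triv_Phi.
by exists n, r, g, phi, u, v; split=> //; apply: ld.
Qed.

Section OfData.
Variables (E : bimodule B B) (I K : finType).
Variables (g : I -> E) (phi : I -> E -> B) (u : I -> K -> A) (v : K -> I -> A).
Hypotheses (K0 : (0 < #|K|)%N) (data : triv g phi u v).

Let g' (i : 'I_#|I|) := g (enum_val i).
Let phi' (i : 'I_#|I|) := phi (enum_val i).
Let u' (i : 'I_#|I|) (k : 'I_#|K|) := u (enum_val i) (enum_val k).
Let v' (k : 'I_#|K|) (i : 'I_#|I|) := v (enum_val k) (enum_val i).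

Lemma reindex_enum_val (V : nmodType) (J : finType) (F : J -> V) :
  \sum_(j < #|J|) F (enum_val j) = \sum_j F j.
Proof. by rewrite [RHS](reindex (@enum_val J xpredT)) //=; exact/onW_bij/enum_val_bij. Qed.

Let data' : triv g' phi' u' v'.
Proof.
case: data => gphi vu uv; split.
- exact: (dual_basis_reindex (@enum_val_bij I)).
- move=> k l; rewrite /u' /v' (reindex_enum_val (fun i => v _ i * u i _)) vu.
  by rewrite (inj_eq enum_val_inj).
- by move=> i j; rewrite /u' /v' (reindex_enum_val (fun k => u _ k * v k _)) uv.
Qed.

Lemma data_in_Vect : in_Vect iota E.
Proof.
have [gphi _ _] := data'; split.
- exact: dual_basis_fg gphi.
- exact: dual_basis_projective gphi.
exists #|K|, (triv_map iota gphi v'); split=> //; exact: (triv_map_bijective gphi data').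
Qed.

Lemma data_in_Vect_bi : leftd g phi u v -> in_Vect_bi iota E.
Proof.
move=> ld; have [gphi _ _] := data'; split.
- exact: dual_basis_fg gphi.
- exact: dual_basis_projective gphi.
exists #|K|, (triv_map iota gphi v'); split=> //; first exact: (triv_map_bijective gphi data').
apply: (triv_map_left gphi data') => b i j.
by rewrite -ld /u' /v' -(reindex_enum_val (fun k => u _ k * _ * v k _)).
Qed.

End OfData.

Section Unit.

Lemma unit_data : triv (E := unit_bimod B) (fun _ : unit => 1 : B) (fun _ x => x : B)
  (fun _ _ : unit => 1) (fun _ _ : unit => 1).
Proof.
split=> [|[] []|_ _]; last 2 first.
- by rewrite big_const card_unit /= addr0 mulr1.
- by rewrite big_const card_unit /= addr0 mulr1 rmorph1.
split=> // x; rewrite big_const card_unit /= addr0.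
by change ((1 : B) * (x : B) = x); exact: mul1r.
Qed.

Lemma unit_left : leftd (E := unit_bimod B) (fun _ : unit => 1 : B) (fun _ x => x : B)
  (fun _ _ : unit => 1) (fun _ _ : unit => 1).
Proof.
move=> b _ _; rewrite big_const card_unit /= addr0 mul1r mulr1.
by rewrite /ext_lact /= mulr1.
Qed.

End Unit.

Section Sum.
Variables (E F : bimodule B B) (I J K L : finType).
Variables (g : I -> E) (phi : I -> E -> B) (u : I -> K -> A) (v : K -> I -> A).
Variables (h : J -> F) (psi : J -> F -> B) (w : J -> L -> A) (z : L -> J -> A).
Hypotheses (dE : triv g phi u v) (dF : triv h psi w z).

Definition sum_gen (i : I + J) : sum_bimod E F :=
  match i with inl i => (g i, 0) | inr j => (0, h j) end.
Definition sum_coord (i : I + J) (x : sum_bimod E F) : B :=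
  match i with inl i => phi i x.1 | inr j => psi j x.2 end.
Definition sum_u (i : I + J) (k : K + L) : A :=
  match i, k with inl i, inl k => u i k | inr j, inr l => w j l | _, _ => 0 end.
Definition sum_v (k : K + L) (i : I + J) : A :=
  match k, i with inl k, inl i => v k i | inr l, inr j => z l j | _, _ => 0 end.

Lemma sum_data : triv sum_gen sum_coord sum_u sum_v.
Proof.
case: dE dF => gphi vu uv [hpsi zw wz].
have phi0 i : phi i 0 = 0 by apply: (addIr (phi i 0)); rewrite -(dual_basisD gphi) !add0r.
have psi0 i : psi i 0 = 0 by apply: (addIr (psi i 0)); rewrite -(dual_basisD hpsi) !add0r.
split.
- split=> [[i|j] x y|[i|j] t x|[x y]] /=.
  + exact: (dual_basisD gphi).
  + exact: (dual_basisD hpsi).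
  + exact: (dual_basisZ gphi).
  + exact: (dual_basisZ hpsi).
  rewrite big_sumType /= [RHS](_ : _ = (x, 0) + (0, y)); last first.
    by congr pair; rewrite ?addr0 ?add0r.
  congr (_ + _).
    rewrite -[x in RHS](dual_basisK gphi).
    rewrite (big_morph (fun x => (x, 0 : F)) (id1 := 0) (op1 := +%R)) //.
      by apply: eq_bigr => i _; congr pair; rewrite scaler0.
    by move=> a b; congr pair; rewrite addr0.
  rewrite -[y in RHS](dual_basisK hpsi).
  rewrite (big_morph (fun x => (0 : E, x)) (id1 := 0) (op1 := +%R)) //.
    by apply: eq_bigr => i _; congr pair; rewrite scaler0.
  by move=> a b; congr pair; rewrite addr0.
- move=> [k|k] [l|l]; rewrite big_sumType /=.
  + by rewrite vu [X in _ + X]big1 ?addr0 // => i _; rewrite mulr0.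
  + by rewrite !big1 ?addr0 // => i _; rewrite ?mulr0 ?mul0r.
  + by rewrite !big1 ?addr0 // => i _; rewrite ?mulr0 ?mul0r.
  + by rewrite zw big1 ?add0r // => i _; rewrite mulr0.
- move=> [i|i] [j|j]; rewrite big_sumType /=.
  + by rewrite uv [X in _ + X]big1 ?addr0 // => k _; rewrite mulr0.
  + by rewrite phi0 rmorph0 !big1 ?addr0 // => k _; rewrite ?mulr0 ?mul0r.
  + by rewrite psi0 rmorph0 !big1 ?addr0 // => k _; rewrite ?mulr0 ?mul0r.
  + by rewrite wz big1 ?add0r // => k _; rewrite mulr0.
Qed.

Lemma sum_left : leftd g phi u v -> leftd h psi w z -> leftd sum_gen sum_coord sum_u sum_v.
Proof.
case: dE dF => gphi vu uv [hpsi zw wz] lE lF b.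
have l0 (G : bimodule B B) : lact b (0 : G) = 0.
  by apply: (addIr (lact b 0)); rewrite -lactD !add0r.
have phi0 i : phi i 0 = 0 by apply: (addIr (phi i 0)); rewrite -(dual_basisD gphi) !add0r.
have psi0 i : psi i 0 = 0 by apply: (addIr (psi i 0)); rewrite -(dual_basisD hpsi) !add0r.
move=> [i|i] [j|j]; rewrite big_sumType /=.
- by rewrite lE [X in _ + X]big1 ?addr0 // => k _; rewrite mulr0.
- by rewrite l0 phi0 rmorph0 !big1 ?addr0 // => k _; rewrite ?mulr0 ?mul0r.
- by rewrite l0 psi0 rmorph0 !big1 ?addr0 // => k _; rewrite ?mulr0 ?mul0r.
- by rewrite lF big1 ?add0r // => k _; rewrite mulr0.
Qed.

End Sum.
End Closure.

(** * Coordinate data for tensor products *)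

Section TensorData.
Variables (B A : nzRingType) (iota : {rmorphism B -> A}).
Variables (E F : bimodule B B) (I J K L : finType).
Variables (g : I -> E) (phi : I -> E -> B) (u : I -> K -> A) (v : K -> I -> A).
Variables (h : J -> F) (psi : J -> F -> B) (w : J -> L -> A) (z : L -> J -> A).
Hypotheses (dE : trivial_data iota g phi u v) (dF : trivial_data iota h psi w z).
Hypothesis lF : left_data iota h psi w z.
Local Notation EF := (tensor_bimod E F).

Let gphi : dual_basis g phi. Proof. by case: dE. Qed.
Let hpsi : dual_basis h psi. Proof. by case: dF. Qed.

Definition tensor_gen (ij : I * J) : EF := tens (g ij.1) (h ij.2).
Let pre_coord (ij : I * J) (x : E * F) : B := psi ij.2 (lact (phi ij.1 x.1) x.2).
Definition tensor_coord (ij : I * J) : EF -> B := pres_lift (pre_coord ij).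
(** The order of the factors is forced: psi_j(phi_i(g_i') h_j') becomes, by the left compatibility
    of [F], a sum of w_jl (u_ik v_ki') z_lj', with the data of [E] in the middle. *)
Definition tensor_u (ij : I * J) (kl : K * L) : A := w ij.2 kl.2 * u ij.1 kl.1.
Definition tensor_v (kl : K * L) (ij : I * J) : A := v kl.1 ij.1 * z kl.2 ij.2.

Let pre_coord_kills ij : kills (@tensor_rel B B B E F) (pre_coord ij).
Proof.
apply: kills_balanced => [e e' f|e f f'|e t f]; rewrite /pre_coord /=.
- by rewrite (dual_basisD gphi) lactDl (dual_basisD hpsi).
- by rewrite lactD (dual_basisD hpsi).
- by rewrite (dual_basisZ gphi) lactA.
Qed.

Lemma tensor_coord_tens ij e f :
  tensor_coord ij (tens e f) = psi ij.2 (lact (phi ij.1 e) f).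
Proof. exact: (pres_lift_gen _ (pre_coord_kills ij)). Qed.

Lemma tensor_coordD ij : {morph tensor_coord ij : x y / x + y}.
Proof. exact: (pres_liftD (pre_coord_kills ij)). Qed.

Lemma tensor_scaleE (t : B^c) e f : t *: (tens e f : EF) = tens e (t *: f).
Proof. exact: tensor_scale_tens. Qed.

Lemma tens_suml S (r : seq S) (P : pred S) (G : S -> E) f :
  (tens (\sum_(j <- r | P j) G j) f : EF) = \sum_(j <- r | P j) tens (G j) f.
Proof.
apply: (big_morph (fun e => tens e f : EF)); first by move=> x y; exact: tensDl.
by apply: (addIr (tens 0 f : EF)); rewrite -tensDl !add0r.
Qed.

Lemma tens_sumr S (r : seq S) (P : pred S) (G : S -> F) e :
  (tens e (\sum_(j <- r | P j) G j) : EF) = \sum_(j <- r | P j) tens e (G j).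
Proof.
apply: (big_morph (fun f => tens e f : EF)); first by move=> x y; exact: tensDr.
by apply: (addIr (tens e 0 : EF)); rewrite -tensDr !add0r.
Qed.

Lemma tensor_dual_basis : dual_basis tensor_gen tensor_coord.
Proof.
split=> [ij|ij t|]; first exact: tensor_coordD.
  apply: tensor_ext => [x y|x y|e f].
  - by rewrite scalerDr tensor_coordD.
  - by rewrite tensor_coordD mulrDl.
  - by rewrite tensor_scaleE !tensor_coord_tens lactZ (dual_basisZ hpsi).
apply: tensor_ext => [x y|//|e f].
  by rewrite -big_split; apply: eq_bigr => ij _; rewrite tensor_coordD scalerDl.
rewrite -(pair_bigA _ (fun i j => (tensor_coord (i, j) (tens e f) : B^c) *: tensor_gen (i, j))) /=.
rewrite -[e in RHS](dual_basisK gphi) tens_suml; apply: eq_bigr => i _.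
rewrite tens_mid -[lact _ f in RHS](dual_basisK hpsi) tens_sumr; apply: eq_bigr => j _.
by rewrite tensor_scaleE tensor_coord_tens.
Qed.

Lemma tensor_lact_gen b ij ij' :
  tensor_coord ij (lact b (tensor_gen ij')) =
  psi ij.2 (lact (phi ij.1 (lact b (g ij'.1))) (h ij'.2)).
Proof.
have -> : lact b (tensor_gen ij') = (tens (lact b (g ij'.1)) (h ij'.2) : EF).
  exact: tensor_lact_tens.
exact: tensor_coord_tens.
Qed.

Lemma tensor_data : trivial_data iota tensor_gen tensor_coord tensor_u tensor_v.
Proof.
case: dE dF => _ vu uv [_ zw wz]; split; first exact: tensor_dual_basis.
  move=> [k l] [k' l'].
  rewrite -(pair_bigA _ (fun i j => tensor_v (k, l) (i, j) * tensor_u (i, j) (k', l'))) /=.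
  rewrite /tensor_u /tensor_v /=.
  transitivity (\sum_i v k i * (l == l')%:R * u i k').
    apply: eq_bigr => i _; rewrite -zw mulr_sumr mulr_suml.
    by apply: eq_bigr => j _; rewrite !mulrA.
  have -> : ((k, l) == (k', l')) = (k == k') && (l == l') by [].
  case: (l == l'); first by under eq_bigr => i _ do rewrite mulr1; rewrite vu andbT.
  by rewrite big1 ?andbF // => i _; rewrite mulr0 mul0r.
move=> ij ij'; rewrite tensor_coord_tens -lF -uv.
rewrite -(pair_bigA _ (fun k l => tensor_u ij (k, l) * tensor_v (k, l) ij')) /= exchange_big /=.
apply: eq_bigr => l _; rewrite mulr_sumr mulr_suml; apply: eq_bigr => k _.
by rewrite /tensor_u /tensor_v !mulrA.
Qed.

Lemma tensor_left : left_data iota g phi u v ->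
  left_data iota tensor_gen tensor_coord tensor_u tensor_v.
Proof.
move=> lE b ij ij'; rewrite tensor_lact_gen -lF -lE.
rewrite -(pair_bigA _ (fun k l => tensor_u ij (k, l) * iota b * tensor_v (k, l) ij')) /=.
rewrite exchange_big /=; apply: eq_bigr => l _; rewrite mulr_sumr mulr_suml.
by apply: eq_bigr => k _; rewrite /tensor_u /tensor_v !mulrA.
Qed.

Lemma tensor_trace : iota (\sum_ij tensor_coord ij (tensor_gen ij)) =
  \sum_j \sum_l w j l * iota (\sum_i phi i (g i)) * z l j.
Proof.
have -> : \sum_ij tensor_coord ij (tensor_gen ij) =
    \sum_j \sum_i psi j (lact (phi i (g i)) (h j)).
  by rewrite exchange_big pair_bigA; apply: eq_bigr => ij _; exact: tensor_coord_tens.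
rewrite rmorph_sum; apply: eq_bigr => j _; rewrite rmorph_sum.
under eq_bigr => i _ do rewrite -lF.
rewrite exchange_big /=; apply: eq_bigr => l _.
by rewrite rmorph_sum mulr_sumr mulr_suml.
Qed.

End TensorData.

(** * The Chern character *)

Section Zdual.

Let size_lin (a b : int) : 
  (size (a%:P + b *: 'X : {poly int})%R < size (mk_monic ('X^2 : {poly int})%R))%N.
Proof.
rewrite mk_monic_Xn size_polyXn ltnS (leq_trans (size_polyD _ _)) // geq_max.
by rewrite (leq_trans (size_polyC_leq1 _)) // (leq_trans (size_scale_leq _ _)) ?size_polyX.
Qed.

Lemma zdualE a b : (zdual a b : {poly int}) = a%:P + b *: 'X.
Proof. exact: in_qpoly_small (size_lin a b). Qed.

Lemma zdual_inj a b a' b' : zdual a b = zdual a' b' -> a = a' /\ b = b'.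
Proof.
move=> e; have /polyP h : a%:P + b *: 'X = a'%:P + b' *: 'X :> {poly int}.
  by rewrite -!zdualE e.
by split; [have := h 0 | have := h 1];
  rewrite !coefD !coefC !coefZ !coefX /= ?mulr0 ?mulr1 ?addr0 ?add0r.
Qed.

Lemma zdualD a b a' b' : zdual a b + zdual a' b' = zdual (a + a') (b + b').
Proof.
by rewrite /zdual -in_qpolyD polyCD scalerDl addrACA.
Qed.

Lemma zdual1 : zdual 1 0 = 1.
Proof. by apply: val_inj; apply: etrans (zdualE 1 0) _; rewrite scale0r addr0. Qed.

Lemma zdualM a b a' b' : zdual a b * zdual a' b' = zdual (a * a') (a * b' + b * a').
Proof.
have -> : zdual a b * zdual a' b' = in_qpoly 'X^2 ((zdual a b : {poly int}) * zdual a' b') by [].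
rewrite !zdualE.
have -> : (a%:P + b *: 'X) * (a'%:P + b' *: 'X) =
    ((a * a')%:P + (a * b' + b * a') *: 'X) + (b * b') *: 'X^2 :> {poly int}.
  rewrite -!mul_polyC !polyCD !polyCM; ring.
rewrite in_qpolyD in_qpolyZ; have -> : in_qpoly 'X^2 'X^2 = 0 :> {poly %/ ('X^2 : {poly int})}.
  apply: val_inj => /=; rewrite mk_monic_Xn; exact: Pdiv.RingMonic.rmodpp (monicXn _ _).
by rewrite scaler0 addr0.
Qed.

End Zdual.

Section SymbolIndex.
Variables (R : realType) (H : hilbertType R).
Local Notation S := (symb_op H).
Local Notation sc := (symb_scalar H).
Local Notation sy := (symb H).

Let sK z : sy (sc z) = z. Proof. by []. Qed.
Let idF : ideal (@symb_finite R H) := symb_ideal (finite_rank_ideal H).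
Let idL : ideal (@symb_trace R H) := symb_ideal (trace_idealP H).
Let FL (x : S) : symb_finite x -> symb_trace x.
Proof. by move=> [Fx x0]; split=> //; exact: finite_rank_trace. Qed.
Let Lker (x : S) : symb_trace x -> sy x = 0. Proof. by case. Qed.

Lemma symb_TrD (x y : S) : symb_trace x -> symb_trace y ->
  symb_Tr (x + y) = symb_Tr x + symb_Tr y.
Proof. by move=> [Lx _] [Ly _]; exact: (TrD Lx Ly). Qed.

Lemma symb_TrC (x l : S) : symb_trace l -> symb_Tr (x * l) = symb_Tr (l * x).
Proof. by move=> [Ll _]; exact: (Tr_mulC x.1 Ll). Qed.

Lemma symb_Tr_scale k (x : S) : symb_trace x -> symb_Tr (sc k * x) = k * symb_Tr x.
Proof.
move=> [Lx _]; apply: Tr_eq; apply/has_traceP => I e oe d d0.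
have p : 0 < nr k + 1 by have := nr_ge0 k; lra.
have /has_traceP /(_ I e oe _ (divr_gt0 d0 p)) [J0 hJ] := TrP Lx.
exists J0 => J /hJ; set t := Tr _; set v := \sum_(i <- J) _ => h.
have -> : \sum_(i <- J) inner ((sc k * x).1 (e i)) (e i) = k * v.
  by rewrite mulr_sumr; apply: eq_bigr => i _; rewrite -innerZl.
have -> : k * symb_Tr x - k * v = k * (t - v) by rewrite mulrBr.
rewrite nrM; move: h; rewrite ltr_pdivlMr //.
by have := nr_ge0 (t - v); lra.
Qed.

Definition symb_defect (x : S) : S := x - sc (sy x).

Lemma symb_defectD (x y : S) : symb_defect (x + y) = symb_defect x + symb_defect y.
Proof. by rewrite /symb_defect [sy (_ + _)]rmorphD [sc (_ + _)]rmorphD opprD addrACA. Qed.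

Lemma scal_central k (x : S) : sc k * x = x * sc k.
Proof. by congr pair; [apply: op_ext => z /=; rewrite opZ_arg|exact: mulrC]. Qed.

(** The first entry is an integer because it is the rank of an idempotent complex matrix; the second
    is an integer by definition of the index. *)
Definition chern_pair n (P : 'M[S]_n) (k : int * int) : Prop :=
  (k.1)%:~R = \tr (map_mx sy P) /\
  is_index (@symb_norm R H) sy sc (@symb_finite R H) (@symb_Tr R H) P k.2.

Let compact n m (P : 'M[S]_(n, m)) := scalar_mod sy sc (@symb_compact R H) P.

Lemma chern_pair_exists n (P : 'M[S]_n) : P *m P = P -> compact P ->
  exists k, chern_pair P k.
Proof.
move=> PP KP.
have [l hl] := index_exists (symb_complete H) sK idF FL Lker (@symb_Tr_int R H)
  (@symb_compact_ker R H) PP KP.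
exists ((\rank (map_mx sy P))%:Z, l); split=> //=.
by rewrite mxtrace_idem ?pmulrn // -map_mxM PP.
Qed.

Lemma chern_pair_equiv m n (P : 'M[S]_m) (Q : 'M[S]_n) (a : 'M[S]_(m, n)) b k l :
  P *m P = P -> compact a -> compact b -> a *m b = P -> b *m a = Q ->
  chern_pair P k -> chern_pair Q l -> k = l.
Proof.
move=> PP Ka Kb ab ba [k1 k2] [l1 l2].
rewrite [k]surjective_pairing [l]surjective_pairing; congr pair.
  apply: (@intr_inj R[i]); rewrite k1 l1 -ab -ba !map_mxM; exact: mxtrace_mulC.
exact: (index_equiv (symb_complete H) sK idF idL FL Lker symb_TrD symb_TrC PP Ka Kb ab ba k2 l2).
Qed.

Lemma chern_pair_block m n (P : 'M[S]_m) (Q : 'M[S]_n) k l :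
  chern_pair P k -> chern_pair Q l ->
  chern_pair (block_mx P 0 0 Q) (k.1 + l.1, k.2 + l.2).
Proof.
move=> [k1 k2] [l1 l2]; split; last exact: (index_block (symb_complete H) idF idL FL symb_TrD k2 l2).
by rewrite map_block_mx mxtrace_block rmorphD /= k1 l1.
Qed.

Lemma chern_pair_trace n (P : 'M[S]_n) k : P *m P = P ->
  scalar_mod sy sc (@symb_trace R H) P -> chern_pair P k ->
  (k.2)%:~R = symb_Tr (symb_defect (\tr P)).
Proof.
move=> PP LP [_ k2].
rewrite -(index_tau (symb_complete H) sK idF idL FL Lker symb_TrD symb_TrC (@symb_Tr_int R H)
  (@symb_trace_compact R H) (@symb_compact_ker R H) PP LP k2) /tau.
congr symb_Tr; rewrite raddfB /=; congr (_ - _).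
rewrite /scal /mxtrace !raddf_sum; apply: eq_bigr => i _; by rewrite mxE.
Qed.

End SymbolIndex.

Section Chern.
Variables (R : realType) (B A Bbar : starAlgType R) (iota : {lrmorphism B -> A}).
Variables (j : {lrmorphism B -> Bbar}) (eps : {lrmorphism A -> R[i] | *%R}).
Variables (H : hilbertType R) (pi : A -> H -> H) (pi_rep : is_rep pi).
Hypothesis pi_eps : forall b : B,
  trace_class (fun x : H => pi (iota b) x - eps (iota b) *: x).
Variable Psi : {rmorphism Bbar -> symb_op H}.
Hypothesis Psi_j : forall b, Psi (j b) = rep_symb pi_rep eps (iota b).
Hypothesis Psi_compact : forall x,
  symb_compact (Psi x - symb_scalar H (symb H (Psi x))).

Local Notation rho := (rep_symb pi_rep eps).

Definition rep_mx n (p : 'M[B]_n) : 'M[symb_op H]_n := map_mx rho (map_mx iota p).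
Definition defect_trace (b : B) : R[i] := symb_Tr (symb_defect (rho (iota b))).

Let rep_mx_compact m n (x : 'M[B]_(m, n)) :
  scalar_mod (symb H) (symb_scalar H) (@symb_compact R H) (map_mx rho (map_mx iota x)).
Proof.
by move=> i k; rewrite !mxE; apply/symb_trace_compact/(rep_symb_trace pi_rep pi_eps).
Qed.

Let Psi_mx_compact m n (x : 'M[Bbar]_(m, n)) :
  scalar_mod (symb H) (symb_scalar H) (@symb_compact R H) (map_mx Psi x).
Proof. by move=> i k; rewrite !mxE; exact: Psi_compact. Qed.

Let rep_mx_trace n (p : 'M[B]_n) :
  scalar_mod (symb H) (symb_scalar H) (@symb_trace R H) (rep_mx p).
Proof. by move=> i k; rewrite !mxE; exact: (rep_symb_trace pi_rep pi_eps). Qed.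

Lemma rep_mx_idem n (p : 'M[B]_n) : p *m p = p -> rep_mx p *m rep_mx p = rep_mx p.
Proof. by move=> pp; rewrite -!map_mxM pp. Qed.

Lemma defect_traceD b c : defect_trace (b + c) = defect_trace b + defect_trace c.
Proof.
rewrite /defect_trace rmorphD [rho _]rmorphD symb_defectD.
by apply: symb_TrD; exact: (rep_symb_trace pi_rep pi_eps).
Qed.

Lemma has_trace_defect b :
  has_trace (fun x : H => pi (iota b) x - eps (iota b) *: x) (defect_trace b).
Proof.
have [/TrP h _] := rep_symb_trace pi_rep pi_eps b.
by apply: has_trace_ext h => x; rewrite op_subE.
Qed.

Let is_chern (E : bimodule B B) (k : int * int) : Prop :=
  exists N (p : 'M[B]_N), [/\ p *m p = p, iso_idem E p & chern_pair (rep_mx p) k].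

(** Total on all bimodules, with default (0, 0) where no idempotent represents [E]; elsewhere
    [chern_unique] makes the choice immaterial. *)
Definition chern (E : bimodule B B) : int * int := xget (0, 0) [set k | is_chern E k]%classic.

Lemma chern_unique (E : bimodule B B) m n (p : 'M[B]_m) (q : 'M[B]_n) k l :
  p *m p = p -> iso_idem E p -> q *m q = q -> iso_idem E q ->
  chern_pair (rep_mx p) k -> chern_pair (rep_mx q) l -> k = l.
Proof.
move=> pp Ep qq Eq.
have [g [phi [gphi ep]]] := iso_idem_dual_basis pp Ep.
have [h [psi [hpsi eq]]] := iso_idem_dual_basis qq Eq.
have [x [y [xy yx]]] := dual_gram_equiv gphi hpsi; rewrite -ep in xy; rewrite -eq in yx.
apply: (chern_pair_equiv (rep_mx_idem pp) (rep_mx_compact x) (rep_mx_compact y)).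
  by rewrite -!map_mxM xy.
by rewrite -!map_mxM yx.
Qed.

Lemma chernP (E : bimodule B B) n (p : 'M[B]_n) : p *m p = p -> iso_idem E p ->
  chern_pair (rep_mx p) (chern E).
Proof.
move=> pp Ep; have [k pk] := chern_pair_exists (rep_mx_idem pp) (rep_mx_compact p).
have [N [q [qq Eq qk]]] : is_chern E (chern E) by apply: xgetPex; exists k, n, p.
by rewrite -(chern_unique pp Ep qq Eq pk qk).
Qed.

Lemma chern_idem (E : bimodule B B) n (p : 'M[B]_n) : p *m p = p -> iso_idem E p ->
  ((chern E).1)%:~R = eps (iota (\tr p)) /\ ((chern E).2)%:~R = defect_trace (\tr p).
Proof.
move=> pp Ep; have ck := chernP pp Ep; split.
  have [-> _] := ck; rewrite /mxtrace !raddf_sum.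
  by apply: eq_bigr => i _; rewrite !mxE.
rewrite (chern_pair_trace (rep_mx_idem pp) (rep_mx_trace p) ck) /defect_trace.
congr (symb_Tr (symb_defect _)); rewrite /mxtrace !raddf_sum.
by apply: eq_bigr => i _; rewrite !mxE.
Qed.

Lemma chern_dual_basis (E : bimodule B B) (I : finType) (g : I -> E) phi :
  dual_basis g phi ->
  ((chern E).1)%:~R = eps (iota (\sum_i phi i (g i))) /\
  ((chern E).2)%:~R = defect_trace (\sum_i phi i (g i)).
Proof.
move=> gphi; have gphi' := dual_basis_reindex (@enum_val_bij I) gphi.
have := chern_idem (dual_gram_idem gphi') (dual_basis_iso gphi').
suff -> : \tr (dual_gram (g \o @enum_val I xpredT) (fun i => phi (enum_val i))) =
    \sum_i phi i (g i) by [].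
rewrite -(reindex_enum_val (fun i => phi i (g i))).
by apply: eq_bigr => i _; rewrite mxE.
Qed.

Lemma chern_iso (E F : bimodule B B) : in_Vect iota E -> bimod_iso E F -> chern E = chern F.
Proof.
move=> /in_Vect_data [n [r [g [phi [u [v [_ [gphi _ _]]]]]]]] EF.
have pp := dual_gram_idem gphi; have Ep := dual_basis_iso gphi.
have Fp := iso_idem_bimod_iso EF Ep.
exact: (chern_unique pp Fp pp Fp (chernP pp Ep) (chernP pp Fp)).
Qed.

(** The sums of u v and of v u need not agree in [A], but their images under [eps] do, since its
    values commute. *)
Lemma trivial_data_rank (E : bimodule B B) (I K : finType) (g : I -> E) phi
    (u : I -> K -> A) (v : K -> I -> A) :
  trivial_data iota g phi u v -> (chern E).1 = #|K|%:Z.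
Proof.
move=> [gphi vu uv]; apply: (@intr_inj R[i]).
have [-> _] := chern_dual_basis gphi.
rewrite -pmulrn !rmorph_sum.
transitivity (\sum_k \sum_i eps (v k i * u i k)).
  rewrite exchange_big; apply: eq_bigr => i _; rewrite -uv rmorph_sum.
  by apply: eq_bigr => k _; rewrite !rmorphM mulrC.
under eq_bigr => k _ do rewrite -rmorph_sum vu eqxx rmorph1.
by rewrite sumr_const.
Qed.

Lemma chern_unit : chern (unit_bimod B) = (1, 0).
Proof.
have [gphi _ _] := unit_data iota.
have [c0 c1] := chern_dual_basis gphi.
have s1 : \sum_(i : unit) (1 : B) = 1 by rewrite big_const card_unit /= addr0.
rewrite [chern _]surjective_pairing; congr pair; apply: (@intr_inj R[i]).
  by rewrite c0 s1 !rmorph1.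
rewrite c1 s1 rmorph0 /defect_trace /symb_defect !rmorph1 subrr.
exact/Tr_eq/has_trace0.
Qed.

Lemma chern_sum (E F : bimodule B B) (I J K L : finType)
    (g : I -> E) phi (u : I -> K -> A) v (h : J -> F) psi (w : J -> L -> A) z :
  trivial_data iota g phi u v -> trivial_data iota h psi w z ->
  chern (sum_bimod E F) = ((chern E).1 + (chern F).1, (chern E).2 + (chern F).2).
Proof.
move=> dE dF; have [gphi _ _] := dE; have [hpsi _ _] := dF; have [sphi _ _] := sum_data dE dF.
have [e0 e1] := chern_dual_basis gphi; have [f0 f1] := chern_dual_basis hpsi.
have [s0 s1] := chern_dual_basis sphi.
have tr_sum : \sum_i sum_coord phi psi i (sum_gen g h i) =
    \sum_i phi i (g i) + \sum_i psi i (h i) by rewrite big_sumType.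
rewrite tr_sum in s0 s1; rewrite [LHS]surjective_pairing; congr pair; apply: (@intr_inj R[i]).
  by rewrite s0 !rmorphD /= e0 f0.
by rewrite s1 defect_traceD rmorphD /= e1 f1.
Qed.

(** Left compatibility is asked of [F] alone: in the coordinates of the tensor product [B] acts on
    [F], whereas [E] enters the formula only through its trace [tE]. *)
Lemma chern_tensor (E F : bimodule B B) (I J K L : finType)
    (g : I -> E) phi (u : I -> K -> A) v (h : J -> F) psi (w : J -> L -> A) z :
  trivial_data iota g phi u v -> trivial_data iota h psi w z -> left_data iota h psi w z ->
  chern (tensor_bimod E F) = ((chern E).1 * (chern F).1,
    (chern E).1 * (chern F).2 + (chern E).2 * (chern F).1).
Proof.
move=> dE dF lF; have [gphi _ _] := dE; have [hpsi zw wz] := dF.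
have [tphi _ _] := tensor_data dE dF lF.
have [e0 e1] := chern_dual_basis gphi; have [f0 f1] := chern_dual_basis hpsi.
have [t0 t1] := chern_dual_basis tphi.
have rF := trivial_data_rank dF.
have trT := tensor_trace dE dF lF.
set tE := \sum_i phi i (g i) in e0 e1 trT; set tF := \sum_i psi i (h i) in f0 f1.
set tT : B := \sum_i tensor_coord phi psi i (tensor_gen g h i) in t0 t1 trT.
pose a := rho (iota tE); pose d := symb_defect a.
have Ld : symb_trace d := rep_symb_trace pi_rep pi_eps tE.
have aE : a = symb_scalar H (eps (iota tE)) + d by rewrite addrC subrK.
have WZ : \sum_i \sum_l rho (w i l) * rho (z l i) = rho (iota tF).
  rewrite !rmorph_sum; apply: eq_bigr => i _; rewrite -wz rmorph_sum.
  by apply: eq_bigr => l _; rewrite rmorphM.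
(* The scalar part of rho(tE) is central, so it leaves the sum and multiplies the trace of [F]; only
   the trace class part [d] stays enclosed between w and z. *)
have rT : rho (iota tT) = symb_scalar H (eps (iota tE)) * rho (iota tF) +
    \sum_i \sum_l rho (w i l) * d * rho (z l i).
  rewrite trT -WZ mulr_sumr -big_split rmorph_sum; apply: eq_bigr => i _.
  rewrite rmorph_sum mulr_sumr -big_split; apply: eq_bigr => l _ /=.
  rewrite !rmorphM /= -/a aE mulrDr mulrDl.
  by rewrite mulrA scal_central.
have Ls i l : symb_trace (rho (w i l) * d * rho (z l i)).
  have idL := symb_ideal (trace_idealP H).
  by apply: (idealMr idL); apply: (idealMl idL).
have Lss i : symb_trace (\sum_l rho (w i l) * d * rho (z l i)).
  by apply: (ideal_sum (symb_ideal (trace_idealP H))) => l _; exact: Ls.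
have eT : eps (iota tT) = eps (iota tE) * eps (iota tF).
  have : symb H (rho (iota tT)) = eps (iota tT) by [].
  rewrite rT rmorphD rmorphM /= => <-.
  rewrite [X in _ + X](_ : _ = 0) ?addr0 //.
  by have [_ ->] := ideal_sum (symb_ideal (trace_idealP H)) (index_enum J) (P := xpredT) (fun i _ => Lss i).
rewrite [LHS]surjective_pairing; congr pair; apply: (@intr_inj R[i]).
  by rewrite t0 eT rmorphM /= e0 f0.
rewrite t1 rmorphD !rmorphM /= e0 f1 e1 rF -[X in defect_trace tE * X]pmulrn.
have -> : defect_trace tT = symb_Tr (symb_scalar H (eps (iota tE)) * symb_defect (rho (iota tF)) +
    \sum_i \sum_l rho (w i l) * d * rho (z l i)).
  congr symb_Tr; rewrite /symb_defect rT [symb H _](_ : _ = eps (iota tE) * eps (iota tF)).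
    by rewrite [symb_scalar H (_ * _)]rmorphM mulrBr addrAC.
  by rewrite -rT -eT.
rewrite symb_TrD; last first.
- by apply: (ideal_sum (symb_ideal (trace_idealP H))) => i _; exact: Lss.
- apply: (idealMl (symb_ideal (trace_idealP H))).
  exact: (rep_symb_trace pi_rep pi_eps).
rewrite symb_Tr_scale; last exact: (rep_symb_trace pi_rep pi_eps).
congr (_ + _).
have trS := tr_sum (symb_ideal (trace_idealP H)) (@symb_TrD R H).
rewrite trS => [|i _]; last exact: Lss.
have tr2 i : symb_Tr (\sum_l rho (w i l) * d * rho (z l i)) =
    \sum_l symb_Tr (rho (w i l) * d * rho (z l i)) by rewrite trS // => l _; exact: Ls.
under eq_bigr => i _ do rewrite tr2.
transitivity (symb_Tr (symb_scalar H #|L|%:R * d)); last by rewrite symb_Tr_scale // mulrC.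
have idL := symb_ideal (trace_idealP H).
transitivity (\sum_l \sum_i symb_Tr (rho (z l i) * rho (w i l) * d)).
  rewrite exchange_big; apply: eq_bigr => l _; apply: eq_bigr => i _ /=.
  by rewrite -(symb_TrC (rho (z l i))) ?mulrA //; exact: (idealMl idL).
have Lz l i : symb_trace (rho (z l i) * rho (w i l) * d) by exact: (idealMl idL).
have tr3 l : \sum_i symb_Tr (rho (z l i) * rho (w i l) * d) =
    symb_Tr (\sum_i rho (z l i) * rho (w i l) * d) by rewrite trS // => i _; exact: Lz.
under eq_bigr => l _ do rewrite tr3.
rewrite -trS => [|l _]; last by apply: (ideal_sum idL) => i _; exact: Lz.
congr symb_Tr; rewrite rmorph_nat -sumr_const mulr_suml; apply: eq_bigr => l _.
rewrite -mulr_suml; congr (_ * d).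
have := congr1 rho (zw l l); rewrite eqxx rmorph1 rmorph_sum => <-.
by apply: eq_bigr => i _; rewrite rmorphM.
Qed.

Let chern_K0 (x : idem_mx Bbar) : int * int :=
  xget (0, 0) [set k | chern_pair (map_mx Psi (tagged (val x))) k]%classic.

Let chern_K0P n (p : 'M[Bbar]_n) pp : chern_pair (map_mx Psi p) (chern_K0 (@mk_idem Bbar n p pp)).
Proof.
rewrite /chern_K0 /=; apply: xgetPex; apply: chern_pair_exists; last exact: Psi_mx_compact.
by rewrite -map_mxM pp.
Qed.

Let chern_K0_val (x : idem_mx Bbar) : Zdual := zdual (chern_K0 x).1 (chern_K0 x).2.

(** The pair of [Psi] applied to an idempotent over [Bbar] respects both relations of [K0]. For
    idempotents coming from [B] it is the pair that defines [chern], by [Psi_j]. *)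
Lemma chern_K0_factor : exists chK : {additive K0 Bbar -> Zdual},
  forall (E : bimodule B B) (kappa : K0 Bbar), K0_image j E kappa ->
    zdual (chern E).1 (chern E).2 = chK kappa.
Proof.
have kil : kills (@K0_rel Bbar) chern_K0_val.
  move=> _ [m n p q pp qq x y px qy|m n p q pp qq pq];
    rewrite !feval_cons feval_nil /= addr0 !mulrNz !mulr1z /chern_K0_val.
    have idp : map_mx Psi p *m map_mx Psi p = map_mx Psi p by rewrite -map_mxM pp.
    rewrite (chern_pair_equiv idp (Psi_mx_compact x) (Psi_mx_compact y) _ _
      (chern_K0P pp) (chern_K0P qq)) ?subrr //.
      by rewrite -map_mxM -px.
    by rewrite -map_mxM -qy.
  have h := chern_pair_block (chern_K0P pp) (chern_K0P qq).
  have h' := chern_K0P pq; rewrite map_block_mx !map_mx0 in h'.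
  have idb : block_mx (map_mx Psi p) 0 0 (map_mx Psi q) *m block_mx (map_mx Psi p) 0 0 (map_mx Psi q)
      = block_mx (map_mx Psi p) 0 0 (map_mx Psi q).
    by rewrite mulmx_block !mul0mx !mulmx0 !addr0 !add0r -!map_mxM pp qq.
  have cb : scalar_mod (symb H) (symb_scalar H) (@symb_compact R H)
      (block_mx (map_mx Psi p) 0 0 (map_mx Psi q)).
    by have := Psi_mx_compact (block_mx p 0 0 q); rewrite map_block_mx !map_mx0.
  (* An idempotent is equivalent to itself through itself, so [chern_pair_equiv] also yields
     uniqueness of the pair. *)
  by rewrite (chern_pair_equiv idb cb cb idb idb h' h) /= -zdualD -opprD subrr.
have chKD := pres_liftD kil.
have chKB : {morph (pres_lift chern_K0_val : K0 Bbar -> Zdual) : x y / x - y}.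
  move=> x y; apply: (addIr (pres_lift chern_K0_val y)).
  by rewrite -chKD !subrK.
exists (HB.pack (pres_lift chern_K0_val : K0 Bbar -> Zdual)
  (GRing.isZmodMorphism.Build _ _ _ chKB) : {additive K0 Bbar -> Zdual}).
move=> E kappa [N [p [pp [idp Ep ->]]]] /=.
rewrite /K0_class (pres_lift_gen _ kil) /chern_K0_val.
have -> : chern E = chern_K0 (mk_idem pp); last by [].
have h := chernP idp Ep; have h' := chern_K0P pp.
have e : map_mx Psi (map_mx j p) = rep_mx p.
  by apply/matrixP => a b; rewrite !mxE Psi_j.
rewrite e in h'; have idr := rep_mx_idem idp; have c := rep_mx_compact p.
exact: (chern_pair_equiv idr c c idr idr h h').
Qed.

End Chern.

(** Idempotence of p is checked in [A], where u v u v = u v, and pulled back along the injection. *)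
Lemma trivializing_pair_idem (B A : nzRingType) (iota : {rmorphism B -> A})
  (iota_inj : injective iota) (E : bimodule B B) (r : nat)
  (Phi : {linear tensor_bimod E (ext_bimod iota) -> 'cV[A^c]_r})
  (N : nat) (u : 'M[A]_(N, r)) (v : 'M[A]_(r, N)) :
  trivializing_pair Phi u v -> exists p : 'M[B]_N,
    [/\ p *m p = p, iso_idem E p & map_mx iota p = u *m v].
Proof.
move=> [vu [p [f [g [puv _ _ fg gf]]]]]; exists p; split=> //.
  have ipp : map_mx iota (p *m p) = map_mx iota p.
    by rewrite map_mxM puv !mulmxA -(mulmxA u) vu mulmx1.
  apply/matrixP => i k; apply: iota_inj.
  by have := congr1 (fun X : 'M[A]_N => X i k) ipp; rewrite !mxE.
exists f; split=> [|x].
  by apply: (can_inj (g := g)) => e; case: (fg e).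
split=> [[e <-]|[y ->]]; first by have [[y ey] _] := fg e; exists y.
by exists (g (p *m y)); exact: gf.
Qed.

(* B and A are the two *-algebras, with inclusion iota; Bbar is the
   C*-enveloping algebra of B, with norm nrm and canonical map j. *)
Theorem proposition3p5 (R : realType) (B A Bbar : starAlgType R)
  (iota : {lrmorphism B -> A})
  (iota_inj : injective iota) (iota_star : star_preserving iota)
  (nrm : Bbar -> R) (j : {lrmorphism B -> Bbar})
  (envelope : is_cstar_envelope nrm j)
  (eps : {lrmorphism A -> R[i] | *%R})
  (eps_star : forall a, eps (star a) = (eps a)^*)
  (H : hilbertType R) (pi : A -> H -> H) (pi_rep : is_rep pi)
  (pi_eps : forall b : B,
     trace_class (fun x : H => pi (iota b) x - eps (iota b) *: x)) :
  exists ch0 ch1 : bimodule B B -> int,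
  let ch E := zdual (ch0 E) (ch1 E) in
  [/\ (* (i) *)
      [/\ (forall E F : bimodule B B, in_Vect iota E -> bimod_iso E F ->
             ch E = ch F),
          (forall (E : bimodule B B) (N : nat) (p : 'M[B]_N), in_Vect iota E ->
             p *m p = p -> iso_idem E p ->
             (ch0 E)%:~R = eps (iota (\tr p)) /\
             has_trace (fun x : H => pi (iota (\tr p)) x - eps (iota (\tr p)) *: x)
                       (ch1 E)%:~R),
          in_Vect_bi iota (unit_bimod B) /\ ch (unit_bimod B) = 1,
          (forall E F : bimodule B B,
             (in_Vect iota E -> in_Vect iota F ->
                in_Vect iota (sum_bimod E F) /\ ch (sum_bimod E F) = ch E + ch F) /\
             (in_Vect_bi iota E -> in_Vect_bi iota F ->
                in_Vect_bi iota (sum_bimod E F)))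
        & (forall E F : bimodule B B,
             (in_Vect iota E -> in_Vect_bi iota F ->
                in_Vect iota (tensor_bimod E F) /\
                ch (tensor_bimod E F) = ch E * ch F) /\
             (in_Vect_bi iota E -> in_Vect_bi iota F ->
                in_Vect_bi iota (tensor_bimod E F)))],
      (* (ii) *)
      (exists chK : {additive K0 Bbar -> Zdual},
         forall (E : bimodule B B) (kappa : K0 Bbar),
           in_Vect iota E -> K0_image j E kappa -> ch E = chK kappa),
      (* (iii) *)
      (forall (E : bimodule B B) (r : nat)
         (Phi : {linear tensor_bimod E (ext_bimod iota) -> 'cV[A^c]_r})
         (N : nat) (u : 'M[A]_(N, r)) (v : 'M[A]_(r, N)),
         in_Vect iota E -> trivialization Phi -> trivializing_pair Phi u v ->
         ch0 E = r%:Z)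
    & (forall (E E' : bimodule B B) (r r' : nat)
         (Phi : {linear tensor_bimod E (ext_bimod iota) -> 'cV[A^c]_r})
         (Phi' : {linear tensor_bimod E' (ext_bimod iota) -> 'cV[A^c]_r'})
         (N N' : nat) (u : 'M[A]_(N, r)) (v : 'M[A]_(r, N))
         (u' : 'M[A]_(N', r')) (v' : 'M[A]_(r', N')) (kappa : K0 Bbar),
         in_Vect iota E -> trivialization Phi -> trivializing_pair Phi u v ->
         in_Vect iota E' -> trivialization Phi' -> trivializing_pair Phi' u' v' ->
         K0_image j E kappa -> K0_image j E' kappa -> r = r')].
Proof.
have [Psi [Psi_j Psi_compact]] := envelope_extension iota_star envelope eps_star pi_rep pi_eps.
pose ch := chern iota eps pi_rep.
(* Tr(u v) and Tr(v u) may differ in [A]; after applying the character they agree, and the latter is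
   the trace of an identity matrix of size r. *)
have pair_rank (E : bimodule B B) (r : nat)
    (Phi : {linear tensor_bimod E (ext_bimod iota) -> 'cV[A^c]_r})
    (N : nat) (u : 'M[A]_(N, r)) (v : 'M[A]_(r, N)) :
    trivializing_pair Phi u v -> (ch E).1 = r%:Z.
  move=> uv; have [p [pp Ep puv]] := trivializing_pair_idem iota_inj uv.
  apply: (@intr_inj R[i]); rewrite (chern_idem pi_rep pi_eps pp Ep).1.
  transitivity (eps (\tr (u *m v))); first by rewrite -puv -trace_map_mx.
  have vu := uv.1; rewrite -[LHS]trace_map_mx map_mxM mxtrace_mulC -map_mxM vu map_mx1.
  by rewrite mxtrace1 -pmulrn.
have [chK chKP] := chern_K0_factor pi_eps Psi_j Psi_compact.
exists (fun E => (ch E).1), (fun E => (ch E).2) => /=; split.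
- split.
  + by move=> E F VE EF; rewrite /ch (chern_iso pi_rep pi_eps VE EF).
  + move=> E N p _ pp Ep; have [c0 c1] := chern_idem pi_rep pi_eps pp Ep; split=> //.
    by rewrite c1; exact: (has_trace_defect pi_eps).
  + split; last by rewrite /ch (chern_unit pi_rep pi_eps) zdual1.
    by apply: (data_in_Vect_bi _ (unit_data iota) (unit_left iota)); rewrite card_unit.
  + move=> E F; split=> [/in_Vect_data [n [r [g [phi [u [v [r0 dE]]]]]]]|].
      move=> /in_Vect_data [m [s [h [psi [w [z [s0 dF]]]]]]]; split.
        by apply: (data_in_Vect _ (sum_data dE dF)); rewrite card_sum !card_ord addn_gt0 r0.
      by rewrite /ch (chern_sum pi_rep pi_eps dE dF) zdualD.
    move=> /in_Vect_bi_data [n [r [g [phi [u [v [r0 dE lE]]]]]]].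
    move=> /in_Vect_bi_data [m [s [h [psi [w [z [s0 dF lF]]]]]]].
    by apply: (data_in_Vect_bi _ (sum_data dE dF) (sum_left dE dF lE lF));
      rewrite card_sum !card_ord addn_gt0 r0.
  + move=> E F; split=> [/in_Vect_data [n [r [g [phi [u [v [r0 dE]]]]]]]|].
      move=> /in_Vect_bi_data [m [s [h [psi [w [z [s0 dF lF]]]]]]]; split.
        by apply: (data_in_Vect _ (tensor_data dE dF lF)); rewrite card_prod !card_ord muln_gt0 r0.
      by rewrite /ch (chern_tensor pi_rep pi_eps dE dF lF) zdualM.
    move=> /in_Vect_bi_data [n [r [g [phi [u [v [r0 dE lE]]]]]]].
    move=> /in_Vect_bi_data [m [s [h [psi [w [z [s0 dF lF]]]]]]].
    by apply: (data_in_Vect_bi _ (tensor_data dE dF lF) (tensor_left dE dF lF lE));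
      rewrite card_prod !card_ord muln_gt0 r0.
- by exists chK => E kappa _; exact: chKP.
- by move=> E r Phi N u v _ _; exact: pair_rank.
move=> E E' r r' Phi Phi' N N' u v u' v' kappa _ _ uv _ _ uv' kE kE'.
have [e0 _] := zdual_inj (etrans (chKP E kappa kE) (esym (chKP E' kappa kE'))).
by have := pair_rank _ _ _ _ _ _ uv; rewrite e0 (pair_rank _ _ _ _ _ _ uv') => -[].
Qed.
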